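(* Let $n$ be a power of $2$, let $A$ be an array of $n$ real numbers $A[0],\dots,A[n-1]$, let $f\colon[0,n)\to\mathbb{R}$ be a function, and put $p:=p_f$. Assume that the oracles $\mathrm{EVO}$ and $\mathrm{SPO}$ are available. Then there exists a data structure $T$ (the augmented segment tree) supporting the following two operations: (1) $T.build(A)$, which builds the data structure for $A$ with worst-case $\mathrm{SPO}$-oracle complexity and arithmetic complexity $O\bigl(n^{\log_2(p)+\frac{1}{1+\log_2(p)}}\bigr)$; (2) $T.query(i,j,x)$, which, for $x\in\{0,\dots,n-1\}$ and $i,j\in\{0,\dots,n\}$, returns $F([i,j);x)$, with worst-case $\mathrm{EVO}$-oracle complexity and arithmetic complexity $O(\log^2(n))$. The data structure uses $O\bigl(n^{\log_2(p)+\frac{1}{1+\log_2(p)}}\bigr)$ space. All calls to $\mathrm{SPO}$ are made for functions of the form $g(x)=f(x+a)-f(x+b)+c$ with $a,b\in\mathbb{Z}_{\ge 0}$ and $c\in\mathbb{Z}$, and all calls to $\mathrm{EVO}$ are made for $f$.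
   Context: For an array $A$ of length $n$, a function $f\colon[0,n)\to\mathbb{R}$, $x\in\{0,\dots,n-1\}$ and $i\le j$ in $\{0,\dots,n\}$, define $F([i,j);x)=\min_{0\le k<j-i}\{A[i+k]+f(x+k)\}$. An interval $[a,b)\subseteq\mathbb{R}$ is called integer if $a,b\in\mathbb{Z}$. For a function $h$ and an integer interval $I\subseteq\mathrm{dom}(h)$, a minimal sign partition of $h$ on $I$ is a set of integer intervals $I_1,\dots,I_m$ of minimum possible cardinality such that $I_1,\dots,I_m$ partition $I$ and, for each $j$, one of the following holds for all $x\in I_j$: $h(x)\ge 0$; or $h(x)\le 0$; or $h(x)>0$; or $h(x)<0$. The set of all minimal sign partitions is denoted $\mathcal{PS}(h,I)$. For a function $f$ on an integer interval, $a\in\mathbb{R}_{\ge0}$, $b\in\mathbb{R}$, put $g_{ab}(x)=f(x+a)-f(x)+b$; define $p_f(a,b,J)=\max\{|\mathcal{P}|:\mathcal{P}\in\mathcal{PS}(g_{ab},J)\}$ and $p_f=\max\{p_f(a,b,J): a\in\mathbb{R}_{\ge0},\ b\in\mathbb{R},\ J\subseteq\mathrm{dom}(g_{ab})\text{ an integer interval}\}$. The evaluation oracle $\mathrm{EVO}$, given a function and a point $x$ of its domain, returns its value at $x$ (and can compare values of the function at two points). The minimal sign partition oracle $\mathrm{SPO}$, given a function $h$ and an integer interval $I\subseteq\mathrm{dom}(h)$, returns some element of $\mathcal{PS}(h,I)$. Complexity counts elementary arithmetic operations (resp. oracle calls).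
   Formalization: Signs in a minimal sign partition are tested only at integer points (over real x such partitions, hence p_f and SPO, need not exist); in F([i,j);x) indices k with x+k ≥ n, where f is undefined, are dropped, and an empty minimum is +∞. *)

(* Defs.v *)
(* Stdlib real numbers; Coquelicot only for the extended reals [Rbar]. *)
From Stdlib Require Import Reals ZArith List Lia Lra ClassicalEpsilon.
From Coquelicot Require Import Rbar.
Import ListNotations.
Open Scope R_scope.

Definition lg (x : R) : R := ln x / ln 2.

(** * Range minima *)

(** [F n A f i j x] is the minimum of [A[i+k] + f(x+k)] over [0 <= k < j - i].
    Since [f] lives on [[0,n)], the indices with [x + k >= n] do not contribute
    (equivalently, [f] is [+oo] there), and the minimum of nothing is [+oo]. *)
Definition F (n : nat) (A : list R) (f : R -> R) (i j x : nat) : Rbar :=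
  fold_right Rbar_min p_infty
    (map (fun k => Finite (nth (i + k) A 0 + f (INR (x + k))))
       (filter (fun k => Nat.ltb (x + k) n) (seq 0 (j - i)))).

(** * Minimal sign partitions *)

(** The pair [(l, r)] stands for the integer interval [[l, r)] of reals. *)
Definition interval : Type := (Z * Z)%type.

Definition in_itv (K : interval) (x : R) : Prop :=
  IZR (fst K) <= x < IZR (snd K).

(** A finite set of intervals is a list; blocks are nonempty and pairwise
    disjoint, so the list has no repetition and its length is the cardinality
    of the set. The order of the list is irrelevant. *)
Definition partitions (P : list interval) (I : interval) : Prop :=
  (forall K, In K P -> exists x, in_itv K x) /\
  ForallOrdPairs (fun K L => forall x, ~ (in_itv K x /\ in_itv L x)) P /\
  (forall x, in_itv I x <-> exists K, In K P /\ in_itv K x).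

(** Signs are taken at the integer points: with real points a function whose
    sign changes strictly between two integers would have no partition into
    integer intervals at all. *)
Definition one_sign (h : R -> R) (K : interval) : Prop :=
  (forall z : Z, in_itv K (IZR z) -> h (IZR z) >= 0) \/
  (forall z : Z, in_itv K (IZR z) -> h (IZR z) <= 0) \/
  (forall z : Z, in_itv K (IZR z) -> h (IZR z) > 0) \/
  (forall z : Z, in_itv K (IZR z) -> h (IZR z) < 0).

Definition sign_partition (h : R -> R) (I : interval) (P : list interval) : Prop :=
  partitions P I /\ (forall K, In K P -> one_sign h K).

Definition PS (h : R -> R) (I : interval) (P : list interval) : Prop :=
  sign_partition h I P /\
  (forall Q, sign_partition h I Q -> (length P <= length Q)%nat).

Definition is_max (E : nat -> Prop) (m : nat) : Prop :=
  E m /\ (forall k, E k -> (k <= m)%nat).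

Definition maximum (E : nat -> Prop) : nat := epsilon (inhabits 0%nat) (is_max E).

Definition gab (f : R -> R) (a b : R) (x : R) : R := f (x + a) - f x + b.

Definition pf_on (f : R -> R) (a b : R) (J : interval) : nat :=
  maximum (fun m => exists P, PS (gab f a b) J P /\ m = length P).

(** [f] is a function on [[0,n)], whence the domain of [gab f a b]. *)
Definition pf (n : nat) (f : R -> R) : nat :=
  maximum (fun m => exists (a b : R) (J : interval),
    0 <= a /\ (fst J <= snd J)%Z /\
    (forall x, in_itv J x -> 0 <= x < INR n /\ 0 <= x + a < INR n) /\
    m = pf_on f a b J).

(** * Well-definedness: minimal sign partitions and the maxima above exist *)

Lemma maximum_spec (E : nat -> Prop) (B : nat) :
  (exists m, E m) -> (forall m, E m -> (m <= B)%nat) -> is_max E (maximum E).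
Proof.
intros [m0 Hm0] HB. apply (epsilon_spec (inhabits 0%nat) (is_max E)).
revert HB. induction B as [|B IH]; intros HB.
- exists m0. split; [exact Hm0|]. intros k Hk. specialize (HB k Hk). lia.
- destruct (classic (E (S B))) as [H|H].
  + exists (S B). split; assumption.
  + apply IH. intros m Hm. specialize (HB m Hm).
    assert (m <> S B) by (intros ->; contradiction). lia.
Qed.

Lemma unit_partition (h : R -> R) (l : Z) (k : nat) :
  exists P, sign_partition h (l, l + Z.of_nat k)%Z P /\ length P = k /\
    (forall K, In K P -> (l <= fst K)%Z).
Proof.
revert l. induction k as [|k IH]; intros l.
- exists []. split; [|split; [reflexivity|now intros K []]].
  split; [|now intros K []]. split; [now intros K []|]. split; [constructor|].
  intros x; split; [|now intros [K [[] _]]].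
  unfold in_itv; simpl. rewrite Z.add_0_r. lra.
- destruct (IH (l + 1)%Z) as [P [[[Hne [Hd Hu]] Hs] [Hl Hlow]]].
  exists ((l, (l + 1)%Z) :: P). repeat split.
  + intros K [<-|HK]; [|exact (Hne K HK)].
    exists (IZR l). unfold in_itv; simpl. rewrite plus_IZR. lra.
  + constructor; [|exact Hd]. apply Forall_forall. intros L HL x [[_ H1] [H2 _]].
    apply Hlow, IZR_le in HL. simpl in H1. lra.
  + intros H. destruct (Rlt_le_dec x (IZR (l + 1))) as [Hx|Hx].
    * exists (l, (l + 1)%Z). split; [now left|]. split; [apply H|exact Hx].
    * destruct (proj1 (Hu x)) as [K [HK HxK]].
      -- split; simpl; [exact Hx|]. destruct H as [_ H]; simpl in H.
         replace (l + 1 + Z.of_nat k)%Z with (l + Z.pos (Pos.of_succ_nat k))%Z by lia.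
         exact H.
      -- exists K. split; [now right|exact HxK].
  + destruct H as [K [[<-|HK] HxK]]; [apply HxK|].
    assert (H := proj2 (Hu x) (ex_intro _ K (conj HK HxK))). destruct H as [H _].
    simpl in *. rewrite plus_IZR in H. lra.
  + destruct H as [K [[<-|HK] HxK]].
    * destruct HxK as [_ H]; simpl in *. apply Rlt_le_trans with (1 := H). apply IZR_le. lia.
    * assert (H := proj2 (Hu x) (ex_intro _ K (conj HK HxK))). destruct H as [_ H].
      simpl in *.
      replace (l + Z.pos (Pos.of_succ_nat k))%Z with (l + 1 + Z.of_nat k)%Z by lia.
      exact H.
  + intros K [<-|HK]; [|exact (Hs K HK)].
    assert (Hz : forall z, in_itv (l, (l + 1)%Z) (IZR z) -> z = l).
    { intros z [H1 H2]; simpl in *. apply le_IZR in H1. apply lt_IZR in H2. lia. }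
    destruct (Rle_lt_dec 0 (h (IZR l))) as [H|H].
    * left. intros z Hzl. rewrite (Hz z Hzl). lra.
    * right; left. intros z Hzl. rewrite (Hz z Hzl). lra.
  + simpl. now rewrite Hl.
  + intros K [<-|HK]; [simpl; lia|]. specialize (Hlow K HK). lia.
Qed.

Lemma PS_nonempty (h : R -> R) (I : interval) :
  (fst I <= snd I)%Z ->
  exists P, PS h I P /\ (length P <= Z.to_nat (snd I - fst I))%nat.
Proof.
destruct I as [l r]; simpl; intros Hlr.
destruct (unit_partition h l (Z.to_nat (r - l))) as [P0 [HP0 [Hl0 _]]].
replace (l + Z.of_nat (Z.to_nat (r - l)))%Z with r in HP0 by lia.
rewrite <- Hl0. clear Hl0.
remember (length P0) as k eqn:Hk. revert P0 HP0 Hk.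
induction k as [k IH] using lt_wf_ind. intros P0 HP0 Hk.
destruct (classic (exists Q, sign_partition h (l, r) Q /\ (length Q < k)%nat))
  as [[Q [HQ Hlt]]|Hno].
- destruct (IH _ Hlt Q HQ eq_refl) as [P [HP HPl]]. exists P. split; [exact HP|lia].
- exists P0. split; [|lia]. split; [exact HP0|]. intros Q HQ.
  destruct (Nat.le_gt_cases (length P0) (length Q)) as [H|H]; [exact H|].
  exfalso. apply Hno. exists Q. split; [exact HQ|lia].
Qed.

Lemma pf_on_spec (f : R -> R) (a b : R) (J : interval) :
  (fst J <= snd J)%Z ->
  is_max (fun m => exists P, PS (gab f a b) J P /\ m = length P) (pf_on f a b J) /\
  (pf_on f a b J <= Z.to_nat (snd J - fst J))%nat.
Proof.
intros HJ. destruct (PS_nonempty (gab f a b) J HJ) as [P [HP HPl]].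
assert (H : is_max (fun m => exists P, PS (gab f a b) J P /\ m = length P) (pf_on f a b J)).
{ apply maximum_spec with (B := length P).
  - exists (length P), P. now split.
  - intros m [Q [[_ HQ] ->]]. apply HQ, HP. }
split; [exact H|]. destruct H as [[Q [[_ HQ] ->]] _].
apply Nat.le_trans with (2 := HPl). apply HQ, HP.
Qed.

Lemma pf_spec (n : nat) (f : R -> R) :
  is_max (fun m => exists (a b : R) (J : interval),
    0 <= a /\ (fst J <= snd J)%Z /\
    (forall x, in_itv J x -> 0 <= x < INR n /\ 0 <= x + a < INR n) /\
    m = pf_on f a b J) (pf n f).
Proof.
apply maximum_spec with (B := n).
- exists (pf_on f 0 0 (0, 0)%Z), 0, 0, (0, 0)%Z.
  split; [lra|split; [simpl; lia|split; [|reflexivity]]].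
  intros x [H1 H2]; simpl in *; lra.
- intros m [a [b [[l r] [Ha [HJ [Hd ->]]]]]]. simpl in HJ.
  apply Nat.le_trans with (1 := proj2 (pf_on_spec f a b (l, r) HJ)). simpl.
  destruct (Z.eq_dec l r) as [->|Hne]; [lia|].
  assert (Hl : in_itv (l, r) (IZR l)) by (split; simpl; [lra|apply IZR_lt; lia]).
  assert (Hr : in_itv (l, r) (IZR (r - 1))) by (split; simpl; [apply IZR_le|apply IZR_lt]; lia).
  apply Hd in Hl. apply Hd in Hr. destruct Hl as [[Hl _] _]. destruct Hr as [[_ Hr] _].
  apply le_IZR in Hl. rewrite INR_IZR_INZ in Hr. apply lt_IZR in Hr. lia.
Qed.

(** * A real RAM with oracles

    Programs are finite, fixed texts (independent of the input) working on
    integer arrays and real arrays, named by natural numbers and initially zero;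
    a register is a cell of an array at a constant index. The only constants are
    integers, and there is no conversion from reals to integers. *)

Record state := mkState { zmem : nat -> Z -> Z; rmem : nat -> Z -> R }.

Inductive zop := ZAdd | ZSub | ZMul | ZDiv | ZMod.

Inductive zexp :=
| ZLit (c : Z)
| ZGet (a : nat) (i : zexp)
| ZOp (o : zop) (e1 e2 : zexp).

Inductive rop := RAdd | RSub | RMul | RDiv.

Inductive rexp :=
| ROfZ (e : zexp)
| RGet (a : nat) (i : zexp)
| ROp (o : rop) (e1 e2 : rexp).

Inductive bexp :=
| BZle (e1 e2 : zexp)
| BRle (e1 e2 : rexp)
| BNot (b : bexp)
| BAnd (b1 b2 : bexp).

(** Functions that a program may hand to an oracle: everything that can be
    obtained from the given function [f] by these operations. *)
Inductive fexp :=
| FSelf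
| FConst (c : rexp)
| FShift (F1 : fexp) (a : zexp)
| FAdd (F1 F2 : fexp)
| FSub (F1 F2 : fexp).

Inductive com :=
| Skip
| ZSet (a : nat) (i e : zexp)
| RSet (a : nat) (i : zexp) (e : rexp)
| Seq (c1 c2 : com)
| If (b : bexp) (c1 c2 : com)
| While (b : bexp) (c : com)
| Eval (a : nat) (i : zexp) (h : fexp) (x : rexp)
| Compare (a : nat) (i : zexp) (h : fexp) (x y : rexp)
| SignPart (a : nat) (i : zexp) (h : fexp) (l r : zexp).

Definition zop_sem (o : zop) : Z -> Z -> Z :=
  match o with
  | ZAdd => Z.add | ZSub => Z.sub | ZMul => Z.mul | ZDiv => Z.div | ZMod => Z.modulo
  end.

Definition rop_sem (o : rop) : R -> R -> R :=
  match o with RAdd => Rplus | RSub => Rminus | RMul => Rmult | RDiv => Rdiv end.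

Fixpoint zeval (s : state) (e : zexp) : Z :=
  match e with
  | ZLit c => c
  | ZGet a i => zmem s a (zeval s i)
  | ZOp o e1 e2 => zop_sem o (zeval s e1) (zeval s e2)
  end.

Fixpoint reval (s : state) (e : rexp) : R :=
  match e with
  | ROfZ e => IZR (zeval s e)
  | RGet a i => rmem s a (zeval s i)
  | ROp o e1 e2 => rop_sem o (reval s e1) (reval s e2)
  end.

Definition Rleb (x y : R) : bool := if Rle_dec x y then true else false.

Fixpoint beval (s : state) (b : bexp) : bool :=
  match b with
  | BZle e1 e2 => Z.leb (zeval s e1) (zeval s e2)
  | BRle e1 e2 => Rleb (reval s e1) (reval s e2)
  | BNot b => negb (beval s b)
  | BAnd b1 b2 => andb (beval s b1) (beval s b2)
  end.

Fixpoint feval (f : R -> R) (s : state) (h : fexp) (x : R) : R :=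
  match h with
  | FSelf => f x
  | FConst c => reval s c
  | FShift h a => feval f s h (x + IZR (zeval s a))
  | FAdd h1 h2 => feval f s h1 x + feval f s h2 x
  | FSub h1 h2 => feval f s h1 x - feval f s h2 x
  end.

Fixpoint fdom (n : nat) (s : state) (h : fexp) (x : R) : Prop :=
  match h with
  | FSelf => 0 <= x < INR n
  | FConst _ => True
  | FShift h a => fdom n s h (x + IZR (zeval s a))
  | FAdd h1 h2 | FSub h1 h2 => fdom n s h1 x /\ fdom n s h2 x
  end.

(** Number of elementary operations needed to evaluate an expression. *)
Fixpoint zcost (e : zexp) : nat :=
  match e with
  | ZLit _ => 1
  | ZGet _ i => S (zcost i)
  | ZOp _ e1 e2 => S (zcost e1 + zcost e2)
  end.

Fixpoint rcost (e : rexp) : nat :=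
  match e with
  | ROfZ e => S (zcost e)
  | RGet _ i => S (zcost i)
  | ROp _ e1 e2 => S (rcost e1 + rcost e2)
  end.

Fixpoint bcost (b : bexp) : nat :=
  match b with
  | BZle e1 e2 => S (zcost e1 + zcost e2)
  | BRle e1 e2 => S (rcost e1 + rcost e2)
  | BNot b => S (bcost b)
  | BAnd b1 b2 => S (bcost b1 + bcost b2)
  end.

Fixpoint fcost (h : fexp) : nat :=
  match h with
  | FSelf => 1
  | FConst c => S (rcost c)
  | FShift h a => S (fcost h + zcost a)
  | FAdd h1 h2 | FSub h1 h2 => S (fcost h1 + fcost h2)
  end.

Definition upd {X : Type} (m : nat -> Z -> X) (a : nat) (i : Z) (v : X) : nat -> Z -> X :=
  fun a' i' => if andb (Nat.eqb a' a) (Z.eqb i' i) then v else m a' i'.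

Fixpoint upds {X : Type} (m : nat -> Z -> X) (a : nat) (i : Z) (vs : list X) : nat -> Z -> X :=
  match vs with
  | [] => m
  | v :: vs => upds (upd m a i v) a (i + 1)%Z vs
  end.

(** An [SPO] answer [{[l1,r1), ..., [lm,rm)}] is delivered as [m, l1, r1, ..., lm, rm]. *)
Definition encode (P : list interval) : list Z :=
  Z.of_nat (length P) :: flat_map (fun K => [fst K; snd K]) P.

Definition spo_oracle : Type := (R -> R) -> interval -> list interval.

Definition spo_correct (spo : spo_oracle) : Prop :=
  forall h I, (fst I <= snd I)%Z -> PS h I (spo h I).

Lemma spo_exists : exists spo, spo_correct spo.
Proof.
exists (fun h I => epsilon (inhabits []) (PS h I)). intros h I HI.
apply (epsilon_spec (inhabits []) (PS h I)). destruct (PS_nonempty h I HI) as [P [HP _]]. now exists P.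
Qed.

Inductive call :=
| CallEval (h : R -> R) (x : R)
| CallCompare (h : R -> R) (x y : R)
| CallSPO (h : R -> R) (I : interval).

Definition is_evo (c : call) : bool :=
  match c with CallEval _ _ | CallCompare _ _ _ => true | CallSPO _ _ => false end.

Definition evo_calls (L : list call) : nat := length (filter is_evo L).
Definition spo_calls (L : list call) : nat := length (filter (fun c => negb (is_evo c)) L).

(** The setting of a run: [f] is a function on [[0,n)], and every array has the
    cells [0, ..., space - 1]. *)
Record env := mkEnv { dim : nat; fn : R -> R; spo : spo_oracle; space : nat }.

Definition in_space (E : env) (i : Z) : Prop := (0 <= i < Z.of_nat (space E))%Z.

(** [exec E c s s' t L]: the run of [c] from [s] terminates in [s'] after [t]
    elementary operations, making the oracle calls [L]. There is no such run if
    [c] writes outside the available space (reading there yields the initial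
    value [0]) or calls an oracle outside the domain of the function. *)
Inductive exec (E : env) : com -> state -> state -> nat -> list call -> Prop :=
| exec_Skip s : exec E Skip s s 1 []
| exec_ZSet s a i e :
    in_space E (zeval s i) ->
    exec E (ZSet a i e) s (mkState (upd (zmem s) a (zeval s i) (zeval s e)) (rmem s))
      (1 + zcost i + zcost e) []
| exec_RSet s a i e :
    in_space E (zeval s i) ->
    exec E (RSet a i e) s (mkState (zmem s) (upd (rmem s) a (zeval s i) (reval s e)))
      (1 + zcost i + rcost e) []
| exec_Seq s s1 s2 c1 c2 t1 t2 L1 L2 :
    exec E c1 s s1 t1 L1 -> exec E c2 s1 s2 t2 L2 ->
    exec E (Seq c1 c2) s s2 (1 + t1 + t2) (L1 ++ L2)
| exec_If s s' b c1 c2 t L :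
    exec E (if beval s b then c1 else c2) s s' t L ->
    exec E (If b c1 c2) s s' (1 + bcost b + t) L
| exec_While_false s b c :
    beval s b = false ->
    exec E (While b c) s s (1 + bcost b) []
| exec_While_true s s1 s2 b c t1 t2 L1 L2 :
    beval s b = true ->
    exec E c s s1 t1 L1 -> exec E (While b c) s1 s2 t2 L2 ->
    exec E (While b c) s s2 (1 + bcost b + t1 + t2) (L1 ++ L2)
| exec_Eval s a i h x :
    in_space E (zeval s i) ->
    fdom (dim E) s h (reval s x) ->
    exec E (Eval a i h x) s
      (mkState (zmem s)
         (upd (rmem s) a (zeval s i) (feval (fn E) s h (reval s x))))
      (1 + zcost i + fcost h + rcost x)
      [CallEval (feval (fn E) s h) (reval s x)]
| exec_Compare s a i h x y :
    in_space E (zeval s i) ->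
    fdom (dim E) s h (reval s x) -> fdom (dim E) s h (reval s y) ->
    exec E (Compare a i h x y) s
      (mkState
         (upd (zmem s) a (zeval s i)
            (if Rleb (feval (fn E) s h (reval s x)) (feval (fn E) s h (reval s y))
             then 1 else 0)%Z)
         (rmem s))
      (1 + zcost i + fcost h + rcost x + rcost y)
      [CallCompare (feval (fn E) s h) (reval s x) (reval s y)]
| exec_SignPart s a i h l r out :
    (zeval s l <= zeval s r)%Z ->
    (forall x, in_itv (zeval s l, zeval s r) x -> fdom (dim E) s h x) ->
    out = encode (spo E (feval (fn E) s h) (zeval s l, zeval s r)) ->
    (0 <= zeval s i)%Z ->
    (zeval s i + Z.of_nat (length out) <= Z.of_nat (space E))%Z ->
    exec E (SignPart a i h l r) s
      (mkState (upds (zmem s) a (zeval s i) out) (rmem s))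
      (1 + zcost i + fcost h + zcost l + zcost r)
      [CallSPO (feval (fn E) s h) (zeval s l, zeval s r)].

(** * Calling conventions *)

(** Before [build]: [n] in cell 0 of integer array 0, and [A] in real array 0. *)
Definition init (n : nat) (A : list R) : state :=
  mkState
    (upd (fun _ _ => 0%Z) 0 0 (Z.of_nat n))
    (fun a i => if andb (Nat.eqb a 0) (Z.leb 0 i) then nth (Z.to_nat i) A 0 else 0).

(** Before [query]: [i], [j], [x] in cells 1, 2, 3 of integer array 0. *)
Definition with_args (i j x : nat) (s : state) : state :=
  mkState (upds (zmem s) 0 1 [Z.of_nat i; Z.of_nat j; Z.of_nat x]) (rmem s).

(** After [query]: cell 0 of real array 1, or [+oo] if cell 0 of integer
    array 1 is zero. *)
Definition result (s : state) : Rbar :=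
  if Z.eqb (zmem s 1%nat 0%Z) 0 then p_infty else Finite (rmem s 1%nat 0%Z).

Definition admissible (f : R -> R) (L : list call) : Prop :=
  forall cl, In cl L ->
    match cl with
    | CallEval h _ | CallCompare h _ _ => forall x, h x = f x
    | CallSPO h _ =>
        exists a b c : Z, (0 <= a)%Z /\ (0 <= b)%Z /\
          (forall x, h x = f (x + IZR a) - f (x + IZR b) + IZR c)
    end.

(* Main.v *)
(** With [s = x - i], the value [A[i+k] + f(x+k)] is [A[w] + f(s+w)] for the
    position [w = i + k], so that [F([i,j);x)] is the minimum over [w] in
    [[i, j)], and all nodes of a segment tree are queried at the same [s].
    Each node stores the leftmost minimizer as a piecewise constant function of
    [s]; a query looks up [O(log n)] nodes, each by binary search.

    A node is obtained from its two children by comparing, on the runs where both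
    minimizers are constant, [A[w] + f(s+w)] with [A[w'] + f(s+w')], that is, by
    finding the sign changes of [f(y+a) - f(y) + c] for [y = s + w] and
    [a = w' - w]. As the numbers [A[w]] are real while sign partitions are
    available for integral [c] only, the changes are located by evaluations of
    [f] alone. On a level with nodes of length [l <= sqrt n], the minima and maxima
    of [f(y+a) - f(y)] over all windows of length about [sqrt (n/l)] are
    precomputed for every [a < l]; a window without sign change is skipped in one
    step. On higher levels one scans all [s]. If [f] is affine on the integers,
    there are no sign changes at all.

    For [p = 1], [f] is affine and the time is linear. For [p = 2], [f] is convex
    or concave on the integers, so each node has at most as many pieces as
    positions, and the time is [O(n^(3/2))]. For [p = 3], the number of pieces
    grows by a factor of at most 6 per level, and counting skipped windows only
    for nodes of length at most [n^(1/4)] gives [O(n^(19/10))]. For [p >= 4] the exponent is at least 2,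
    which is enough to scan everywhere. *)
Require Import Defs.
From Stdlib Require Import Reals ZArith List Lia Lra Bool Psatz FinFun ClassicalEpsilon.
From Coquelicot Require Import Rbar.
Import ListNotations.
Open Scope R_scope.

(** The window length balances two costs. With windows of length [B], a merge with [c] runs makes at
    most about [n/B] skips and [B * c] single steps, since a window that cannot be skipped contains
    the end of a run. For nodes of length [l] and [c] about [l], the choice [B = sqrt (n/l)] makes
    both terms [sqrt (n * l)]; the [n/l] nodes of the level then cost [n^(3/2) / sqrt l], a
    geometric series. The table rows for all shifts [a < l] have [l * n] entries, which stays within
    [n^(3/2)] as long as [l <= sqrt n]; for longer nodes scanning costs [n^2 / l] per level, again
    at most [n^(3/2)]. The number of runs depends on the shape of [f], of which the program knows
    nothing. Program and combinatorics therefore meet in a potential: the merge loop is verified for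
    any potential that decreases with each move it may make, and bounds on [pf] supply such
    potentials. A node is described only for those [s] for which all its positions [s + w] lie in
    the domain of [f]; a query first cuts [[i, j)] at [n - s], so that it never leaves these
    ranges. *)

(** * Counting in integer intervals *)

Lemma Rleb_true (x y : R) : Rleb x y = true <-> x <= y.
Proof. unfold Rleb. destruct (Rle_dec x y); split; easy. Qed.

Lemma Rleb_false (x y : R) : Rleb x y = false <-> y < x.
Proof. unfold Rleb. destruct (Rle_dec x y); split; intros; try easy; lra. Qed.

Fixpoint count (P : Z -> bool) (u : Z) (d : nat) : nat :=
  match d with
  | O => 0
  | S d => (if P u then 1 else 0) + count P (u + 1) d
  end.

Lemma count_le P d : forall u, (count P u d <= d)%nat.
Proof. induction d; intros u; simpl; [lia|]. specialize (IHd (u+1)%Z). destruct (P u); lia. Qed.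

Lemma count_split P d2 d1 : forall u,
  count P u (d1 + d2) = (count P u d1 + count P (u + Z.of_nat d1) d2)%nat.
Proof.
induction d1; intros u; simpl; [now rewrite Z.add_0_r|].
rewrite IHd1. replace (u + 1 + Z.of_nat d1)%Z with (u + Z.pos (Pos.of_succ_nat d1))%Z by lia. lia.
Qed.

Lemma count_or P Q R d : forall u,
  (forall z, (u <= z < u + Z.of_nat d)%Z -> P z = true -> Q z = true \/ R z = true) ->
  (count P u d <= count Q u d + count R u d)%nat.
Proof.
induction d; intros u H; simpl; [lia|].
assert (IH := IHd (u+1)%Z). assert (H0 := H u ltac:(lia)).
specialize (IH ltac:(intros z Hz; apply H; lia)).
destruct (P u); [destruct (H0 eq_refl) as [E|E]; rewrite E|]; repeat (match goal with |- context [if ?b then _ else _] => destruct b end); lia.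
Qed.

Lemma count_false P d : forall u, (forall z, (u <= z < u + Z.of_nat d)%Z -> P z = false) -> count P u d = 0%nat.
Proof.
induction d; intros u H; simpl; [lia|]. rewrite H by lia. rewrite IHd; [lia|]. intros; apply H; lia.
Qed.

Lemma count_mono P Q u d :
  (forall z, (u <= z < u + Z.of_nat d)%Z -> P z = true -> Q z = true) ->
  (count P u d <= count Q u d)%nat.
Proof.
intros H. transitivity (count P u d + 0)%nat; [lia|].
pose proof (count_or P Q (fun _ => false) d u ltac:(intros; left; auto)) as E.
rewrite (count_false (fun _ => false)) in E by auto. lia.
Qed.

Lemma count_shift P a d : forall u, count (fun z => P (z + a)%Z) u d = count P (u + a) d.
Proof.
induction d; intros u; simpl; [easy|]. rewrite IHd. now replace (u + 1 + a)%Z with (u + a + 1)%Z by lia.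
Qed.

Lemma count_sub P u d u' d' : (u <= u')%Z -> (u' + Z.of_nat d' <= u + Z.of_nat d)%Z ->
  (count P u' d' <= count P u d)%nat.
Proof.
intros H1 H2. replace d with (Z.to_nat (u' - u) + (d' + (d - d' - Z.to_nat (u' - u))))%nat by lia.
rewrite !count_split. replace (u + Z.of_nat (Z.to_nat (u' - u)))%Z with u' by lia. lia.
Qed.

Lemma count_first P d : forall u,
  (forall z, (u <= z < u + Z.of_nat d)%Z -> P z = false) \/
  exists d1, (d1 < d)%nat /\ (forall z, (u <= z < u + Z.of_nat d1)%Z -> P z = false) /\
    P (u + Z.of_nat d1)%Z = true.
Proof.
induction d; intros u; [left; lia|].
destruct (P u) eqn:E.
- right. exists 0%nat. split; [lia|split; [lia|]]. now rewrite Z.add_0_r.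
- destruct (IHd (u+1)%Z) as [H|[d1 [H1 [H2 H3]]]].
  + left. intros z Hz. destruct (Z.eq_dec z u) as [->|]; [easy|]. apply H; lia.
  + right. exists (S d1). split; [lia|split].
    * intros z Hz. destruct (Z.eq_dec z u) as [->|]; [easy|]. apply H2; lia.
    * now replace (u + Z.of_nat (S d1))%Z with (u + 1 + Z.of_nat d1)%Z by lia.
Qed.

Lemma count_points P d : forall u, exists xs, length xs = count P u d /\ NoDup xs /\
  forall x, In x xs -> (u <= x < u + Z.of_nat d)%Z /\ P x = true.
Proof.
induction d; intros u; simpl; [exists []; repeat split; try constructor; easy|].
destruct (IHd (u+1)%Z) as [xs [H1 [H2 H3]]].
destruct (P u) eqn:E.
- exists (u :: xs). simpl. split; [lia|split].
  + constructor; [|easy]. intros H. apply H3 in H. lia.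
  + intros x [<-|H]; [split; [lia|easy]|]. destruct (H3 x H). split; [lia|easy].
- exists xs. split; [lia|split; [easy|]]. intros x H. destruct (H3 x H). split; [lia|easy].
Qed.

(* A set [J] of positions cuts an interval into [count J + 1] runs. *)
Lemma count_runs J S q d : forall u,
  (forall u' d', (u <= u')%Z -> (u' + Z.of_nat d' <= u + Z.of_nat d)%Z ->
     (forall z, (u' <= z < u' + Z.of_nat d')%Z -> J z = false) -> (count S u' d' <= q)%nat) ->
  (count (fun z => negb (J z) && S z) u d <= q * (count J u d + 1))%nat.
Proof.
induction d as [d IH] using lt_wf_ind. intros u H.
destruct (count_first J d u) as [H0|[d1 [H1 [H2 H3]]]].
- specialize (H u d ltac:(lia) ltac:(lia) H0).
  assert (count (fun z => negb (J z) && S z) u d <= count S u d)%nat.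
  { apply count_mono. intros z Hz Hb. now apply andb_prop in Hb. }
  nia.
- replace d with (d1 + (1 + (d - d1 - 1)))%nat in * by lia. set (d2 := (d - d1 - 1)%nat) in *.
  rewrite !count_split. simpl. rewrite H3. simpl.
  assert (E1 := H u d1 ltac:(lia) ltac:(lia) H2).
  assert (E2 : (count (fun z => negb (J z) && S z) u d1 <= count S u d1)%nat).
  { apply count_mono. intros z Hz Hb. now apply andb_prop in Hb. }
  assert (E3 := IH d2 ltac:(lia) (u + Z.of_nat d1 + 1)%Z).
  specialize (E3 ltac:(intros; apply H; try lia; auto)).
  nia.
Qed.

(** * Sign partitions and alternations *)

(** Two of the points cannot share a block: a block is an interval, so it would contain points of
    both strict signs between them. Assigning to each point the block that contains it is thus
    injective. *)
Lemma alternation_blocks (h : R -> R) (J : interval) (P : list interval) (xs : list Z) :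
  sign_partition h J P -> NoDup xs ->
  (forall x, In x xs -> (fst J <= x < snd J)%Z) ->
  (forall x y, In x xs -> In y xs -> (x < y)%Z -> exists u v,
     (x <= u <= y)%Z /\ (x <= v <= y)%Z /\ 0 < h (IZR u) /\ h (IZR v) < 0) ->
  (length xs <= length P)%nat.
Proof.
intros [[_ [_ Hcov]] Hs] Hnd Hin Halt.
assert (H : exists Ks, Forall2 (fun x K => In K P /\ in_itv K (IZR x)) xs Ks /\ NoDup Ks).
{ revert Hin Halt. induction Hnd as [|x xs Hx Hnd IH]; intros Hin Halt.
  - exists []. split; constructor.
  - destruct IH as [Ks [HK HKd]].
    { intros y Hy. apply Hin. now right. }
    { intros y z Hy Hz. apply Halt; now right. }
    destruct (proj1 (Hcov (IZR x))) as [K [HKP HKx]].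
    { specialize (Hin x ltac:(now left)). split; [apply IZR_le|apply IZR_lt]; lia. }
    exists (K :: Ks). split; [now constructor|]. constructor; [|easy].
    intros HKin. apply In_nth_error in HKin. destruct HKin as [i Hi].
    assert (Hy : exists y, In y xs /\ in_itv K (IZR y)).
    { clear - HK Hi. revert i Hi. induction HK as [|x K' xs Ks [H1 H2] HK IH]; intros i Hi.
      - destruct i; discriminate.
      - destruct i; simpl in Hi.
        + injection Hi as ->. exists x. split; [now left|easy].
        + destruct (IH i Hi) as [y [Hy1 Hy2]]. exists y. split; [now right|easy]. }
    destruct Hy as [y [Hy HKy]].
    assert (Hop : forall x y, in_itv K (IZR x) -> in_itv K (IZR y) ->
      (exists u v, (x <= u <= y)%Z /\ (x <= v <= y)%Z /\ 0 < h (IZR u) /\ h (IZR v) < 0) -> False).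
    { intros a b [Ha1 Ha2] [Hb1 Hb2] [u [v [Hu [Hv [Hpu Hnv]]]]].
      assert (Hi' : forall z, (a <= z <= b)%Z -> in_itv K (IZR z)).
      { intros z [Hz1 Hz2]. apply IZR_le in Hz1, Hz2. unfold in_itv in *. lra. }
      assert (Ku := Hi' u Hu). assert (Kv := Hi' v Hv).
      destruct (Hs K HKP) as [Hc|[Hc|[Hc|Hc]]]; pose proof (Hc u Ku); pose proof (Hc v Kv); lra. }
    destruct (Z.lt_trichotomy x y) as [Hlt|[->|Hlt]].
    + apply (Hop x y HKx HKy). apply Halt; [now left|now right|easy].
    + easy.
    + apply (Hop y x HKy HKx). apply Halt; [now right|now left|easy]. }
destruct H as [Ks [HK HKd]].
replace (length xs) with (length Ks) by (symmetry; eapply Forall2_length; eauto).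
apply NoDup_incl_length; [easy|]. intros K HKin.
clear - HK HKin. induction HK as [|x K' xs Ks [H1 H2] HK IH]; [easy|].
destruct HKin as [<-|H]; auto.
Qed.

Section PiecesOfF.
Variables (n : nat) (f : R -> R).
Let F (z : Z) := f (IZR z).
Let N := Z.of_nat n.

(** Every lower bound on [pf] comes from here: points separated by both strict signs force as many
    blocks in each sign partition, in particular in a minimal one. The level [c] may be any real
    number. *)
Lemma pf_ge (a l r : Z) (c : R) (xs : list Z) :
  (0 <= a)%Z -> (0 <= l <= r)%Z -> (r + a <= N)%Z -> NoDup xs ->
  (forall x, In x xs -> (l <= x < r)%Z) ->
  (forall x y, In x xs -> In y xs -> (x < y)%Z -> exists u v,
     (x <= u <= y)%Z /\ (x <= v <= y)%Z /\
     0 < F (u + a) - F u + c /\ F (v + a) - F v + c < 0) ->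
  (length xs <= pf n f)%nat.
Proof.
intros Ha Hl Hr Hnd Hin Halt.
transitivity (pf_on f (IZR a) c (l, r)).
- destruct (pf_on_spec f (IZR a) c (l, r) (proj2 Hl)) as [[[P [[HP _] ->]] _] _].
  apply alternation_blocks with (1 := HP); try easy.
  intros x y Hx Hy Hxy. destruct (Halt x y Hx Hy Hxy) as [u [v H]].
  exists u, v. unfold gab, F in *. rewrite <- !plus_IZR. easy.
- apply (proj2 (pf_spec n f)). exists (IZR a), c, (l, r).
  split; [now apply IZR_le|]. split; [apply Hl|]. split; [|easy].
  intros x [H1 H2]; simpl in *. destruct Hl as [Hl0 Hl].
  apply IZR_le in Hl0, Hl, Hr, Ha. unfold N in Hr. rewrite plus_IZR, <- INR_IZR_INZ in Hr. lra.
Qed.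

Lemma pf_pos : (0 < n)%nat -> (1 <= pf n f)%nat.
Proof.
intros Hn. apply (pf_ge 0 0 1 0 [0%Z]); unfold N; try lia.
- repeat constructor. easy.
- intros x [<-|[]]; lia.
- intros x y [<-|[]] [<-|[]]; lia.
Qed.

Definition slope (F : Z -> R) (z : Z) : R := F (z + 1)%Z - F z.

(** For [a = 1] the sign function is a slope of [F] plus a constant, and a level halfway between two
    different slopes separates them. Contrapositively, [p <= 1] forces [F] to be affine. *)
Lemma pf_not_linear (z : Z) : (0 <= z)%Z -> (z + 1 < N)%Z -> slope F z <> slope F 0 ->
  (2 <= pf n f)%nat.
Proof.
intros Hz HN Hd. assert (Hz0 : (z <> 0)%Z) by (intros ->; easy).
apply (pf_ge 1 0 (z + 1) (- (slope F z + slope F 0) / 2) [0; z]%Z); try lia.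
- repeat constructor; simpl; intuition.
- intros x [<-|[<-|[]]]; lia.
- unfold slope in *. intros x y [<-|[<-|[]]] [<-|[<-|[]]] Hxy; try lia.
  destruct (Rlt_le_dec (F (z + 1)%Z - F z) (F (0 + 1)%Z - F 0%Z)).
  + exists 0%Z, z. repeat split; try lia; lra.
  + exists z, 0%Z. repeat split; try lia; lra.
Qed.

(** A level between the middle slope and the outer ones gives the sign pattern [- + -] or [+ - +],
    which needs three blocks. *)
Lemma pf_extremum (x y z : Z) : (0 <= x < y)%Z -> (y < z)%Z -> (z + 1 < N)%Z ->
  (slope F x < slope F y /\ slope F z < slope F y) \/
  (slope F y < slope F x /\ slope F y < slope F z) -> (3 <= pf n f)%nat.
Proof.
intros Hx Hy HN Hd. unfold slope in Hd.
set (dx := F (x + 1)%Z - F x) in *. set (dy := F (y + 1)%Z - F y) in *. set (dz := F (z + 1)%Z - F z) in *.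
assert (Hc : exists c, (dx + c < 0 /\ 0 < dy + c /\ dz + c < 0) \/ (0 < dx + c /\ dy + c < 0 /\ 0 < dz + c)).
{ destruct Hd as [[H1 H2]|[H1 H2]].
  - exists (- (dy + Rmax dx dz) / 2). unfold Rmax; destruct Rle_dec; lra.
  - exists (- (dy + Rmin dx dz) / 2). unfold Rmin; destruct Rle_dec; lra. }
destruct Hc as [c Hc].
apply (pf_ge 1 0 (z + 1) c [x; y; z]); try lia.
- repeat constructor; simpl; intuition lia.
- intros w [<-|[<-|[<-|[]]]]; lia.
- intros a b [<-|[<-|[<-|[]]]] [<-|[<-|[<-|[]]]] Hab; try lia;
    destruct Hc as [Hc|Hc]; unfold dx, dy, dz in Hc;
    solve [exists x, y; repeat split; (lia || tauto) | exists y, x; repeat split; (lia || tauto)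
      | exists y, z; repeat split; (lia || tauto) | exists z, y; repeat split; (lia || tauto)].
Qed.

(** Comparing the first slope with the last one fixes the direction. A pair that violates it forms,
    with one of the two ends, a triple with an interior extremum, which [pf_extremum] excludes. *)
Lemma pf_le2_monotone_slopes : (pf n f <= 2)%nat ->
  (forall x y, (0 <= x <= y)%Z -> (y + 1 < N)%Z -> slope F x <= slope F y) \/
  (forall x y, (0 <= x <= y)%Z -> (y + 1 < N)%Z -> slope F y <= slope F x).
Proof.
intros Hp.
assert (Hno : forall x y z, (0 <= x < y)%Z -> (y < z)%Z -> (z + 1 < N)%Z ->
  ~ ((slope F x < slope F y /\ slope F z < slope F y) \/
     (slope F y < slope F x /\ slope F y < slope F z))).
{ intros x y z H1 H2 H3 H4. pose proof (pf_extremum x y z H1 H2 H3 H4). lia. }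
set (e := (N - 2)%Z).
destruct (Rle_lt_dec (slope F 0) (slope F e)) as [Hd|Hd]; [left|right]; intros x y Hxy HN;
  apply Rnot_lt_le; intros Hlt;
  (assert (Hne : (x <> y)%Z) by (intros ->; lra));
  (destruct (Z.eq_dec x 0) as [->|Hx0]);
  (destruct (Z.eq_dec y e) as [->|Hye]); try lra.
- apply (Hno 0%Z y e); unfold e in *; try lia. lra.
- apply (Hno 0%Z x e); unfold e in *; try lia. lra.
- assert (H1 := Hno 0%Z x y). assert (H2 := Hno x y e). unfold e in *.
  specialize (H1 ltac:(lia) ltac:(lia) ltac:(lia)). specialize (H2 ltac:(lia) ltac:(lia) ltac:(lia)). lra.
- apply (Hno 0%Z y e); unfold e in *; try lia. lra.
- apply (Hno 0%Z x e); unfold e in *; try lia. lra.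
- assert (H1 := Hno 0%Z x y). assert (H2 := Hno x y e). unfold e in *.
  specialize (H1 ltac:(lia) ltac:(lia) ltac:(lia)). specialize (H2 ltac:(lia) ltac:(lia) ltac:(lia)). lra.
Qed.

(** A switch of the test [0 <= h] at a zero of [h] need not separate blocks, as a zero fits both
    weak signs; hence the passage to a slightly higher level. The points are then [u] and the
    successors of the switches: between any two of them lies a complete switch. *)
Lemma pf_switches (a u : Z) (c : R) (d : nat) :
  (0 <= a)%Z -> (0 <= u)%Z -> (u + Z.of_nat d + a < N)%Z ->
  (count (fun z => xorb (Rleb 0 (F (z + a) - F z + c)) (Rleb 0 (F (z + 1 + a) - F (z + 1) + c))) u d
    + 1 <= pf n f)%nat.
Proof.
intros Ha Hu HN. set (h := fun z : Z => F (z + a) - F z + c).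
(* Raising [h] slightly makes it nowhere zero without changing its switches. *)
assert (He : exists e, 0 < e /\ forall z, (u <= z <= u + Z.of_nat d)%Z -> h z < 0 -> h z + e < 0).
{ clear HN. induction d as [|d [e [He IH]]].
  - destruct (Rlt_le_dec (h u) 0) as [H|H].
    + exists (- h u / 2). split; [lra|]. intros z Hz _. replace z with u by lia. lra.
    + exists 1. split; [lra|]. intros z Hz. replace z with u by lia. lra.
  - destruct (Rlt_le_dec (h (u + Z.of_nat (S d))%Z) 0) as [H|H].
    + exists (Rmin e (- h (u + Z.of_nat (S d))%Z / 2)). split.
      * apply Rmin_glb_lt; lra.
      * intros z Hz Hneg.
        pose proof (Rmin_l e (- h (u + Z.of_nat (S d))%Z / 2)).
        pose proof (Rmin_r e (- h (u + Z.of_nat (S d))%Z / 2)).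
        destruct (Z.eq_dec z (u + Z.of_nat (S d))) as [->|]; [lra|].
        specialize (IH z ltac:(lia) Hneg). lra.
    + exists e. split; [easy|]. intros z Hz Hneg.
      destruct (Z.eq_dec z (u + Z.of_nat (S d))) as [->|]; [lra|]. apply IH; [lia|easy]. }
destruct He as [e [He Hneg]].
match goal with |- (count ?P u d + 1 <= _)%nat => destruct (count_points P d u) as [xs [H1 [H2 H3]]] end.
rewrite <- H1. replace (length xs + 1)%nat with (length (u :: map Z.succ xs)) by (simpl; rewrite length_map; lia).
apply (pf_ge a u (u + Z.of_nat d + 1) (c + e)); try lia.
- constructor.
  + intros Hin. apply in_map_iff in Hin. destruct Hin as [x [E Hin]]. apply H3 in Hin. lia.
  + apply FinFun.Injective_map_NoDup; [intros ? ?; lia|easy].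
- intros x [<-|Hin]; [lia|]. apply in_map_iff in Hin. destruct Hin as [x' [<- Hin]]. apply H3 in Hin. lia.
- intros x y Hx Hy Hxy.
  assert (Hy' : exists z, y = (z + 1)%Z /\ In z xs).
  { destruct Hy as [<-|Hy].
    - destruct Hx as [<-|Hin]; [lia|]. apply in_map_iff in Hin. destruct Hin as [x' [<- Hin]]. apply H3 in Hin. lia.
    - apply in_map_iff in Hy. destruct Hy as [z [<- Hz]]. exists z. split; [lia|easy]. }
  destruct Hy' as [z [-> Hz]]. destruct (H3 z Hz) as [Hzr Hsw].
  fold (h z) (h (z + 1)%Z) in Hsw.
  assert (Hn1 := Hneg z ltac:(lia)). assert (Hn2 := Hneg (z + 1)%Z ltac:(lia)).
  destruct (Rleb 0 (h z)) eqn:E1, (Rleb 0 (h (z + 1)%Z)) eqn:E2; try discriminate;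
    [apply Rleb_true in E1; apply Rleb_false in E2; exists z, (z + 1)%Z
    |apply Rleb_true in E2; apply Rleb_false in E1; exists (z + 1)%Z, z];
    unfold h in *; repeat split; try lia; lra.
Qed.
End PiecesOfF.

(** * Minimizers of the segment tree nodes and their changes *)

Definition pw (k : nat) : Z := (2 ^ Z.of_nat k)%Z.

Lemma pw_S k : pw (S k) = (2 * pw k)%Z.
Proof. unfold pw. rewrite Nat2Z.inj_succ, Z.pow_succ_r; lia. Qed.

Lemma pw_pos k : (0 < pw k)%Z.
Proof. unfold pw. apply Z.pow_pos_nonneg; lia. Qed.

Lemma pw_add a b : pw (a + b) = (pw a * pw b)%Z.
Proof. unfold pw. rewrite Nat2Z.inj_add, Z.pow_add_r; lia. Qed.

Lemma pw_nat k : pw k = Z.of_nat (2 ^ k).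
Proof. unfold pw. now rewrite Nat2Z.inj_pow. Qed.

(* [s] stands for [x - i] and [w] for [i + k]. *)
Definition candidate (A F : Z -> R) (w s : Z) : R := A w + F (s + w)%Z.

(** The recursion is that of the merges; the weak comparison gives ties to the left half, so this is
    the leftmost minimizer over [[lo, lo + pw k)]. *)
Fixpoint winner (A F : Z -> R) (k : nat) (lo s : Z) : Z :=
  match k with
  | O => lo
  | S k =>
      let a := winner A F k lo s in
      let b := winner A F k (lo + pw k) s in
      if Rleb (candidate A F a s) (candidate A F b s) then a else b
  end.

Definition changes (W : Z -> Z) (z : Z) : bool := negb (W z =? W (z + 1))%Z.

Section Envelope.
Variables (A F : Z -> R).
Notation V := (candidate A F).
Notation winner := (winner A F).

Lemma winner_range k : forall lo s, (lo <= winner k lo s < lo + pw k)%Z.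
Proof.
induction k as [|k IH]; intros lo s; simpl winner; [unfold pw; simpl; lia|].
pose proof (IH lo s). pose proof (IH (lo + pw k)%Z s). rewrite pw_S.
destruct Rleb; lia.
Qed.

Lemma winner_min k : forall lo s w, (lo <= w < lo + pw k)%Z -> V (winner k lo s) s <= V w s.
Proof.
induction k as [|k IH]; intros lo s w Hw; simpl winner.
- unfold pw in Hw; simpl in Hw. replace w with lo by lia. lra.
- rewrite pw_S in Hw. set (a := winner k lo s). set (b := winner k (lo + pw k) s).
  assert (Ha := IH lo s w). assert (Hb := IH (lo + pw k)%Z s w). fold a in Ha. fold b in Hb.
  destruct (Z_lt_le_dec w (lo + pw k)); destruct (Rleb (V a s) (V b s)) eqn:E;
    try apply Rleb_true in E; try apply Rleb_false in E;
    try specialize (Ha ltac:(lia)); try specialize (Hb ltac:(lia)); lra.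
Qed.

Definition side (k : nat) (lo z : Z) : bool :=
  Rleb (V (winner k lo z) z) (V (winner k (lo + pw k) z) z).

Definition jumpAB (k : nat) (lo z : Z) : bool :=
  changes (winner k lo) z || changes (winner k (lo + pw k)) z.

(** Between two jumps both minimizers and the outcome of their comparison are constant. Changes of
    the losing child count as well, so jumps may outnumber the changes of the merged minimizer. *)
Definition jump (k : nat) (lo z : Z) : bool :=
  jumpAB k lo z || xorb (side k lo z) (side k lo (z + 1)).

Lemma winner_S k lo z : winner (S k) lo z = if side k lo z then winner k lo z else winner k (lo + pw k) z.
Proof. reflexivity. Qed.

Lemma jump_false k lo z : jump k lo z = false ->
  winner k lo (z + 1) = winner k lo z /\ winner k (lo + pw k) (z + 1) = winner k (lo + pw k) z /\
  side k lo (z + 1) = side k lo z.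
Proof.
unfold jump, jumpAB, changes. intros H. apply orb_false_elim in H. destruct H as [H H3].
apply orb_false_elim in H. destruct H as [H1 H2].
apply negb_false_iff, Z.eqb_eq in H1, H2. apply xorb_eq in H3. auto.
Qed.

Lemma changes_winner k lo z : changes (winner (S k) lo) z = true -> jump k lo z = true.
Proof.
intros H. apply not_false_iff_true. intros Hj. apply jump_false in Hj. destruct Hj as [H1 [H2 H3]].
unfold changes in H. rewrite !winner_S, H1, H2, H3, Z.eqb_refl in H. discriminate.
Qed.

Variable n : Z.

(* The node of level [k] at [lo] is used for [s] in [[-lo, n - lo - pw k]] only, where all its
   positions lie in the domain of [f]. *)
Definition breaks (k : nat) (lo : Z) : nat :=
  count (changes (winner k lo)) (- lo) (Z.to_nat (n - pw k)).

Definition jumps (k : nat) (lo : Z) : nat :=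
  count (jump k lo) (- lo) (Z.to_nat (n - pw (S k))).

Lemma breaks_S k lo : (breaks (S k) lo <= jumps k lo)%nat.
Proof. apply count_mono. intros z _. apply changes_winner. Qed.

Lemma breaks_0 lo : breaks 0 lo = 0%nat.
Proof. apply count_false. intros z _. unfold changes. simpl. now rewrite Z.eqb_refl. Qed.

(** The range of [s] of a node is contained in the ranges of both children. *)
Lemma jumpAB_count k lo : (0 <= lo)%Z -> (lo + pw (S k) <= n)%Z ->
  (count (jumpAB k lo) (- lo) (Z.to_nat (n - pw (S k))) <= breaks k lo + breaks k (lo + pw k))%nat.
Proof.
intros H1 H2. rewrite pw_S in *. pose proof (pw_pos k).
etransitivity; [apply count_or with (Q := changes (winner k lo)) (R := changes (winner k (lo + pw k)))|].
- intros z _ H0. apply orb_prop in H0. exact H0.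
- apply Nat.add_le_mono; apply count_sub; lia.
Qed.

Lemma const_run {X : Type} (W : Z -> X) (u : Z) (d : nat) :
  (forall z, (u <= z < u + Z.of_nat d)%Z -> W (z + 1)%Z = W z) ->
  forall z, (u <= z <= u + Z.of_nat d)%Z -> W z = W u.
Proof.
intros H. assert (H' : forall e, (e <= d)%nat -> W (u + Z.of_nat e)%Z = W u).
{ induction e; intros He; [now rewrite Z.add_0_r|]. rewrite <- IHe by lia.
  replace (u + Z.of_nat (S e))%Z with (u + Z.of_nat e + 1)%Z by lia. apply H. lia. }
intros z Hz. replace z with (u + Z.of_nat (Z.to_nat (z - u)))%Z by lia. apply H'. lia.
Qed.

Definition switch_bound (p : nat) : Prop := forall (a u : Z) (c : R) (d : nat),
  (0 <= a)%Z -> (0 <= u)%Z -> (u + Z.of_nat d + a < n)%Z ->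
  (count (fun z => xorb (Rleb 0 (F (z + a) - F z + c)) (Rleb 0 (F (z + 1 + a) - F (z + 1) + c))) u d
    + 1 <= p)%nat.

Lemma Rleb_shift x y z t : x - y = z - t -> Rleb y x = Rleb t z.
Proof. intros H. unfold Rleb. do 2 destruct Rle_dec; try easy; lra. Qed.

(** On a run where the children keep their minimizers [a] and [b], the comparison is the sign of
    [F (y + (b - a)) - F y + (A b - A a)] at [y = z + a], which switches at most [p - 1] times. With
    [J] changes in the children there are at most [J + 1] runs, hence at most
    [J + (p - 1) * (J + 1) = p * (J + 1) - 1] jumps. *)
Lemma jumps_general p k lo : switch_bound p -> (0 <= lo)%Z -> (lo + pw (S k) <= n)%Z ->
  (jumps k lo + 1 <= p * (breaks k lo + breaks k (lo + pw k) + 1))%nat.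
Proof.
intros Hp Hlo Hn. assert (Hc := jumpAB_count k lo Hlo Hn).
assert (Hp1 : (1 <= p)%nat).
{ specialize (Hp 0%Z 0%Z 0 0%nat). simpl in Hp. apply Hp; try lia. pose proof (pw_pos (S k)). lia. }
set (S0 := fun z => xorb (side k lo z) (side k lo (z + 1))).
assert (H1 : (jumps k lo <= count (jumpAB k lo) (- lo) (Z.to_nat (n - pw (S k))) +
  count (fun z => negb (jumpAB k lo z) && S0 z) (- lo) (Z.to_nat (n - pw (S k))))%nat).
{ apply count_or. intros z _. unfold jump. fold (S0 z). destruct (jumpAB k lo z), (S0 z); simpl; auto. }
assert (H2 := count_runs (jumpAB k lo) S0 (p - 1) (Z.to_nat (n - pw (S k))) (- lo)).
rewrite pw_S in *. pose proof (pw_pos k).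
match type of H2 with ?X -> _ => assert (H3 : X); [|specialize (H2 H3); nia] end.
intros u d Hu Hd HJ. clear H2.
assert (Hab : forall z, (u <= z < u + Z.of_nat d)%Z -> winner k lo (z + 1) = winner k lo z /\
  winner k (lo + pw k) (z + 1) = winner k (lo + pw k) z).
{ intros z Hz. specialize (HJ z Hz). apply orb_false_elim in HJ. destruct HJ as [E1 E2].
  now apply negb_false_iff, Z.eqb_eq in E1, E2. }
assert (Ha := const_run (winner k lo) u d (fun z Hz => proj1 (Hab z Hz))).
assert (Hb := const_run (winner k (lo + pw k)) u d (fun z Hz => proj2 (Hab z Hz))).
set (a := winner k lo u) in *. set (b := winner k (lo + pw k) u) in *.
assert (Ra := winner_range k lo u). assert (Rb := winner_range k (lo + pw k) u). fold a in Ra. fold b in Rb.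
specialize (Hp (b - a)%Z (u + a)%Z (A b - A a) d).
specialize (Hp ltac:(lia) ltac:(lia) ltac:(lia)).
rewrite <- count_shift in Hp.
apply (Nat.le_trans _ (p - 1)); [|lia].
transitivity (count (fun z => xorb
  (Rleb 0 (F (z + a + (b - a))%Z - F (z + a)%Z + (A b - A a)))
  (Rleb 0 (F (z + a + 1 + (b - a))%Z - F (z + a + 1)%Z + (A b - A a)))) u d); [|lia].
apply count_mono. intros z Hz. unfold S0, side. rewrite !Ha, !Hb by lia. intros Hs. rewrite <- Hs.
f_equal; symmetry; apply Rleb_shift; unfold candidate.
- replace (z + a + (b - a))%Z with (z + b)%Z by lia. ring.
- replace (z + a + 1 + (b - a))%Z with (z + 1 + b)%Z by lia.
  replace (z + a + 1)%Z with (z + 1 + a)%Z by lia. ring.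
Qed.

Lemma monotone_switches (sd : Z -> bool) (b : bool) d : forall u,
  (forall z, (u <= z < u + Z.of_nat d)%Z -> sd z = b -> sd (z + 1)%Z = b) ->
  (count (fun z => xorb (sd z) (sd (z + 1)%Z)) u d <= 1)%nat.
Proof.
induction d; intros u H; simpl; [lia|].
destruct (bool_dec (sd u) b) as [E|E].
- rewrite count_false; [rewrite (H u) by (lia || auto); rewrite E; destruct b; simpl; lia|].
  assert (H' : forall e, (e <= d)%nat -> sd (u + 1 + Z.of_nat e)%Z = b).
  { induction e; intros He; [rewrite Z.add_0_r; apply H; [lia|easy]|].
    replace (u + 1 + Z.of_nat (S e))%Z with (u + 1 + Z.of_nat e + 1)%Z by lia. apply H; [lia|].
    apply IHe. lia. }
  intros z Hz. replace z with (u + 1 + Z.of_nat (Z.to_nat (z - u - 1)))%Z by lia.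
  rewrite H' by lia.
  replace (u + 1 + Z.of_nat (Z.to_nat (z - u - 1)) + 1)%Z with (u + 1 + Z.of_nat (Z.to_nat (z - u)))%Z by lia.
  rewrite H' by lia. apply xorb_nilpotent.
- specialize (IHd (u + 1)%Z ltac:(intros; apply H; [lia|easy])).
  destruct (xorb (sd u) (sd (u + 1)%Z)) eqn:X; [|lia].
  rewrite count_false; [lia|].
  assert (H0 : sd (u + 1)%Z = b) by (destruct (sd u), (sd (u + 1)%Z), b; simpl in *; congruence).
  assert (H' : forall e, (e <= d)%nat -> sd (u + 1 + Z.of_nat e)%Z = b).
  { induction e; intros He; [now rewrite Z.add_0_r|].
    replace (u + 1 + Z.of_nat (S e))%Z with (u + 1 + Z.of_nat e + 1)%Z by lia. apply H; [lia|].
    apply IHe. lia. }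
  intros z Hz. replace z with (u + 1 + Z.of_nat (Z.to_nat (z - u - 1)))%Z by lia.
  rewrite H' by lia.
  replace (u + 1 + Z.of_nat (Z.to_nat (z - u - 1)) + 1)%Z with (u + 1 + Z.of_nat (Z.to_nat (z - u)))%Z by lia.
  rewrite H' by lia. apply xorb_nilpotent.
Qed.

Definition convex : Prop := forall x y, (0 <= x <= y)%Z -> (y + 1 < n)%Z -> slope F x <= slope F y.
Definition concave : Prop := forall x y, (0 <= x <= y)%Z -> (y + 1 < n)%Z -> slope F y <= slope F x.

(** All positions of the left child precede those of the right one. Under convexity, passing to
    [z + 1] therefore raises the left minimum by no more than the right one, and a left child once
    ahead stays ahead; under concavity the right child does. So the comparison switches once in the
    whole range instead of once in each run, and the changes of the children merely add up. *)
Lemma jumps_curved k lo : convex \/ concave -> (0 <= lo)%Z -> (lo + pw (S k) <= n)%Z ->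
  (jumps k lo <= breaks k lo + breaks k (lo + pw k) + 1)%nat.
Proof.
intros Hc Hlo Hn. assert (Hc' := jumpAB_count k lo Hlo Hn).
set (S0 := fun z => xorb (side k lo z) (side k lo (z + 1))).
assert (H1 : (jumps k lo <= count (jumpAB k lo) (- lo) (Z.to_nat (n - pw (S k))) +
  count S0 (- lo) (Z.to_nat (n - pw (S k))))%nat).
{ apply count_or. intros z _. unfold jump. fold (S0 z). destruct (jumpAB k lo z), (S0 z); simpl; auto. }
cut (count S0 (- lo) (Z.to_nat (n - pw (S k))) <= 1)%nat; [lia|].
clear H1 Hc'. rewrite pw_S in *. pose proof (pw_pos k) as Hpw.
assert (Hr : forall z, (- lo <= z < n - lo - 2 * pw k)%Z ->
  forall w w', (lo <= w < lo + pw k)%Z -> (lo + pw k <= w' < lo + 2 * pw k)%Z ->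
  (0 <= z + w)%Z /\ (z + w <= z + w')%Z /\ (z + w' + 1 < n)%Z) by lia.
destruct Hc as [Hc|Hc]; [apply monotone_switches with (b := true)|apply monotone_switches with (b := false)];
  intros z Hz; unfold side;
  pose proof (winner_range k lo z) as R1; pose proof (winner_range k (lo + pw k) z) as R2;
  pose proof (winner_range k lo (z + 1)) as R3; pose proof (winner_range k (lo + pw k) (z + 1)) as R4;
  pose proof (winner_min k lo z) as M1; pose proof (winner_min k (lo + pw k) z) as M2;
  pose proof (winner_min k lo (z + 1)) as M3; pose proof (winner_min k (lo + pw k) (z + 1)) as M4;
  set (a := winner k lo z) in *; set (b := winner k (lo + pw k) z) in *;
  set (a' := winner k lo (z + 1)) in *; set (b' := winner k (lo + pw k) (z + 1)) in *.
- rewrite !Rleb_true. intros H.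
  (* The old left minimizer [a] bounds the new left minimum, and the new right minimizer [b'] bounds
     the old right minimum; only the slopes at these two positions are compared. *)
  specialize (M3 a ltac:(lia)). specialize (M2 b' ltac:(lia)).
  destruct (Hr z ltac:(lia) a b' ltac:(lia) ltac:(lia)) as [E1 [E2 E3]].
  assert (E := Hc (z + a)%Z (z + b')%Z (conj E1 E2) E3).
  unfold slope, candidate in *. replace (z + 1 + a)%Z with (z + a + 1)%Z in * by lia.
  replace (z + 1 + b')%Z with (z + b' + 1)%Z in * by lia. lra.
- rewrite !Rleb_false. intros H.
  specialize (M1 a' ltac:(lia)). specialize (M4 b ltac:(lia)).
  destruct (Hr z ltac:(lia) a' b ltac:(lia) ltac:(lia)) as [E1 [E2 E3]].
  assert (E := Hc (z + a')%Z (z + b)%Z (conj E1 E2) E3).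
  unfold slope, candidate in *. replace (z + 1 + a')%Z with (z + a' + 1)%Z in * by lia.
  replace (z + 1 + b)%Z with (z + b + 1)%Z in * by lia. lra.
Qed.

Definition affine : Prop := forall x, (0 <= x)%Z -> (x + 1 < n)%Z -> slope F x = slope F 0.

(** Passing from [z] to [z + 1] adds the same number to all candidates, so no comparison ever
    changes. *)
Lemma affine_jump k : affine -> forall lo z, (0 <= lo)%Z -> (lo + pw (S k) <= n)%Z ->
  (- lo <= z < n - lo - pw (S k))%Z -> jump k lo z = false.
Proof.
intros Hl. pose proof pw_pos as Hpos.
assert (HV : forall lo h z w w', (- lo <= z < n - lo - h)%Z -> (lo <= w < lo + h)%Z -> (lo <= w' < lo + h)%Z ->
  Rleb (V w (z + 1)) (V w' (z + 1)) = Rleb (V w z) (V w' z)).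
{ intros lo h z w w' Hz Hw Hw'. apply Rleb_shift. unfold candidate.
  pose proof (Hl (z + w) ltac:(lia) ltac:(lia))%Z. pose proof (Hl (z + w') ltac:(lia) ltac:(lia))%Z.
  unfold slope in *. replace (z + 1 + w)%Z with (z + w + 1)%Z by lia.
  replace (z + 1 + w')%Z with (z + w' + 1)%Z by lia. lra. }
assert (HW : forall k lo z, (0 <= lo)%Z -> (lo + pw k <= n)%Z -> (- lo <= z < n - lo - pw k)%Z ->
  winner k lo (z + 1) = winner k lo z).
{ clear k. induction k as [|k IH]; intros lo z H1 H2 H3; simpl; [easy|].
  rewrite pw_S in *. specialize (Hpos k). rewrite !IH by lia.
  rewrite (HV lo (pw (S k))); [easy|rewrite pw_S; lia| |];
    rewrite pw_S;
    [pose proof (winner_range k lo z)|pose proof (winner_range k (lo + pw k) z)]; lia. }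
intros lo z H1 H2 H3. rewrite pw_S in *. specialize (Hpos k).
unfold jump, jumpAB, changes, side. rewrite !HW by lia. rewrite !Z.eqb_refl. simpl.
rewrite (HV lo (pw (S k))); [apply xorb_nilpotent|rewrite pw_S; lia| |];
    rewrite pw_S;
    [pose proof (winner_range k lo z)|pose proof (winner_range k (lo + pw k) z)]; lia.
Qed.

(** * Steps of a merge *)

(** Exclusive end of the range of [s] for the node of level [S k] at [lo]. *)
Definition bound_at (k : nat) (lo : Z) : Z := (n - lo - pw (S k) + 1)%Z.

(** The last position of the range counts too, so that every run, including the last one, ends in a
    stop. *)
Definition stop (k : nat) (lo z : Z) : bool :=
  (z <? bound_at k lo)%Z && (jump k lo z || (z =? bound_at k lo - 1)%Z).

Fixpoint near (P : Z -> bool) (d : nat) (s : Z) : bool :=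
  match d with
  | O => false
  | S d => near P d s || P (s + Z.of_nat d)%Z
  end.

Lemma near_true P d s : near P d s = true <-> exists z, (s <= z < s + Z.of_nat d)%Z /\ P z = true.
Proof.
induction d; simpl.
- split; [easy|]. intros [z [H _]]. lia.
- rewrite orb_true_iff, IHd. split.
  + intros [[z [H1 H2]]|H]; [exists z|exists (s + Z.of_nat d)%Z]; (split; [lia|easy]).
  + intros [z [H1 H2]]. destruct (Z.eq_dec z (s + Z.of_nat d)) as [<-|Hn]; [now right|].
    left. exists z. split; [lia|easy].
Qed.

(** Each point of [P] is seen from at most [d] positions; the first hypothesis excludes points
    beyond the interval, since [near] looks ahead. *)
Lemma count_near P d u v e :
  (forall z, (u + Z.of_nat e <= z)%Z -> P z = false) -> v = u ->
  (count (near P d) v e <= d * count P u e)%nat.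
Proof.
intros HP ->. induction d.
- rewrite count_false; [lia|easy].
- simpl near.
  etransitivity; [apply count_or with (Q := near P d) (R := fun z => P (z + Z.of_nat d)%Z);
    intros z _ H; now apply orb_prop in H|].
  rewrite count_shift.
  assert (E : (count P (u + Z.of_nat d) e <= count P u e)%nat).
  { destruct (Nat.le_gt_cases e d) as [Hd|Hd].
    - rewrite (count_false _ e (u + Z.of_nat d)); [lia|]. intros z Hz. apply HP. lia.
    - replace e with ((e - d) + d)%nat at 1 by lia. rewrite count_split.
      rewrite (count_false _ d (u + Z.of_nat d + Z.of_nat (e - d))) by (intros z Hz; apply HP; lia).
      rewrite Nat.add_0_r. apply count_sub; lia. }
  simpl. lia.
Qed.

Definition merge_step (lin tab : bool) (B : Z) (k : nat) (lo s s' : Z) : Prop :=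
  (s < s' <= bound_at k lo)%Z /\
  if lin then stop k lo (s' - 1) = true
  else if tab then s' = (s + B)%Z \/ (s' = s + 1 /\ near (stop k lo) (Z.to_nat (B - 1)) s = true)%Z
  else True.

(** A potential can serve directly as the variant of the merge loop, without naming the sequence of
    moves. It bounds the number of pieces produced as well. *)
Definition merges_within (lin tab : bool) (B : Z) (k : nat) (lo : Z) (cap : nat) : Prop :=
  exists phi : Z -> nat,
    (forall s s', (- lo <= s < bound_at k lo)%Z -> merge_step lin tab B k lo s s' ->
       (phi s' < phi s)%nat) /\
    (phi (- lo)%Z <= cap)%nat.

Lemma merges_within_scan lin tab B k lo : (lo + pw (S k) <= n)%Z ->
  merges_within lin tab B k lo (Z.to_nat (n - pw (S k) + 1)).
Proof.
intros H. exists (fun s => Z.to_nat (bound_at k lo - s)). split.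
- intros s s' Hs [Hs' _]. lia.
- unfold bound_at. lia.
Qed.

Lemma stop_count k lo : (0 <= lo)%Z -> (lo + pw (S k) <= n)%Z ->
  (count (stop k lo) (- lo) (Z.to_nat (bound_at k lo + lo)) <= jumps k lo + 1)%nat.
Proof.
intros H1 H2. unfold jumps.
replace (Z.to_nat (bound_at k lo + lo)) with (Z.to_nat (n - pw (S k)) + 1)%nat by (unfold bound_at; lia).
rewrite count_split. apply Nat.add_le_mono.
- apply count_mono. intros z Hz H. unfold stop in H. apply andb_prop in H. destruct H as [_ H].
  apply orb_prop in H. destruct H as [H|H]; [easy|]. apply Z.eqb_eq in H. unfold bound_at in H. lia.
- apply count_le.
Qed.

Lemma merges_within_lin tab B k lo cap : (0 <= lo)%Z -> (lo + pw (S k) <= n)%Z ->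
  (jumps k lo + 1 <= cap)%nat -> merges_within true tab B k lo cap.
Proof.
intros H1 H2 Hcap. exists (fun s => count (stop k lo) s (Z.to_nat (bound_at k lo - s))). split.
- intros s s' Hs [Hs' Hst].
  replace (Z.to_nat (bound_at k lo - s)) with
    (Z.to_nat (s' - 1 - s) + (1 + Z.to_nat (bound_at k lo - s')))%nat by lia.
  rewrite !count_split. simpl.
  replace (s + Z.of_nat (Z.to_nat (s' - 1 - s)))%Z with (s' - 1)%Z by lia. rewrite Hst.
  replace (s' - 1 + 1)%Z with s' by lia. lia.
- pose proof (stop_count k lo H1 H2).
  replace (bound_at k lo - - lo)%Z with (bound_at k lo + lo)%Z by lia. lia.
Qed.

(* A window that is not skipped contains a stop, and each stop is responsible for fewer than [B]
   single steps. *)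
Lemma merges_within_windows B k lo cap : (0 <= lo)%Z -> (lo + pw (S k) <= n)%Z -> (0 < B)%Z ->
  (Z.to_nat (n / B) + 1 + Z.to_nat B * (jumps k lo + 1) <= cap)%nat ->
  merges_within false true B k lo cap.
Proof.
intros H1 H2 HB Hcap.
(* The first summand counts the windows that still fit and pays for skips; the second counts the
   remaining positions that see a stop and pays for single steps. *)
exists (fun s => (Z.to_nat ((bound_at k lo - s) / B) +
  count (near (stop k lo) (Z.to_nat (B - 1))) s (Z.to_nat (bound_at k lo - s)))%nat). split.
- intros s s' Hs [Hs' [->|[-> Hst]]].
  + assert (E : ((bound_at k lo - s) / B = (bound_at k lo - (s + B)) / B + 1)%Z)
      by (rewrite <- Z.div_add by lia; f_equal; lia).
    rewrite E.
    assert (0 <= (bound_at k lo - (s + B)) / B)%Z by (apply Z.div_pos; lia).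
    match goal with |- (_ + ?x < _ + ?y)%nat => assert (x <= y)%nat by (apply count_sub; lia) end. lia.
  + assert ((bound_at k lo - (s + 1)) / B <= (bound_at k lo - s) / B)%Z by (apply Z.div_le_mono; lia).
    replace (Z.to_nat (bound_at k lo - s)) with (S (Z.to_nat (bound_at k lo - (s + 1))))%nat by lia.
    simpl. rewrite Hst. lia.
- assert (Hs := stop_count k lo H1 H2).
  assert (Hn := count_near (stop k lo) (Z.to_nat (B - 1)) (- lo) (- lo) (Z.to_nat (bound_at k lo + lo))).
  specialize (Hn ltac:(intros z Hz; unfold stop; apply andb_false_iff; left; apply Z.ltb_ge; lia) eq_refl).
  replace (bound_at k lo - - lo)%Z with (bound_at k lo + lo)%Z by lia.
  assert ((bound_at k lo + lo) / B <= n / B)%Z.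
  { apply Z.div_le_mono; [lia|]. unfold bound_at. pose proof (pw_pos (S k)). lia. }
  nia.
Qed.

End Envelope.

(** * Oracle calls of programs that only evaluate [f] *)

Fixpoint evaluates_only (c : com) : bool :=
  match c with
  | Skip | ZSet _ _ _ | RSet _ _ _ | Eval _ _ FSelf _ => true
  | Seq c1 c2 | If _ c1 c2 => evaluates_only c1 && evaluates_only c2
  | While _ c => evaluates_only c
  | _ => false
  end.

(** Admissibility follows from the text of the program, since only [FSelf] is evaluated. As every
    call takes at least one operation, a time bound is also a bound on the calls. *)
Lemma exec_calls E c s s' t L : exec E c s s' t L -> evaluates_only c = true ->
  admissible (fn E) L /\ (length L <= t)%nat.
Proof.
induction 1; simpl; intros Hc; try discriminate; try (split; [easy|simpl; lia]).
- apply andb_prop in Hc. destruct Hc as [Hc1 Hc2].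
  destruct (IHexec1 Hc1) as [I1 I2]. destruct (IHexec2 Hc2) as [I3 I4]. split.
  + intros cl Hcl. apply in_app_or in Hcl. destruct Hcl; [now apply I1|now apply I3].
  + rewrite length_app. lia.
- apply andb_prop in Hc. destruct Hc as [Hc1 Hc2].
  destruct IHexec as [I1 I2]; [now destruct (beval s b)|]. split; [easy|lia].
- destruct (IHexec1 Hc) as [I1 I2]. destruct (IHexec2 Hc) as [I3 I4]. split.
  + intros cl Hcl. apply in_app_or in Hcl. destruct Hcl; [now apply I1|now apply I3].
  + rewrite length_app. lia.
- destruct h; try discriminate. split; [|simpl; lia].
  intros cl [<-|[]]. reflexivity.
Qed.

Lemma evo_spo_calls L : (evo_calls L <= length L)%nat /\ (spo_calls L <= length L)%nat.
Proof. split; apply filter_length_le. Qed.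

(** * Frames *)

Fixpoint zmods (c : com) : list nat :=
  match c with
  | ZSet a _ _ | Compare a _ _ _ _ | SignPart a _ _ _ _ => [a]
  | Seq c1 c2 | If _ c1 c2 => zmods c1 ++ zmods c2
  | While _ c => zmods c
  | _ => []
  end.

Fixpoint rmods (c : com) : list nat :=
  match c with
  | RSet a _ _ | Eval a _ _ _ => [a]
  | Seq c1 c2 | If _ c1 c2 => rmods c1 ++ rmods c2
  | While _ c => rmods c
  | _ => []
  end.

Definition mem (a : nat) (l : list nat) : bool := existsb (Nat.eqb a) l.

Lemma mem_In a l : mem a l = true -> In a l.
Proof. intros H. apply existsb_exists in H. destruct H as [x [H E]]. now apply Nat.eqb_eq in E as ->. Qed.

(** Changes are tracked by whole arrays and decided by computation on the program text. This is why
    each working variable of the programs is cell 0 of an array of its own. *)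
Definition frame (c : com) (s s' : state) : Prop :=
  (forall a i, mem a (zmods c) = false -> zmem s' a i = zmem s a i) /\
  (forall a i, mem a (rmods c) = false -> rmem s' a i = rmem s a i).

Lemma upd_other {X} (m : nat -> Z -> X) a i v a' i' : Nat.eqb a' a = false -> upd m a i v a' i' = m a' i'.
Proof. intros H. unfold upd. now rewrite H. Qed.

Lemma upds_other {X} (vs : list X) : forall m a i a' i', Nat.eqb a' a = false -> upds m a i vs a' i' = m a' i'.
Proof.
induction vs as [|v vs IH]; intros m a i a' i' H; simpl; [easy|]. rewrite IH by easy. now apply upd_other.
Qed.

Lemma exec_frame E c s s' t L : exec E c s s' t L -> frame c s s'.
Proof.
induction 1; split; simpl; intros a' i' H'; auto;
  try (unfold mem in H'; rewrite existsb_app in H'; apply orb_false_elim in H'; destruct H' as [H1 H2]);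
  try (destruct IHexec as [J1 J2]); try (destruct IHexec1 as [J1 J2]); try (destruct IHexec2 as [J3 J4]);
  try (unfold mem in H'; simpl in H'; rewrite orb_false_r in H'; first [now apply upd_other|now apply upds_other]).
- rewrite J3, J1; auto.
- rewrite J4, J2; auto.
- destruct (beval s b); apply J1; auto.
- destruct (beval s b); apply J2; auto.
- simpl in J3. rewrite J3, J1; auto.
- simpl in J4. rewrite J4, J2; auto.
Qed.

(** * Weakest preconditions with running time *)

(** Total correctness with a postcondition on the time; the calls are left out, as [exec_calls]
    deals with them. *)
Definition wp (E : env) (c : com) (Q : state -> nat -> Prop) (s : state) : Prop :=
  exists s' t L, exec E c s s' t L /\ Q s' t.

Section Rules.
Variable E : env.

(** The continuation receives the frame, so specifications need only mention what a program
    changes. *)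
Lemma wp_conseq c s (Q Q' : state -> nat -> Prop) :
  wp E c Q s -> (forall s' t, frame c s s' -> Q s' t -> Q' s' t) -> wp E c Q' s.
Proof.
intros [s' [t [L [H1 H2]]]] H. exists s', t, L. split; [easy|]. apply H; [|easy]. eapply exec_frame; eauto.
Qed.

Lemma wp_skip s (Q : state -> nat -> Prop) : Q s 1%nat -> wp E Skip Q s.
Proof. intros H. exists s, 1%nat, []. split; [constructor|easy]. Qed.

Lemma wp_zset a i e s (Q : state -> nat -> Prop) :
  in_space E (zeval s i) ->
  Q (mkState (upd (zmem s) a (zeval s i) (zeval s e)) (rmem s)) (1 + zcost i + zcost e)%nat ->
  wp E (ZSet a i e) Q s.
Proof. intros H1 H2. eexists _, _, _. split; [now constructor|easy]. Qed.

Lemma wp_rset a i e s (Q : state -> nat -> Prop) :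
  in_space E (zeval s i) ->
  Q (mkState (zmem s) (upd (rmem s) a (zeval s i) (reval s e))) (1 + zcost i + rcost e)%nat ->
  wp E (RSet a i e) Q s.
Proof. intros H1 H2. eexists _, _, _. split; [now constructor|easy]. Qed.

Lemma wp_eval a i x s (Q : state -> nat -> Prop) :
  in_space E (zeval s i) -> 0 <= reval s x < INR (dim E) ->
  Q (mkState (zmem s) (upd (rmem s) a (zeval s i) (fn E (reval s x)))) (1 + zcost i + 1 + rcost x)%nat ->
  wp E (Eval a i FSelf x) Q s.
Proof. intros H1 H2 H3. eexists _, _, _. split; [now constructor|easy]. Qed.

Lemma wp_seq c1 c2 s (Q : state -> nat -> Prop) :
  wp E c1 (fun s1 t1 => wp E c2 (fun s2 t2 => Q s2 (1 + t1 + t2)%nat) s1) s -> wp E (Seq c1 c2) Q s.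
Proof.
intros [s1 [t1 [L1 [H1 [s2 [t2 [L2 [H2 H3]]]]]]]].
eexists _, _, _. split; [econstructor; eauto|easy].
Qed.

Lemma wp_if b c1 c2 s (Q : state -> nat -> Prop) :
  (beval s b = true -> wp E c1 (fun s' t => Q s' (1 + bcost b + t)%nat) s) ->
  (beval s b = false -> wp E c2 (fun s' t => Q s' (1 + bcost b + t)%nat) s) ->
  wp E (If b c1 c2) Q s.
Proof.
intros H1 H2. destruct (beval s b) eqn:Hb;
  [destruct (H1 eq_refl) as [s' [t [L [H3 H4]]]]|destruct (H2 eq_refl) as [s' [t [L [H3 H4]]]]];
  exists s', (1 + bcost b + t)%nat, L; (split; [constructor; now rewrite Hb|easy]).
Qed.

Lemma frame_refl c s : frame c s s.
Proof. split; auto. Qed.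

Lemma frame_trans c s1 s2 s3 : frame c s1 s2 -> frame c s2 s3 -> frame c s1 s3.
Proof.
intros [H1 H2] [H3 H4]. split; intros a i H; [rewrite H3, H1|rewrite H4, H2]; auto.
Qed.

(* [Inv s v]: the loop invariant holds and the rest of the loop takes time at most [v]. *)
Lemma wp_while b c s0 v0 (Inv : state -> nat -> Prop) (Q : state -> nat -> Prop) :
  Inv s0 v0 ->
  (forall s v, frame c s0 s -> Inv s v -> beval s b = true ->
     wp E c (fun s' t => exists v', Inv s' v' /\ (1 + bcost b + t + v' <= v)%nat) s) ->
  (forall s v, frame c s0 s -> Inv s v -> beval s b = false ->
     (1 + bcost b <= v)%nat /\ forall t, (t <= v0)%nat -> Q s t) ->
  wp E (While b c) Q s0.
Proof.
intros H0 Hstep Hend.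
assert (Hm : forall v s, frame c s0 s -> Inv s v ->
  exists s' t L, exec E (While b c) s s' t L /\ (t <= v)%nat /\
    exists v', Inv s' v' /\ beval s' b = false /\ frame c s0 s').
{ induction v as [v IH] using lt_wf_ind. intros s Hfr Hi. destruct (beval s b) eqn:Hb.
  - destruct (Hstep s v Hfr Hi Hb) as [s1 [t1 [L1 [Hx [v1 [Hi1 Hv1]]]]]].
    destruct (IH v1 ltac:(lia) s1) as [s2 [t2 [L2 [Hx2 [Ht2 Hf]]]]]; [|easy|].
    + apply frame_trans with s; [easy|]. eapply exec_frame; eauto.
    + exists s2, (1 + bcost b + t1 + t2)%nat, (L1 ++ L2).
      split; [econstructor; eauto|]. split; [lia|easy].
  - destruct (Hend s v Hfr Hi Hb) as [Hv _].
    exists s, (1 + bcost b)%nat, []. split; [now constructor|]. split; [easy|]. exists v. auto. }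
destruct (Hm v0 s0 (frame_refl c s0) H0) as [s' [t [L [Hx [Ht [v' [Hi [Hb Hf]]]]]]]].
exists s', t, L. split; [easy|]. now apply (Hend s' v').
Qed.
End Rules.

(** * Notation for programs, names of arrays, and the query *)

Notation "! v" := (ZGet v (ZLit 0)) (at level 5, format "! v").
Infix ";;" := Seq (at level 60, right associativity).
Declare Scope zexp_scope.
Delimit Scope zexp_scope with ze.
Infix "+" := (ZOp ZAdd) : zexp_scope.
Infix "-" := (ZOp ZSub) : zexp_scope.
Infix "*" := (ZOp ZMul) : zexp_scope.
Infix "/" := (ZOp ZDiv) : zexp_scope.
Infix "mod" := (ZOp ZMod) : zexp_scope.
Infix "<=" := BZle : zexp_scope.
Notation "x < y" := (BZle (ZOp ZAdd x (ZLit 1)) y) : zexp_scope.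
Notation "x = y" := (BAnd (BZle x y) (BZle y x)) : zexp_scope.
Notation "'lit' z" := (ZLit z) (at level 5).
Notation "v ::= e" := (ZSet v (ZLit 0) e%ze) (at level 55).

(* The pieces of node [v] are numbered [ST[v], ..., ST[v+1] - 1]; piece [t] starts at [s = PX[t]]
   and has the minimizer [PW[t]]. *)
Notation FLAG := 1%nat.
Notation ST := 2%nat.
Notation PX := 3%nat.
Notation PW := 4%nat.
Notation QS := 31%nat.
Notation QL := 32%nat.
Notation QR := 33%nat.
Notation QP := 34%nat.
Notation QQ := 35%nat.
Notation QM := 36%nat.
Notation QV := 37%nat.
Notation QW := 38%nat.
Notation RES := 1%nat.
Notation FV := 2%nat.
Notation VAL := 8%nat.

Notation size := (ZGet 0 (lit 0)).

Definition visit : com :=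
  QP ::= ZGet ST !QV ;;
  QQ ::= ZGet ST (!QV + lit 1) ;;
  While (!QP + lit 1 < !QQ)%ze
    (QM ::= (!QP + !QQ) / lit 2 ;;
     If (ZGet PX !QM <= !QS)%ze (QP ::= !QM) (QQ ::= !QM)) ;;
  QW ::= ZGet PW !QP ;;
  RSet VAL (lit 0) (ROp RAdd (RGet 0 !QW) (RGet FV (!QS + !QW)%ze)) ;;
  If (BAnd (lit 1 <= !FLAG)%ze (BRle (RGet RES (lit 0)) (RGet VAL (lit 0))))
    Skip
    (FLAG ::= lit 1 ;; RSet RES (lit 0) (RGet VAL (lit 0))).

(** A climb from the leaves. If [QL] is odd it is a right child, whose parent reaches too far to the
    left, so it is visited by itself; likewise the left child [QR - 1] if [QR] is odd. The right end
    is first cut at [n - s], where [s + w] leaves the domain of [f]. *)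
Definition query : com :=
  QS ::= ZGet 0 (lit 3) - ZGet 0 (lit 1) ;;
  QL ::= ZGet 0 (lit 1) ;;
  QR ::= ZGet 0 (lit 2) ;;
  If (size - !QS <= !QR)%ze (QR ::= size - !QS) Skip ;;
  FLAG ::= lit 0 ;;
  While (!QL < !QR)%ze
    (If (lit 1 <= !QL mod lit 2)%ze (QV ::= !QL ;; visit ;; QL ::= !QL + lit 1) Skip ;;
     If (lit 1 <= !QR mod lit 2)%ze (QR ::= !QR - lit 1 ;; QV ::= !QR ;; visit) Skip ;;
     QL ::= size + !QL / lit 2 ;;
     QR ::= size + !QR / lit 2).

(** The last clause makes pieces maximal: each start of a further piece is a genuine change of [W],
    so that the ends of pieces met by a merge are jumps. *)
Definition runs (px pw : Z -> Z) (W : Z -> Z) (u D st en : Z) : Prop :=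
  px st = u /\
  forall t, (st <= t < en)%Z ->
    let e := if (t + 1 <? en)%Z then px (t + 1)%Z else D in
    (px t < e)%Z /\ (forall z, (px t <= z < e)%Z -> W z = pw t) /\
    ((t + 1 < en)%Z -> pw (t + 1)%Z <> pw t).

(* The nodes are numbered level by level, [off m k] being the first one of level [k]; so node
   [j >= n] has the children [2 (j - n)] and [2 (j - n) + 1], and node [c] has the parent [n + c / 2]. *)
Definition off (m k : nat) : Z := (2 * pw m - 2 * pw (m - k))%Z.

Ltac sim := cbn [zeval reval beval zop_sem rop_sem zmem rmem upd Nat.eqb andb negb Z.eqb
  with_args upds].
Ltac sim_in H := cbn [zeval reval beval zop_sem rop_sem zmem rmem upd Nat.eqb andb negb Z.eqb
  with_args upds] in H.
Ltac cost := cbn [zcost rcost bcost fcost].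
Ltac step := first
  [ apply wp_seq | apply wp_zset; [|sim] | apply wp_rset; [|sim] | apply wp_skip ].

Lemma beval_zle s e1 e2 : beval s (BZle e1 e2) = true <-> (zeval s e1 <= zeval s e2)%Z.
Proof. apply Z.leb_le. Qed.

Lemma beval_zle_false s e1 e2 : beval s (BZle e1 e2) = false <-> (zeval s e2 < zeval s e1)%Z.
Proof. apply Z.leb_gt. Qed.

Tactic Notation "unchanged" constr(a) "from" constr(s) "to" constr(s') "by" constr(H) "as" ident(e) :=
  assert (e : forall i, zmem s' a i = zmem s a i) by (intros; rewrite (proj1 H a) by reflexivity; reflexivity).
Tactic Notation "real" "unchanged" constr(a) "from" constr(s) "to" constr(s') "by" constr(H) "as" ident(e) :=
  assert (e : forall i, rmem s' a i = rmem s a i) by (intros; rewrite (proj2 H a) by reflexivity; reflexivity).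

(** * Correctness and time of the query *)

Section Query.
Variables (m : nat) (A : list R) (f : R -> R) (spo : spo_oracle) (space : nat).
Let E := mkEnv (2 ^ m)%nat f spo space.
Definition arr (A : list R) (z : Z) : R := nth (Z.to_nat z) A 0.
Definition onZ (f : R -> R) (z : Z) : R := f (IZR z).

Hypothesis space_pos : (0 < space)%nat.

Lemma in_space_0 : in_space E 0.
Proof. unfold in_space, E. simpl. lia. Qed.

Definition inputs (s : state) : Prop :=
  zmem s 0%nat 0%Z = pw m /\
  (forall z, (0 <= z < pw m)%Z -> rmem s 0%nat z = arr A z) /\
  (forall z, (0 <= z < pw m)%Z -> rmem s FV z = onZ f z).

(** Two bounds on the number of pieces: [pw m] limits a binary search to [m] rounds, [cap] enters
    the cost of the merge above. *)
Definition node_ok (cap : nat) (s : state) (id : Z) (k : nat) (lo : Z) : Prop :=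
  let st := zmem s ST id in
  let en := zmem s ST (id + 1)%Z in
  (0 <= st < en)%Z /\ (en - st <= pw m)%Z /\ (en - st <= Z.of_nat cap)%Z /\
  runs (zmem s PX) (zmem s PW) (winner (arr A) (onZ f) k lo) (- lo) (pw m - lo - pw k + 1) st en.

Definition best (P : Z -> Prop) (sh : Z) (s : state) : Prop :=
  (zmem s FLAG 0%Z = 0%Z /\ forall w, ~ P w) \/
  (zmem s FLAG 0%Z = 1%Z /\ exists w, P w /\ rmem s RES 0%Z = candidate (arr A) (onZ f) w sh /\
    forall w', P w' -> candidate (arr A) (onZ f) w sh <= candidate (arr A) (onZ f) w' sh).

(** The minimizer stored in the piece found is [winner], whose candidate is minimal over the whole
    node; so a single comparison extends the current best to all positions of the node. *)
Lemma wp_visit s cap k lo (P : Z -> Prop) :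
  inputs s -> node_ok cap s (zmem s QV 0%Z) k lo -> (0 <= lo)%Z -> (lo + pw k <= pw m)%Z ->
  (- lo <= zmem s QS 0%Z <= pw m - lo - pw k)%Z ->
  best P (zmem s QS 0%Z) s ->
  wp E visit (fun s' t => best (fun w => P w \/ (lo <= w < lo + pw k)%Z) (zmem s QS 0%Z) s' /\
    (t <= 60 * (m + 2))%nat) s.
Proof.
intros [Hn [HA HF]] [Hst [Hen [_ [Hu Hruns]]]] Hlo Hlok Hsh Hbest.
assert (H0 := in_space_0).
unfold visit. set (st := zmem s ST (zmem s QV 0%Z)) in *. set (en := zmem s ST (zmem s QV 0%Z + 1)%Z) in *.
set (sh := zmem s QS 0%Z) in *.
do 4 (step; [exact H0|] || step).
apply wp_seq.
(* [pw e] bounds the number of pieces left, so [e] bounds the rounds to come. The index [en] acts as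
   a piece that starts at infinity. *)
apply wp_while with (v0 := (50 * m + 50)%nat) (Inv := fun s1 v => exists e, v = (50 * e + 50)%nat /\
  (zmem s1 QQ 0%Z - zmem s1 QP 0%Z <= pw e)%Z /\
  (st <= zmem s1 QP 0%Z < zmem s1 QQ 0%Z)%Z /\ (zmem s1 QQ 0%Z <= en)%Z /\
  (zmem s PX (zmem s1 QP 0%Z) <= sh)%Z /\
  ((zmem s1 QQ 0 < en)%Z -> (sh < zmem s PX (zmem s1 QQ 0))%Z)).
- exists m. sim. fold st en. repeat split; lia.

- intros s1 v Hf [e [-> [H1 [H2 [H3 [H4 H5]]]]]] Hb.
  apply beval_zle in Hb. sim_in Hb.
  unchanged PX from s to s1 by Hf as E3. unchanged QS from s to s1 by Hf as E31.
  step. step; [exact H0|]. set (mid := ((zmem s1 34%nat 0 + zmem s1 35%nat 0) / 2)%Z).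
  assert (Hmid : (2 * mid <= zmem s1 34%nat 0 + zmem s1 35%nat 0 < 2 * mid + 2)%Z).
  { unfold mid. pose proof (Z_div_mod_eq_full (zmem s1 34%nat 0 + zmem s1 35%nat 0) 2).
    pose proof (Z.mod_pos_bound (zmem s1 34%nat 0 + zmem s1 35%nat 0) 2). lia. }
  destruct e as [|e]; [unfold pw in H1; simpl in H1; lia|]. rewrite pw_S in H1.
  apply wp_if; intros Hb'; [apply beval_zle in Hb'|apply beval_zle_false in Hb']; sim_in Hb';
    rewrite E3, E31 in Hb'; fold sh in Hb'; (step; [exact H0|]);
    (eexists; split; [exists e; split; [reflexivity|]|cost; lia]);
    repeat split; try lia; fold mid; auto; lia.
- intros s1 v Hf [e [-> [H1 [H2 [H3 [H4 H5]]]]]] Hb.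
  apply beval_zle_false in Hb. sim_in Hb. split; [cost; lia|]. intros t Ht.
  unchanged PW from s to s1 by Hf as E4. unchanged QS from s to s1 by Hf as E31.
  unchanged FLAG from s to s1 by Hf as E1.
  real unchanged 0%nat from s to s1 by Hf as R0. real unchanged FV from s to s1 by Hf as R2.
  real unchanged RES from s to s1 by Hf as R1.
  set (p := zmem s1 34%nat 0%Z) in *. set (q := zmem s1 35%nat 0%Z) in *.
  assert (Hq : q = (p + 1)%Z) by lia. rewrite Hq in *. clear Hq.
  assert (HW : winner (arr A) (onZ f) k lo sh = zmem s PW p).
  { apply (Hruns p ltac:(lia)). split; [easy|]. destruct (Z.ltb_spec (p + 1) en); [now apply H5|lia]. }
  assert (Hwr := winner_range (arr A) (onZ f) k lo sh). assert (Hwm := winner_min (arr A) (onZ f) k lo sh).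
  rewrite HW in Hwr, Hwm. set (w := zmem s PW p) in *.
  assert (Hval : rmem s1 0%nat w + rmem s1 FV (sh + w)%Z = candidate (arr A) (onZ f) w sh).
  { unfold candidate. rewrite R0, R2, HA, HF by lia. reflexivity. }
  assert (Ep : zmem s1 4%nat (zmem s1 34%nat 0%Z) = w) by apply E4.
  step. step; [exact H0|]. step. step; [exact H0|].
  rewrite Ep, E31. fold sh. rewrite Hval.
  apply wp_if; intros Hb'.
  + step. split; [|cost; lia].
    sim_in Hb'. apply andb_prop in Hb'. destruct Hb' as [Hb1 Hb2].
    apply Z.leb_le in Hb1. apply Rleb_true in Hb2. rewrite E1 in Hb1. rewrite R1 in Hb2.
    destruct Hbest as [[Hz _]|[Hz [w0 [Hw0 [Hv0 Hmin]]]]]; [lia|].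
    right. sim. rewrite E1, R1. split; [easy|]. exists w0. split; [now left|]. split; [easy|].
    intros w' [Hw'|Hw']; [now apply Hmin|]. specialize (Hwm w' Hw'). lra.
  + step. step; [exact H0|]. step; [exact H0|]. split; [|cost; lia].
    right. sim. split; [easy|]. exists w. split; [right; lia|]. split; [easy|].
    intros w' [Hw'|Hw']; [|now apply Hwm].
    sim_in Hb'. rewrite E1, R1 in Hb'.
    destruct Hbest as [[_ Hno]|[Hz [w0 [Hw0 [Hv0 Hmin]]]]]; [now apply Hno in Hw'|].
    rewrite Hz in Hb'. simpl in Hb'. apply Rleb_false in Hb'. specialize (Hmin w' Hw'). lra.
Qed.


Lemma runs_ext px pw px' pw' W u D st en :
  (forall i, px' i = px i) -> (forall i, pw' i = pw i) ->
  runs px pw W u D st en -> runs px' pw' W u D st en.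
Proof.
intros H1 H2 [H3 H4]. split; [now rewrite H1|]. intros t Ht. specialize (H4 t Ht).
rewrite !H1, !H2. exact H4.
Qed.

Variable caps : nat -> nat.

Definition valid (s : state) : Prop :=
  inputs s /\
  forall k q, (k <= m)%nat -> (0 <= q < pw (m - k))%Z -> node_ok (caps k) s (off m k + q) k (q * pw k).

Lemma inputs_keep s s' : zmem s' 0%nat 0%Z = zmem s 0%nat 0%Z ->
  (forall i, rmem s' 0%nat i = rmem s 0%nat i) -> (forall i, rmem s' FV i = rmem s FV i) ->
  inputs s -> inputs s'.
Proof.
intros H1 H2 H3 [I1 [I2 I3]]. split; [now rewrite H1|].
split; intros z Hz; [rewrite H2|rewrite H3]; auto.
Qed.

Lemma node_ok_keep s s' cap id k lo : (forall i, zmem s' ST i = zmem s ST i) ->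
  (forall i, zmem s' PX i = zmem s PX i) -> (forall i, zmem s' PW i = zmem s PW i) ->
  node_ok cap s id k lo -> node_ok cap s' id k lo.
Proof.
intros H1 H2 H3 [I1 [I2 [I3 I4]]]. unfold node_ok. rewrite !H1. refine (conj I1 (conj I2 (conj I3 _))).
apply (runs_ext (zmem s PX) (zmem s PW)); auto.
Qed.

(** Integer array 0 enters through its cell 0 alone, because its other cells receive the arguments
    of queries. *)
Lemma valid_keep s s' : zmem s' 0%nat 0%Z = zmem s 0%nat 0%Z ->
  (forall a i, mem a [ST; PX; PW] = true -> zmem s' a i = zmem s a i) ->
  (forall a i, mem a [0%nat; FV] = true -> rmem s' a i = rmem s a i) ->
  valid s -> valid s'.
Proof.
intros H0 H1 H2 [I1 I2]. split.
- apply (inputs_keep s); auto.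
- intros k q Hk Hq. apply (node_ok_keep s); auto.
Qed.

Lemma valid_frame c s s' : frame c s s' ->
  mem 0 (zmods c) || mem ST (zmods c) || mem PX (zmods c) || mem PW (zmods c) = false ->
  mem 0 (rmods c) || mem FV (rmods c) = false -> valid s -> valid s'.
Proof.
intros [Hz Hr] H1 H2. rewrite !orb_false_iff in H1. rewrite orb_false_iff in H2. destruct H1 as [[[Z0 Z1] Z2] Z3].
destruct H2 as [R0 R1].
apply valid_keep; [now apply Hz| |]; intros a i Ha; apply mem_In in Ha.
- destruct Ha as [<-|[<-|[<-|[]]]]; now apply Hz.
- destruct Ha as [<-|[<-|[]]]; now apply Hr.
Qed.

Lemma best_ext (P Q : Z -> Prop) sh s : (forall w, P w <-> Q w) -> best P sh s -> best Q sh s.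
Proof.
intros H [[H1 H2]|[H1 [w [H2 [H3 H4]]]]]; [left|right]; split; auto.
- intros w Hw. apply (H2 w). now apply H.
- exists w. split; [now apply H|]. split; [easy|]. intros w' Hw'. now apply H4, H.
Qed.

Lemma best_keep P sh s s' : zmem s' FLAG 0%Z = zmem s FLAG 0%Z -> rmem s' RES 0%Z = rmem s RES 0%Z ->
  best P sh s -> best P sh s'.
Proof. intros H1 H2. unfold best. now rewrite H1, H2. Qed.

(** Positions of [[i, r)] already accounted for while the nodes [la] to [rh - 1] of level [k]
    remain. *)
Definition outside (i r : Z) (k : nat) (la rh w : Z) : Prop :=
  (i <= w < la * pw k)%Z \/ (rh * pw k <= w < r)%Z.

Definition climbing (i r sh : Z) (k : nat) (la rh : Z) (s : state) : Prop :=
  valid s /\ (k <= m)%nat /\ zmem s QL 0%Z = (off m k + la)%Z /\ zmem s QR 0%Z = (off m k + rh)%Z /\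
   zmem s QS 0%Z = sh /\ (0 <= la <= rh)%Z /\ (rh <= pw (m - k))%Z /\
   (i <= la * pw k)%Z /\ (rh * pw k <= r)%Z /\ best (outside i r k la rh) sh s.

Lemma off_even k : (off m k mod 2 = 0)%Z.
Proof. unfold off. replace (2 * pw m - 2 * pw (m - k))%Z with ((pw m - pw (m - k)) * 2)%Z by lia. apply Z_mod_mult. Qed.

(** A visited node lies inside [[i, r)]; with [- i <= sh] and [r <= pw m - sh] this puts [sh] into
    the range for which the node stores pieces. *)
Lemma wp_climb_left i r sh k la rh s : (- i <= sh)%Z -> (r <= pw m - sh)%Z -> (la < rh)%Z ->
  climbing i r sh k la rh s ->
  wp E (If (lit 1 <= !QL mod lit 2)%ze (QV ::= !QL ;; visit ;; QL ::= !QL + lit 1) Skip)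
    (fun s' t => (exists la', (la' mod 2 = 0)%Z /\ (la <= la')%Z /\ climbing i r sh k la' rh s') /\
   (t <= 60 * (m + 2) + 50)%nat) s.
Proof.
intros Hi Hr Hlt [Hv [Hk [HL [HR [HS [H1 [H2 [H3 [H4 Hb]]]]]]]]].
assert (H0 := in_space_0).
(* Levels begin at even identifiers, so an identifier has the parity of its index within the
   level. *)
assert (Hpar : ((off m k + la) mod 2 = la mod 2)%Z).
{ rewrite Zplus_mod, off_even, Z.add_0_l, Z.mod_mod; lia. }
assert (Hpk := pw_pos k).
assert (Hpm : (pw m = pw (m - k) * pw k)%Z) by (rewrite <- pw_add; f_equal; lia).
assert (Hmb := Z.mod_pos_bound la 2).
apply wp_if; intros Hc; [apply beval_zle in Hc|apply beval_zle_false in Hc]; sim_in Hc;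
  rewrite HL, Hpar in Hc.
- step. step; [exact H0|]. step.
  set (s1 := mkState _ _).
  assert (Hv1 : valid s1) by (apply (valid_keep s); try easy;
    intros a z Ha; apply mem_In in Ha; destruct Ha as [<-|[<-|[<-|[]]]]; easy).
  destruct Hv1 as [Hin1 Hn1].
  apply wp_conseq with (1 := wp_visit s1 (caps k) k (la * pw k) (outside i r k la rh) Hin1
    ltac:(unfold s1; sim; rewrite HL; apply Hn1; lia) ltac:(nia) ltac:(nia)
    ltac:(unfold s1; sim; rewrite HS; nia)
    ltac:(unfold s1; sim; rewrite HS; apply (best_keep _ _ s); easy)).
  intros s2 t2 Hf [Hb2 Ht2]. 
  step; [exact H0|]. split; [|cost; lia].
  set (s3 := mkState _ _). unfold s1 in Hb2. sim_in Hb2. rewrite HS in Hb2.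
  unchanged QL from s1 to s2 by Hf as EL. unchanged QR from s1 to s2 by Hf as ER.
  unchanged QS from s1 to s2 by Hf as ES.
  exists (la + 1)%Z. split; [rewrite Zplus_mod; replace (la mod 2)%Z with 1%Z by lia; reflexivity|].
  split; [lia|]. split.
  { apply (valid_keep s2); try easy;
    [intros a z Ha; apply mem_In in Ha; destruct Ha as [<-|[<-|[<-|[]]]]; easy|].
    apply (valid_frame _ s1 s2 Hf); easy. }
  split; [easy|]. unfold s3. sim. rewrite EL, ER, ES. unfold s1. sim. rewrite HL.
  repeat split; try lia; try nia.
  apply (best_keep _ _ s2); try easy. revert Hb2. apply best_ext.
  intros w. unfold outside. nia.
- step. split; [|cost; lia]. exists la. split; [lia|]. split; [lia|]. split; [exact Hv|]. repeat split; easy.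
Qed.

(** Since [la] is even, an odd [rh] differs from it, so node [rh - 1] is still uncovered. *)
Lemma wp_climb_right i r sh k la rh s : (- i <= sh)%Z -> (r <= pw m - sh)%Z ->
  (la mod 2 = 0)%Z -> climbing i r sh k la rh s ->
  wp E (If (lit 1 <= !QR mod lit 2)%ze (QR ::= !QR - lit 1 ;; QV ::= !QR ;; visit) Skip)
    (fun s' t => (exists rh', (rh' mod 2 = 0)%Z /\ (rh' <= rh)%Z /\ climbing i r sh k la rh' s') /\
   (t <= 60 * (m + 2) + 50)%nat) s.
Proof.
intros Hi Hr Hla [Hv [Hk [HL [HR [HS [H1 [H2 [H3 [H4 Hb]]]]]]]]].
assert (H0 := in_space_0).
assert (Hpar : ((off m k + rh) mod 2 = rh mod 2)%Z).
{ rewrite Zplus_mod, off_even, Z.add_0_l, Z.mod_mod; lia. }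
assert (Hpk := pw_pos k).
assert (Hpm : (pw m = pw (m - k) * pw k)%Z) by (rewrite <- pw_add; f_equal; lia).
assert (Hmb := Z.mod_pos_bound rh 2).
apply wp_if; intros Hc; [apply beval_zle in Hc|apply beval_zle_false in Hc]; sim_in Hc;
  rewrite HR, Hpar in Hc.
- assert (Hlt : (la <> rh)%Z) by (intros ->; lia).
  step. step; [exact H0|]. step. step; [exact H0|].
  set (s1 := mkState _ _).
  assert (Hv1 : valid s1) by (apply (valid_keep s); try easy;
    intros a z Ha; apply mem_In in Ha; destruct Ha as [<-|[<-|[<-|[]]]]; easy).
  destruct Hv1 as [Hin1 Hn1].
  apply wp_conseq with (1 := wp_visit s1 (caps k) k ((rh - 1) * pw k) (outside i r k la rh) Hin1
    ltac:(unfold s1; sim; rewrite HR; replace (off m k + rh - 1)%Z with (off m k + (rh - 1))%Z by lia; apply Hn1; lia)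
    ltac:(nia) ltac:(nia)
    ltac:(unfold s1; sim; rewrite HS; nia)
    ltac:(unfold s1; sim; rewrite HS; apply (best_keep _ _ s); easy)).
  intros s2 t2 Hf [Hb2 Ht2]. split; [|cost; lia].
  unfold s1 in Hb2. sim_in Hb2. rewrite HS in Hb2.
  unchanged QL from s1 to s2 by Hf as EL. unchanged QR from s1 to s2 by Hf as ER.
  unchanged QS from s1 to s2 by Hf as ES.
  exists (rh - 1)%Z. split.
  { rewrite Zminus_mod; replace (rh mod 2)%Z with 1%Z by lia; reflexivity. }
  split; [lia|]. split.
  { apply (valid_frame _ s1 s2 Hf); easy. }
  split; [easy|]. rewrite EL, ER, ES. unfold s1. sim. rewrite HR.
  repeat split; try lia; try nia.
  revert Hb2. apply best_ext. intros w. unfold outside. nia.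
- step. split; [|cost; lia]. exists rh. split; [lia|]. split; [lia|]. split; [exact Hv|]. repeat split; easy.
Qed.

Lemma fold_min (g : nat -> R) (l : list nat) :
  (l = [] /\ fold_right Rbar_min p_infty (map (fun k => Finite (g k)) l) = p_infty) \/
  (exists k, In k l /\ fold_right Rbar_min p_infty (map (fun k => Finite (g k)) l) = Finite (g k) /\
   forall k', In k' l -> g k <= g k').
Proof.
induction l as [|k l [[-> _]|[k0 [H1 [H2 H3]]]]]; [now left| |]; right.
- exists k. split; [now left|]. split; [easy|]. intros k' [->|[]]. lra.
- simpl. rewrite H2. simpl. unfold Rmin. destruct Rle_dec.
  + exists k. split; [now left|]. split; [easy|]. intros k' [->|H]; [lra|]. specialize (H3 k' H). lra.
  + exists k0. split; [now right|]. split; [easy|]. intros k' [->|H]; [lra|]. now apply H3.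
Qed.

Lemma best_result i j x s :
  best (fun w => (Z.of_nat i <= w < Z.min (Z.of_nat j) (pw m - (Z.of_nat x - Z.of_nat i)))%Z)
    (Z.of_nat x - Z.of_nat i) s ->
  result s = Defs.F (2 ^ m) A f i j x.
Proof.
intros Hb. unfold Defs.F. rewrite pw_nat in Hb.
set (l := filter _ _). set (g := fun k => nth (i + k) A 0 + f (INR (x + k))).
assert (Hl : forall k, In k l <-> (k < j - i /\ x + k < 2 ^ m)%nat).
{ intros k. unfold l. rewrite filter_In, in_seq, Nat.ltb_lt. lia. }
assert (Hg : forall k, candidate (arr A) (onZ f) (Z.of_nat (i + k)) (Z.of_nat x - Z.of_nat i) = g k).
{ intros k. unfold candidate, arr, onZ, g. rewrite Nat2Z.id, INR_IZR_INZ. do 3 f_equal. lia. }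
change (result s = fold_right Rbar_min p_infty (map (fun k => Finite (g k)) l)). unfold result.
destruct Hb as [[-> Hno]|[-> [w [Hw [-> Hmin]]]]]; simpl;
  destruct (fold_min g l) as [[Hnil ->]|[k0 [H1 [-> H3]]]]; try easy.
- exfalso. apply Hl in H1. apply (Hno (Z.of_nat (i + k0))). lia.
- exfalso. assert (Hin : In (Z.to_nat (w - Z.of_nat i)) l) by (apply Hl; lia). now rewrite Hnil in Hin.
- f_equal. replace w with (Z.of_nat (i + Z.to_nat (w - Z.of_nat i))) by lia. rewrite Hg.
  apply Rle_antisym.
  + rewrite <- (Hg k0), <- (Hg (Z.to_nat (w - Z.of_nat i))).
    replace (Z.of_nat (i + Z.to_nat (w - Z.of_nat i))) with w by lia.
    apply Hmin. apply Hl in H1. lia.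
  + apply H3. apply Hl. lia.
Qed.


Lemma off_S k : (k < m)%nat -> (off m (S k) = pw m + off m k / 2)%Z.
Proof.
intros H. unfold off. replace (m - k)%nat with (S (m - S k)) by lia. rewrite pw_S.
replace (2 * pw m - 2 * (2 * pw (m - S k)))%Z with ((pw m - 2 * pw (m - S k)) * 2)%Z by lia.
rewrite Z_div_mult; lia.
Qed.

Lemma wp_query s i j x : (i <= 2 ^ m)%nat -> (j <= 2 ^ m)%nat -> (x < 2 ^ m)%nat -> valid s ->
  wp E query (fun s' t => valid s' /\ result s' = Defs.F (2 ^ m) A f i j x /\
    (t <= 400 * (m + 2) * (m + 2))%nat) (with_args i j x s).
Proof.
intros Hi Hj Hx Hv. assert (H0 := in_space_0).
assert (Hv0 : valid (with_args i j x s)).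
{ apply (valid_keep s); try easy;
    intros a z Ha; apply mem_In in Ha; destruct Ha as [<-|[<-|[<-|[]]]]; easy. }
assert (Hn := proj1 (proj1 Hv0)).
cut (wp E query (fun s' t => result s' = Defs.F (2 ^ m) A f i j x /\
    (t <= 400 * (m + 2) * (m + 2))%nat) (with_args i j x s)).
{ intros H. apply wp_conseq with (1 := H). intros s' t Hf H'. split; [|easy].
  apply (valid_frame _ _ _ Hf); easy. }
set (s0 := with_args i j x s) in *.
assert (A1 : zmem s0 0%nat 1%Z = Z.of_nat i) by reflexivity.
assert (A2 : zmem s0 0%nat 2%Z = Z.of_nat j) by reflexivity.
assert (A3 : zmem s0 0%nat 3%Z = Z.of_nat x) by reflexivity.
clearbody s0.
set (sh := (Z.of_nat x - Z.of_nat i)%Z). set (r := Z.min (Z.of_nat j) (pw m - sh)).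
assert (Hpm := pw_nat m).
unfold query. step. step; [exact H0|]. step. step; [exact H0|]. step. step; [exact H0|].
apply wp_seq.
match goal with |- wp ?E ?c _ ?s => 
  apply (wp_conseq E c s (fun s' t => zmem s' QR 0%Z = r /\ (t <= 20)%nat)) end.
{ apply wp_if; intros Hb; [apply beval_zle in Hb|apply beval_zle_false in Hb]; sim_in Hb;
    rewrite ?Hn, ?A1, ?A2, ?A3 in Hb; step; try exact H0; sim; rewrite ?Hn, ?A1, ?A2, ?A3;
    (split; [|cost; lia]); unfold r, sh; lia. }
intros s1 t1 Hf1 [Hr1 Ht1].
match type of Hf1 with frame _ ?s _ => set (sa := s) in Hf1 end.
unchanged QL from sa to s1 by Hf1 as E0. unchanged QS from sa to s1 by Hf1 as E1.
unchanged 0%nat from sa to s1 by Hf1 as En.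
assert (Hva : valid sa) by (apply (valid_keep s0); try easy;
    intros a z Ha; apply mem_In in Ha; destruct Ha as [<-|[<-|[<-|[]]]]; easy).
assert (Hv1 := valid_frame _ _ _ Hf1 eq_refl eq_refl Hva).
unfold sa in E0, E1, En. sim_in E0. specialize (E1 0%Z). sim_in E1. rewrite A1, A3 in E1. specialize (E0 0%Z).
sim_in E0. rewrite A1 in E0. fold sh in E1. clear Hf1 Hva sa En.
step. step; [exact H0|]. set (s2 := mkState _ _).
assert (Hv2 : valid s2) by (apply (valid_keep s1); try easy;
    intros a z Ha; apply mem_In in Ha; destruct Ha as [<-|[<-|[<-|[]]]]; easy).
assert (G1 : zmem s2 QL 0%Z = Z.of_nat i) by exact E0.
assert (G2 : zmem s2 QR 0%Z = r) by exact Hr1.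
assert (G3 : zmem s2 QS 0%Z = sh) by exact E1.
assert (G4 : zmem s2 FLAG 0%Z = 0%Z) by reflexivity.
clearbody s2.
(* Each level costs at most [300 * (m + 2)]. The second alternative describes the states that stand
   on no level: an empty range at the start, with the full time bound, and the passage beyond the
   root. *)
apply wp_while with (v0 := (300 * (m + 2) * (m + 1) + 50)%nat) (Inv := fun s' v =>
  (exists k la rh, v = (300 * (m + 2) * (m + 1 - k) + 50)%nat /\
     climbing (Z.of_nat i) r sh k la rh s') \/
  (v = 50%nat \/ v = (300 * (m + 2) * (m + 1) + 50)%nat) /\ (zmem s' QR 0 <= zmem s' QL 0)%Z /\
     best (fun w => (Z.of_nat i <= w < r)%Z) sh s').
- destruct (Z_lt_le_dec (Z.of_nat i) r) as [Hlt|Hle].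
  + left. exists 0%nat, (Z.of_nat i), r. split; [f_equal; f_equal; lia|].
    assert (Hoff : off m 0 = 0%Z) by (unfold off; rewrite Nat.sub_0_r; lia).
    assert (Hp0 : pw 0 = 1%Z) by reflexivity.
    split; [easy|]. rewrite Hoff, Nat.sub_0_r, Hp0. repeat split; try lia; try easy.
    left. split; [easy|]. unfold outside. lia.
  + right. split; [now right|]. split; [lia|].
    left. split; [easy|]. intros w Hw. lia.
- intros s3 v Hf [[k [la [rh [-> Hcl]]]]|[_ [Hc _]]] Hb;
    apply beval_zle in Hb; sim_in Hb; [|lia].
  assert (Hsh : (- Z.of_nat i <= sh)%Z) by lia. assert (Hr : (r <= pw m - sh)%Z) by lia.
  assert (Hlt : (la < rh)%Z).
  { destruct Hcl as [_ [_ [HL [HR _]]]]. lia. }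
  apply wp_seq. apply wp_conseq with (1 := wp_climb_left _ _ _ _ _ _ _ Hsh Hr Hlt Hcl).
  intros s4 t4 _ [[la' [Hla [Hle Hcl4]]] Ht4].
  apply wp_seq. apply wp_conseq with (1 := wp_climb_right _ _ _ _ _ _ _ Hsh Hr Hla Hcl4).
  intros s5 t5 _ [[rh' [Hrh [Hle' Hcl5]]] Ht5].
  destruct Hcl5 as [Hv5 [Hk [HL [HR [HS [B1 [B2 [B3 [B4 B5]]]]]]]]].
  assert (Hn5 := proj1 (proj1 Hv5)).
  step. step; [exact H0|]. rewrite HL, Hn5. step; [exact H0|]. rewrite HR, Hn5.
  assert (Ela : (la' = 2 * (la' / 2))%Z) by (pose proof (Z_div_mod_eq_full la' 2); lia).
  assert (Erh : (rh' = 2 * (rh' / 2))%Z) by (pose proof (Z_div_mod_eq_full rh' 2); lia).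
  set (la2 := (la' / 2)%Z) in *. set (rh2 := (rh' / 2)%Z) in *.
  assert (Ho : (off m k = 2 * (off m k / 2))%Z).
  { pose proof (Z_div_mod_eq_full (off m k) 2). pose proof (off_even k). lia. }
  assert (Dl : ((off m k + la') / 2 = off m k / 2 + la2)%Z).
  { rewrite Ela, (Z.mul_comm 2 la2), Z.div_add; lia. }
  assert (Dr : ((off m k + rh') / 2 = off m k / 2 + rh2)%Z).
  { rewrite Erh, (Z.mul_comm 2 rh2), Z.div_add; lia. }
  rewrite Dl, Dr.
  destruct (Nat.eq_dec k m) as [->|Hkm].
  (* At the root both indices are even and at most 1, hence 0: everything is covered. *)
  + exists 50%nat. split; [right|replace (m + 1 - m)%nat with 1%nat by lia; cost; nia].
    rewrite Nat.sub_diag in B2. change (pw 0) with 1%Z in B2.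
    assert (la2 = 0%Z /\ rh2 = 0%Z) as [Z1 Z2] by lia.
    split; [now left|]. sim. split; [lia|].
    apply (best_keep _ _ s5); try easy. revert B5. apply best_ext. intros w. unfold outside.
    rewrite Ela, Erh, Z1, Z2 in *. lia.
  + exists (300 * (m + 2) * (m + 1 - S k) + 50)%nat. split.
    * left. exists (S k), la2, rh2. split; [easy|].
      assert (Hpk : pw (m - k) = (2 * pw (m - S k))%Z) by (rewrite <- pw_S; f_equal; lia).
      split; [|split; [lia|]].
      { apply (valid_keep s5); try easy;
        intros a z Ha; apply mem_In in Ha; destruct Ha as [<-|[<-|[<-|[]]]]; easy. }
      sim. rewrite off_S, pw_S by lia. repeat split; try lia; try nia.
      apply (best_keep _ _ s5); try easy. revert B5. apply best_ext. intros w. unfold outside.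
      rewrite pw_S. replace (la2 * (2 * pw k))%Z with (la' * pw k)%Z by (rewrite Ela; ring).
      replace (rh2 * (2 * pw k))%Z with (rh' * pw k)%Z by (rewrite Erh; ring). lia.
    * replace (m + 1 - k)%nat with (S (m + 1 - S k))%nat by lia. cost. lia.
- intros s3 v Hf Hinv Hb. apply beval_zle_false in Hb; sim_in Hb.
  split.
  { destruct Hinv as [[k [la [rh [-> _]]]]|[[->| ->] _]]; cost; lia. }
  intros t Ht. split; [|cost; nia].
  apply best_result. fold sh. fold r.
  destruct Hinv as [[k [la [rh [_ Hcl]]]]|[_ [_ Hbest]]]; [|easy].
  destruct Hcl as [Hv5 [Hk [HL [HR [HS [B1 [B2 [B3 [B4 B5]]]]]]]]].
  revert B5. apply best_ext. intros w. unfold outside. assert (la = rh) as -> by lia. lia.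
Qed.
End Query.

(** * Programs for the tables of window extrema *)

Notation I := 10%nat.
Notation TOP := 11%nat.
Notation LIN := 12%nat.
Notation BLK := 13%nat.
Notation LEN := 14%nat.
Notation J := 15%nat.
Notation TAB := 16%nat.
Notation LO := 17%nat.
Notation PL := 18%nat.
Notation EL := 19%nat.
Notation PR := 20%nat.
Notation ER := 21%nat.
Notation S_ := 22%nat.
Notation D_ := 23%nat.
Notation ST0 := 24%nat.
Notation WA := 25%nat.
Notation WB := 26%nat.
Notation LIM := 27%nat.
Notation W_ := 28%nat.
Notation Y := 29%nat.
Notation X_ := 30%nat.
(* Row [a] holds extrema of [f(y+a) - f(y)] over the part of the block of [y] that ends ([PMN], [PMX])
   or begins ([SMN], [SMX]) at [y]; blocks have length [BLK]. A window of length [BLK] is the end of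
   one block and the beginning of the next one. *)
Notation PMN := 3%nat.
Notation PMX := 4%nat.
Notation SMN := 5%nat.
Notation SMX := 6%nat.
Notation G_ := 7%nat.
Notation DL := 9%nat.

Definition set_min (a : nat) (i : zexp) (e1 e2 : rexp) : com :=
  If (BRle e1 e2) (RSet a i e1) (RSet a i e2).

Definition set_max (a : nat) (i : zexp) (e1 e2 : rexp) : com :=
  If (BRle e1 e2) (RSet a i e2) (RSet a i e1).

Definition prefix_row : com :=
  Y ::= lit 0 ;;
  While (!Y + !I < size)%ze
    (X_ ::= !I * size + !Y ;;
     RSet G_ (lit 0) (ROp RSub (RGet FV (!Y + !I)%ze) (RGet FV !Y)) ;;
     If (!Y mod !BLK <= lit 0)%ze
       (RSet PMN !X_ (RGet G_ (lit 0)) ;; RSet PMX !X_ (RGet G_ (lit 0)))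
       (set_min PMN !X_ (RGet PMN (!X_ - lit 1)%ze) (RGet G_ (lit 0)) ;;
        set_max PMX !X_ (RGet PMX (!X_ - lit 1)%ze) (RGet G_ (lit 0))) ;;
     Y ::= !Y + lit 1).

Definition suffix_row : com :=
  Y ::= size - !I - lit 1 ;;
  While (lit 0 <= !Y)%ze
    (X_ ::= !I * size + !Y ;;
     RSet G_ (lit 0) (ROp RSub (RGet FV (!Y + !I)%ze) (RGet FV !Y)) ;;
     If (BAnd (!Y + !I + lit 1 < size) (lit 1 <= (!Y + lit 1) mod !BLK))%ze
       (set_min SMN !X_ (RGet SMN (!X_ + lit 1)%ze) (RGet G_ (lit 0)) ;;
        set_max SMX !X_ (RGet SMX (!X_ + lit 1)%ze) (RGet G_ (lit 0)))
       (RSet SMN !X_ (RGet G_ (lit 0)) ;; RSet SMX !X_ (RGet G_ (lit 0))) ;;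
     Y ::= !Y - lit 1).

Definition tables : com :=
  I ::= lit 0 ;;
  While (!I < lit 2 * !LEN)%ze (prefix_row ;; suffix_row ;; I ::= !I + lit 1).

Section SetMinMax.
Variable E : env.

Lemma wp_set_min a i e1 e2 s (Q : state -> nat -> Prop) :
  in_space E (zeval s i) ->
  (forall t, (t <= 3 + zcost i + 2 * rcost e1 + 2 * rcost e2)%nat ->
    Q (mkState (zmem s) (upd (rmem s) a (zeval s i) (Rmin (reval s e1) (reval s e2)))) t) ->
  wp E (set_min a i e1 e2) Q s.
Proof.
intros Hi HQ. unfold set_min.
apply wp_if; simpl; intros Hb; apply wp_rset; auto; [apply Rleb_true in Hb|apply Rleb_false in Hb].
- rewrite <- (Rmin_left (reval s e1) (reval s e2)) by easy. apply HQ. lia.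
- rewrite <- (Rmin_right (reval s e1) (reval s e2)) by lra. apply HQ. lia.
Qed.

Lemma wp_set_max a i e1 e2 s (Q : state -> nat -> Prop) :
  in_space E (zeval s i) ->
  (forall t, (t <= 3 + zcost i + 2 * rcost e1 + 2 * rcost e2)%nat ->
    Q (mkState (zmem s) (upd (rmem s) a (zeval s i) (Rmax (reval s e1) (reval s e2)))) t) ->
  wp E (set_max a i e1 e2) Q s.
Proof.
intros Hi HQ. unfold set_max.
apply wp_if; simpl; intros Hb; apply wp_rset; auto; [apply Rleb_true in Hb|apply Rleb_false in Hb].
- rewrite <- (Rmax_right (reval s e1) (reval s e2)) by easy. apply HQ. lia.
- rewrite <- (Rmax_left (reval s e1) (reval s e2)) by lra. apply HQ. lia.
Qed.
End SetMinMax.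

(** * Extrema of [F (z + a) - F z] *)

(** The extrema are described by the two tests they serve: all values at least [c], and all values
    below [c]. The asymmetry is that of the test [0 <= h]. *)
Definition extrema (g : Z -> R) (lo hi : Z) (mn mx : R) : Prop :=
  (forall c, c <= mn <-> forall z, (lo <= z <= hi)%Z -> c <= g z) /\
  (forall c, mx < c <-> forall z, (lo <= z <= hi)%Z -> g z < c).

Lemma extrema_point g z : extrema g z z (g z) (g z).
Proof.
split; intros c; (split; [intros H z' Hz'; replace z' with z by lia; easy|intros H; apply H; lia]).
Qed.

Lemma extrema_union g a b c d mn mx mn' mx' lo hi :
  (forall z, (lo <= z <= hi)%Z <-> (a <= z <= b)%Z \/ (c <= z <= d)%Z) ->
  extrema g a b mn mx -> extrema g c d mn' mx' -> extrema g lo hi (Rmin mn mn') (Rmax mx mx').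
Proof.
intros Hu [H1 H2] [H3 H4]. split; intros e.
- split.
  + intros He z Hz. apply Hu in Hz. pose proof (Rmin_l mn mn'). pose proof (Rmin_r mn mn').
    destruct Hz as [Hz|Hz]; revert z Hz; [apply H1|apply H3]; lra.
  + intros H. apply Rmin_glb; [apply H1|apply H3]; intros z Hz; apply H, Hu; auto.
- split.
  + intros He z Hz. apply Hu in Hz. pose proof (Rmax_l mx mx'). pose proof (Rmax_r mx mx').
    destruct Hz as [Hz|Hz]; revert z Hz; [apply H2|apply H4]; lra.
  + intros H. apply Rmax_lub_lt; [apply H2|apply H4]; intros z Hz; apply H, Hu; auto.
Qed.

Lemma extrema_eq g lo hi lo' hi' mn mx : lo = lo' -> hi = hi' -> extrema g lo hi mn mx -> extrema g lo' hi' mn mx.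
Proof. now intros -> ->. Qed.

Lemma upd_same {X} (mm : nat -> Z -> X) a i v : upd mm a i v a i = v.
Proof. unfold upd. now rewrite Nat.eqb_refl, Z.eqb_refl. Qed.

Lemma upd_diff {X} (mm : nat -> Z -> X) a i v j : j <> i -> upd mm a i v a j = mm a j.
Proof. intros H. unfold upd. apply Z.eqb_neq in H. now rewrite H, andb_false_r. Qed.

Lemma upd_ne {X} (mm : nat -> Z -> X) a i v a' i' : a' <> a \/ i' <> i -> upd mm a i v a' i' = mm a' i'.
Proof.
intros [H|H]; unfold upd; [apply Nat.eqb_neq in H|apply Z.eqb_neq in H]; rewrite H; [easy|].
now rewrite andb_false_r.
Qed.

Lemma div_mod_zero B y : (0 < B)%Z -> (y mod B <= 0)%Z -> (B * (y / B) = y)%Z.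
Proof. intros H1 H2. pose proof (Z_div_mod_eq_full y B). pose proof (Z.mod_pos_bound y B H1). lia. Qed.

Lemma div_unique_block B y q : (0 < B)%Z -> (B * q <= y < B * q + B)%Z -> (y / B = q)%Z.
Proof. intros H1 H2. symmetry. apply Z.div_unique with (y - B * q)%Z; lia. Qed.

(** * Correctness of the tables *)

Section Build.
Variables (m : nat) (A : list R) (f : R -> R) (spo : spo_oracle) (space : nat).
Let E := mkEnv (2 ^ m)%nat f spo space.

Hypothesis space_pos : (0 < space)%nat.

Let H0 : in_space E 0 := in_space_0 m f spo space space_pos.

Definition delta (a z : Z) : R := onZ f (z + a)%Z - onZ f z.

Definition prefix_ok (B : Z) (s : state) (a y : Z) : Prop :=
  extrema (delta a) (B * (y / B)) y (rmem s PMN (a * pw m + y)%Z) (rmem s PMX (a * pw m + y)%Z).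

(** The block of [y] may be cut off at [pw m - a - 1], the last [z] for which [z + a] is in the
    domain. *)
Definition suffix_ok (B : Z) (s : state) (a y : Z) : Prop :=
  extrema (delta a) y (Z.min (B * (y / B) + B - 1) (pw m - a - 1))
    (rmem s SMN (a * pw m + y)%Z) (rmem s SMX (a * pw m + y)%Z).

(** Row [a] occupies the cells from [a * pw m] on, so the clause on smaller indices preserves the
    earlier rows; the register [G_], being cell 0 of its array, is exempt. *)
Lemma wp_prefix_row s B a : inputs m A f s -> zmem s BLK 0%Z = B -> (0 < B)%Z ->
  zmem s I 0%Z = a -> (0 <= a < pw m)%Z -> ((a + 1) * pw m <= Z.of_nat space)%Z ->
  wp E prefix_row (fun s' t =>
    (forall y, (0 <= y < pw m - a)%Z -> prefix_ok B s' a y) /\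
    (forall r i, (i < a * pw m)%Z -> rmem s' r i = rmem s r i \/ r = G_) /\
    (t <= 150 * 2 ^ m + 150)%nat) s.
Proof.
intros Hin HB HB0 Ha Ha0 Hsp. assert (Hpm := pw_nat m).
unfold prefix_row. step. step; [exact H0|]. set (s0 := mkState _ _).
apply wp_while with (v0 := (150 * Z.to_nat (pw m - a) + 50)%nat) (Inv := fun s1 v => exists y,
  zmem s1 Y 0%Z = y /\ (0 <= y <= pw m - a)%Z /\ v = (150 * Z.to_nat (pw m - a - y) + 50)%nat /\
  (forall y', (0 <= y' < y)%Z -> prefix_ok B s1 a y') /\
  (forall r i, (i < a * pw m)%Z -> rmem s1 r i = rmem s r i \/ r = G_)).
- exists 0%Z. split; [reflexivity|]. split; [lia|]. split; [f_equal; f_equal; lia|]. split; [lia|now left].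
- intros s1 v Hf [y [Hy [Hyr [-> [Hok Hlow]]]]] Hb.
  apply beval_zle in Hb. sim_in Hb.
  unchanged I from s to s1 by Hf as E1. unchanged BLK from s to s1 by Hf as E2.
  unchanged 0%nat from s to s1 by Hf as E3. real unchanged FV from s to s1 by Hf as R2.
  assert (Hin1 : inputs m A f s1) by (apply (inputs_keep m A f s); auto;
    real unchanged 0%nat from s to s1 by Hf as R0; auto).
  destruct Hin1 as [N1 [_ F1]].
  rewrite E1, Ha, Hy, N1 in Hb.
  step. step; [exact H0|]. rewrite E1, Ha, Hy, N1.
  step. step; [exact H0|]. rewrite E1, Ha, Hy.
  rewrite !F1 by lia. fold (delta a y).
  set (x := (a * pw m + y)%Z).
  set (s2 := mkState _ _).
  assert (X2 : zmem s2 X_ 0%Z = x) by reflexivity.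
  assert (Hsx : in_space E x) by (unfold in_space, x; simpl; nia).
  apply wp_seq.
  apply (wp_conseq E _ s2 (fun s' t => (t <= 80)%nat /\ exists mn mx,
    s' = mkState (zmem s2) (upd (upd (rmem s2) PMN x mn) PMX x mx) /\
    extrema (delta a) (B * (y / B)) y mn mx)).
  { apply wp_if; intros Hb'; [apply beval_zle in Hb'|apply beval_zle_false in Hb']; sim_in Hb';
      unfold s2 in Hb'; sim_in Hb'; rewrite Hy, E2, HB in Hb'.
    - step. apply wp_rset; [exact Hsx|]. apply wp_rset; [exact Hsx|].
      split; [cost; lia|]. exists (delta a y), (delta a y). split; [reflexivity|].
      apply (extrema_eq _ y y); [rewrite div_mod_zero; lia|easy|]. apply extrema_point.
    - apply wp_seq. apply wp_set_min; [exact Hsx|]. intros t1 Ht1.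
      apply wp_set_max; [exact Hsx|]. intros t2 Ht2.
      cbn [zcost rcost] in Ht1, Ht2.
      split; [cost; lia|].
      exists (Rmin (rmem s1 PMN (x - 1)%Z) (delta a y)), (Rmax (rmem s1 PMX (x - 1)%Z) (delta a y)).
      split; [reflexivity|].
      assert (Hdm := Z_div_mod_eq_full y B). assert (Hmb := Z.mod_pos_bound y B HB0).
      assert (Hy0 : (0 < y)%Z) by (destruct (Z.eq_dec y 0) as [E0|]; [rewrite E0 in Hb'; rewrite Z.mod_0_l in Hb'; lia|lia]).
      assert (Hq : ((y - 1) / B = y / B)%Z) by (apply div_unique_block; lia).
      assert (Hprev := Hok (y - 1)%Z ltac:(lia)). unfold prefix_ok in Hprev. rewrite Hq in Hprev.
      replace (a * pw m + (y - 1))%Z with (x - 1)%Z in Hprev by (unfold x; lia).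
      apply (extrema_union _ (B * (y / B)) (y - 1) y y); [lia|exact Hprev|apply extrema_point]. }
  intros s3 t3 _ [Ht3 [mn [mx [-> Hext]]]].
  assert (Hy2 : zmem s2 Y 0%Z = y) by exact Hy.
  step; [exact H0|]. rewrite Hy2.
  eexists. split.
  + exists (y + 1)%Z. split; [reflexivity|]. split; [lia|]. split; [reflexivity|]. split.
    * intros y' Hy'. unfold prefix_ok. cbn [rmem].
      destruct (Z.eq_dec y' y) as [->|Hne].
      { fold x. rewrite upd_same, upd_other, upd_same by reflexivity. exact Hext. }
      rewrite upd_diff by (unfold x; lia). rewrite (upd_other _ PMX _ _ PMN) by reflexivity.
      rewrite upd_diff by (unfold x; lia). apply Hok. lia.
    * intros r i Hi. cbn [rmem]. destruct (Nat.eq_dec r G_) as [->|Hr]; [now right|left].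
      destruct (Hlow r i Hi) as [H'|]; [|easy].
      assert (i <> x) by (unfold x; lia). rewrite !upd_ne by auto. unfold s2; cbn [rmem].
      now rewrite upd_ne by auto.
  + replace (pw m - a - y)%Z with (pw m - a - (y + 1) + 1)%Z by lia. cost. lia.
- intros s1 v Hf [y [Hy [Hyr [-> [Hok Hlow]]]]] Hb.
  apply beval_zle_false in Hb. sim_in Hb.
  unchanged I from s to s1 by Hf as E1. unchanged 0%nat from s to s1 by Hf as E3.
  rewrite E1, Ha, Hy, E3, (proj1 Hin) in Hb.
  split; [cost; lia|]. intros t Ht. split; [|split; [easy|cost; lia]].
  intros y' Hy'. apply Hok. lia.
Qed.

Lemma wp_suffix_row s B a : inputs m A f s -> zmem s BLK 0%Z = B -> (0 < B)%Z ->
  zmem s I 0%Z = a -> (0 <= a < pw m)%Z -> ((a + 1) * pw m <= Z.of_nat space)%Z ->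
  wp E suffix_row (fun s' t =>
    (forall y, (0 <= y < pw m - a)%Z -> suffix_ok B s' a y) /\
    (forall r i, (i < a * pw m)%Z -> rmem s' r i = rmem s r i \/ r = G_) /\
    (t <= 150 * 2 ^ m + 150)%nat) s.
Proof.
intros Hin HB HB0 Ha Ha0 Hsp. assert (Hpm := pw_nat m).
unfold suffix_row. step. step; [exact H0|]. rewrite Ha, (proj1 Hin). set (s0 := mkState _ _).
apply wp_while with (v0 := (150 * Z.to_nat (pw m - a) + 50)%nat) (Inv := fun s1 v => exists y,
  zmem s1 Y 0%Z = y /\ (-1 <= y < pw m - a)%Z /\ v = (150 * Z.to_nat (y + 1) + 50)%nat /\
  (forall y', (y < y' < pw m - a)%Z -> suffix_ok B s1 a y') /\
  (forall r i, (i < a * pw m)%Z -> rmem s1 r i = rmem s r i \/ r = G_)).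
- exists (pw m - a - 1)%Z. split; [reflexivity|]. split; [lia|]. split; [f_equal; f_equal; lia|]. split; [lia|now left].
- intros s1 v Hf [y [Hy [Hyr [-> [Hok Hlow]]]]] Hb.
  apply beval_zle in Hb. sim_in Hb.
  unchanged I from s to s1 by Hf as E1. unchanged BLK from s to s1 by Hf as E2.
  unchanged 0%nat from s to s1 by Hf as E3. real unchanged FV from s to s1 by Hf as R2.
  assert (Hin1 : inputs m A f s1) by (apply (inputs_keep m A f s); auto;
    real unchanged 0%nat from s to s1 by Hf as R0; auto).
  destruct Hin1 as [N1 [_ F1]].
  rewrite Hy in Hb.
  step. step; [exact H0|]. rewrite E1, Ha, Hy, N1.
  step. step; [exact H0|]. rewrite E1, Ha, Hy.
  rewrite !F1 by lia. fold (delta a y).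
  set (x := (a * pw m + y)%Z).
  set (s2 := mkState _ _).
  assert (X2 : zmem s2 X_ 0%Z = x) by reflexivity.
  assert (Hsx : in_space E x) by (unfold in_space, x; simpl; nia).
  assert (Hdm := Z_div_mod_eq_full y B). assert (Hmb := Z.mod_pos_bound y B HB0).
  apply wp_seq.
  apply (wp_conseq E _ s2 (fun s' t => (t <= 80)%nat /\ exists mn mx,
    s' = mkState (zmem s2) (upd (upd (rmem s2) SMN x mn) SMX x mx) /\
    extrema (delta a) y (Z.min (B * (y / B) + B - 1) (pw m - a - 1)) mn mx)).
  { apply wp_if; intros Hb'; cbn [beval] in Hb';
      [apply andb_prop in Hb'; destruct Hb' as [Hb1 Hb2]; apply Z.leb_le in Hb1, Hb2
      |apply andb_false_iff in Hb'; rewrite !Z.leb_gt in Hb'].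
    - unfold s2 in Hb1, Hb2; sim_in Hb1; sim_in Hb2; rewrite E1, Ha, N1, Hy in Hb1; rewrite Hy, E2, HB in Hb2.
      apply wp_seq. apply wp_set_min; [exact Hsx|]. intros t1 Ht1.
      apply wp_set_max; [exact Hsx|]. intros t2 Ht2.
      cbn [zcost rcost] in Ht1, Ht2.
      split; [cost; lia|].
      exists (Rmin (rmem s1 SMN (x + 1)%Z) (delta a y)), (Rmax (rmem s1 SMX (x + 1)%Z) (delta a y)).
      split; [reflexivity|].
      (* The test on [y + 1] shows that [y] is not the last point of its block, so [y + 1] lies in
         the same block. *)
      assert (Hnz : (y mod B <> B - 1)%Z).
      { intros Hm. rewrite Zplus_mod, Hm in Hb2. destruct (Z.eq_dec B 1) as [->|].
        - rewrite Z.mod_1_r in Hb2. lia.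
        - rewrite (Z.mod_small 1 B) in Hb2 by lia. replace (B - 1 + 1)%Z with B in Hb2 by lia.
          rewrite Z_mod_same_full in Hb2. lia. }
      assert (Hq : ((y + 1) / B = y / B)%Z) by (apply div_unique_block; lia).
      assert (Hprev := Hok (y + 1)%Z ltac:(lia)). unfold suffix_ok in Hprev. rewrite Hq in Hprev.
      replace (a * pw m + (y + 1))%Z with (x + 1)%Z in Hprev by (unfold x; lia).
      refine (extrema_union _ _ _ y y _ _ _ _ _ _ _ Hprev (extrema_point _ _)). lia.
    - unfold s2 in Hb'; sim_in Hb'; rewrite E1, Ha, N1, Hy, E2, HB in Hb'.
      step. apply wp_rset; [exact Hsx|]. apply wp_rset; [exact Hsx|].
      split; [cost; lia|]. exists (delta a y), (delta a y). split; [reflexivity|].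
      apply (extrema_eq _ y y); [easy| |apply extrema_point].
      destruct Hb' as [Hb'|Hb']; [lia|].
      assert (Hd2 := Z_div_mod_eq_full (y + 1) B). assert (Hmb2 := Z.mod_pos_bound (y + 1) B HB0).
      assert (Hm0 : ((y + 1) mod B = 0)%Z) by lia. rewrite Hm0 in Hd2.
      assert (Hq : (y / B = (y + 1) / B - 1)%Z) by (apply div_unique_block; lia). rewrite Hq. lia. }
  intros s3 t3 _ [Ht3 [mn [mx [-> Hext]]]].
  assert (Hy2 : zmem s2 Y 0%Z = y) by exact Hy.
  step; [exact H0|]. rewrite Hy2.
  eexists. split.
  + exists (y - 1)%Z. split; [reflexivity|]. split; [lia|]. split; [reflexivity|]. split.
    * intros y' Hy'. unfold suffix_ok. cbn [rmem].
      destruct (Z.eq_dec y' y) as [->|Hne].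
      { fold x. rewrite upd_same, upd_other, upd_same by reflexivity. exact Hext. }
      rewrite upd_diff by (unfold x; lia). rewrite (upd_other _ SMX _ _ SMN) by reflexivity.
      rewrite upd_diff by (unfold x; lia). apply Hok. lia.
    * intros r i Hi. cbn [rmem]. destruct (Nat.eq_dec r G_) as [->|Hr]; [now right|left].
      destruct (Hlow r i Hi) as [H'|]; [|easy].
      assert (i <> x) by (unfold x; lia). rewrite !upd_ne by auto. unfold s2; cbn [rmem].
      now rewrite upd_ne by auto.
  + replace (y + 1)%Z with (y - 1 + 1 + 1)%Z by lia. cost. lia.
- intros s1 v Hf [y [Hy [Hyr [-> [Hok Hlow]]]]] Hb.
  apply beval_zle_false in Hb. sim_in Hb. rewrite Hy in Hb.
  split; [cost; lia|]. intros t Ht. split; [|split; [easy|cost; lia]].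
  intros y' Hy'. apply Hok. lia.
Qed.

Definition tables_ok (B L : Z) (s : state) : Prop :=
  forall a y, (0 <= a < L)%Z -> (0 <= y < pw m - a)%Z -> prefix_ok B s a y /\ suffix_ok B s a y.

Lemma tables_ok_keep B L s s' :
  (forall a i, mem a [PMN; PMX; SMN; SMX] = true -> rmem s' a i = rmem s a i) ->
  tables_ok B L s -> tables_ok B L s'.
Proof.
intros H Hok a y Ha Hy. destruct (Hok a y Ha Hy) as [H1 H2].
unfold prefix_ok, suffix_ok. rewrite !H by reflexivity. split; assumption.
Qed.

Lemma wp_tables s B L : inputs m A f s -> zmem s BLK 0%Z = B -> (0 < B)%Z ->
  (2 * zmem s LEN 0)%Z = L -> (0 <= L <= pw m)%Z -> (L * pw m <= Z.of_nat space)%Z ->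
  wp E tables (fun s' t => tables_ok B L s' /\ (t <= 700 * Z.to_nat L * 2 ^ m + 50)%nat) s.
Proof.
intros Hin HB HB0 HL HL0 Hsp. assert (Hpm := pw_nat m).
assert (Hm1 : (1 <= 2 ^ m)%nat) by (pose proof (pw_pos m); lia).
unfold tables. step. step; [exact H0|]. set (s0 := mkState _ _).
apply wp_while with (v0 := (700 * 2 ^ m * Z.to_nat L + 20)%nat) (Inv := fun s1 v => exists a,
  zmem s1 I 0%Z = a /\ (0 <= a <= L)%Z /\ v = (700 * 2 ^ m * Z.to_nat (L - a) + 20)%nat /\
  tables_ok B a s1).
- exists 0%Z. split; [reflexivity|]. split; [lia|]. split; [do 2 f_equal; lia|]. intros a y Ha. lia.
- intros s1 v Hf [a [Ha [Har [-> Hok]]]] Hb.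
  apply beval_zle in Hb. sim_in Hb.
  unchanged LEN from s to s1 by Hf as E1. unchanged BLK from s to s1 by Hf as E2.
  unchanged 0%nat from s to s1 by Hf as E3. real unchanged FV from s to s1 by Hf as R2.
  real unchanged 0%nat from s to s1 by Hf as R0.
  assert (Hin1 : inputs m A f s1) by (apply (inputs_keep m A f s); auto).
  rewrite E1, HL, Ha in Hb. rewrite <- (E2 0%Z) in HB.
  apply wp_seq. apply wp_conseq with (1 := wp_prefix_row s1 B a Hin1 HB HB0 Ha ltac:(lia) ltac:(nia)).
  intros s2 t2 Hf2 [P1 [P2 Ht2]].
  unchanged 0%nat from s1 to s2 by Hf2 as E3'. unchanged BLK from s1 to s2 by Hf2 as E2'.
  unchanged I from s1 to s2 by Hf2 as E1'.
  assert (Hin2 : inputs m A f s2).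
  { apply (inputs_keep m A f s1); auto; intros z.
    - now rewrite (proj2 Hf2) by reflexivity.
    - now rewrite (proj2 Hf2) by reflexivity. }
  rewrite <- (E2' 0%Z) in HB. rewrite <- (E1' 0%Z) in Ha.
  apply wp_seq. apply wp_conseq with (1 := wp_suffix_row s2 B a Hin2 HB HB0 Ha ltac:(lia) ltac:(nia)).
  intros s3 t3 Hf3 [P3 [P4 Ht3]].
  unchanged I from s2 to s3 by Hf3 as E1''.
  real unchanged PMN from s2 to s3 by Hf3 as R3. real unchanged PMX from s2 to s3 by Hf3 as R4.
  step; [exact H0|]. rewrite E1'', Ha.
  eexists. split.
  + exists (a + 1)%Z. split; [reflexivity|]. split; [lia|]. split; [reflexivity|].
    intros a' y Ha' Hy. unfold prefix_ok, suffix_ok. cbn [rmem].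
    destruct (Z.eq_dec a' a) as [->|Hne].
    * rewrite R3, R4. split; [now apply P1|now apply P3].
    * assert (Hi : (a' * pw m + y < a * pw m)%Z) by nia.
      rewrite R3, R4.
      destruct (P2 PMN _ Hi) as [->|]; [|easy]. destruct (P2 PMX _ Hi) as [->|]; [|easy].
      destruct (P4 SMN _ Hi) as [->|]; [|easy]. destruct (P4 SMX _ Hi) as [->|]; [|easy].
      destruct (P2 SMN _ Hi) as [->|]; [|easy]. destruct (P2 SMX _ Hi) as [->|]; [|easy].
      apply (Hok a' y); lia.
  + replace (L - a)%Z with (L - (a + 1) + 1)%Z by lia. rewrite Z2Nat.inj_add by lia. cost. simpl (Z.to_nat 1). nia.
- intros s1 v Hf [a [Ha [Har [-> Hok]]]] Hb.
  apply beval_zle_false in Hb. sim_in Hb.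
  unchanged LEN from s to s1 by Hf as E1. rewrite E1, HL, Ha in Hb.
  split; [cost; lia|]. intros t Ht. split; [|cost; nia].
  replace L with a by lia. exact Hok.
Qed.
End Build.

(** * Program for merging two children *)

Definition cut_at_end (p e : nat) : com :=
  If (BAnd (!p + lit 1 < !e) (ZGet PX (!p + lit 1) < !LIM))%ze (LIM ::= ZGet PX (!p + lit 1)) Skip.

Definition choose_winner : com :=
  WA ::= ZGet PW !PL ;;
  WB ::= ZGet PW !PR ;;
  If (BRle (ROp RAdd (RGet 0 !WA) (RGet FV (!S_ + !WA)%ze))
           (ROp RAdd (RGet 0 !WB) (RGet FV (!S_ + !WB)%ze)))
    (W_ ::= !WA) (W_ ::= !WB) ;;
  LIM ::= !D_ ;;
  cut_at_end PL EL ;;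
  cut_at_end PR ER.

(** An unchanged minimizer prolongs the last piece, which keeps pieces maximal. The test against
    [ST0] prevents a node from continuing the last piece of the preceding node. *)
Definition push_winner : com :=
  If (BAnd (!ST0 < !TOP) (ZGet PW (!TOP - lit 1) = !W_))%ze Skip
    (ZSet PX !TOP !S_ ;; ZSet PW !TOP !W_ ;; TOP ::= !TOP + lit 1).

Definition nonneg (e : rexp) : bexp := BRle (ROfZ (lit 0)) e.

Definition sum_at (r : nat) (i : zexp) : rexp := ROp RAdd (RGet DL (lit 0)) (RGet r i).

(** A disjunction by De Morgan: the comparison is nonnegative on both parts of the window, or
    negative on both. *)
Definition uniform_window : bexp :=
  BNot (BAnd
    (BNot (BAnd (nonneg (sum_at SMN !X_)) (nonneg (sum_at PMN (!X_ + !BLK - lit 1)%ze))))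
    (BNot (BAnd (BNot (nonneg (sum_at SMX !X_))) (BNot (nonneg (sum_at PMX (!X_ + !BLK - lit 1)%ze)))))).

Definition move : com :=
  X_ ::= (!WB - !WA) * size + (!S_ + !WA) ;;
  RSet DL (lit 0) (ROp RSub (RGet 0 !WB) (RGet 0 !WA)) ;;
  If (lit 1 <= !LIN)%ze (S_ ::= !LIM)
    (If (BAnd (lit 1 <= !TAB)%ze (BAnd (!S_ + !BLK <= !LIM)%ze uniform_window))
       (S_ ::= !S_ + !BLK) (S_ ::= !S_ + lit 1)).

(** Passing to the next piece of a child is an iteration of its own, paid for by the pieces of the
    children; all other iterations advance [S_]. *)
Definition merge : com :=
  X_ ::= lit 2 * (!J - size) ;;
  PL ::= ZGet ST !X_ ;;
  EL ::= ZGet ST (!X_ + lit 1) ;;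
  PR ::= ZGet ST (!X_ + lit 1) ;;
  ER ::= ZGet ST (!X_ + lit 2) ;;
  S_ ::= lit 0 - !LO ;;
  D_ ::= size - !LO - lit 2 * !LEN + lit 1 ;;
  ST0 ::= !TOP ;;
  While (!S_ < !D_)%ze
    (If (BAnd (!PL + lit 1 < !EL) (ZGet PX (!PL + lit 1) <= !S_))%ze
       (PL ::= !PL + lit 1)
       (If (BAnd (!PR + lit 1 < !ER) (ZGet PX (!PR + lit 1) <= !S_))%ze
          (PR ::= !PR + lit 1)
          (choose_winner ;; push_winner ;; move))) ;;
  ZSet ST (!J + lit 1)%ze !TOP.

(** * Extending a list of maximal pieces *)

Section Runs.
Variables (px pw' : Z -> Z) (W : Z -> Z).

Lemma runs_start u D st w : px st = u -> pw' st = w -> (u < D)%Z ->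
  (forall z, (u <= z < D)%Z -> W z = w) -> runs px pw' W u D st (st + 1).
Proof.
intros H1 H2 H3 H4. split; [easy|]. intros t Ht. replace t with st by lia. cbv zeta.
rewrite (proj2 (Z.ltb_ge (st + 1) (st + 1))) by lia. rewrite H1, H2. repeat split; [easy|easy|lia].
Qed.

Lemma runs_extend u D D' st en : runs px pw' W u D st en -> (D <= D')%Z ->
  (forall z, (D <= z < D')%Z -> W z = pw' (en - 1)%Z) -> runs px pw' W u D' st en.
Proof.
intros [H1 H2] HD HW. split; [easy|]. intros t Ht. specialize (H2 t Ht). cbv zeta in *.
destruct (Z.ltb_spec (t + 1) en); [easy|]. destruct H2 as [H2 [H3 H4]].
split; [lia|]. split; [|easy]. intros z Hz. destruct (Z_lt_le_dec z D); [apply H3; lia|].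
replace t with (en - 1)%Z by lia. apply HW. lia.
Qed.

Lemma runs_push px' pw'' u D D' st en w : runs px pw' W u D st en -> (st < en)%Z ->
  (forall i, (i < en)%Z -> px' i = px i) -> (forall i, (i < en)%Z -> pw'' i = pw' i) ->
  px' en = D -> pw'' en = w -> pw' (en - 1)%Z <> w -> (D < D')%Z ->
  (forall z, (D <= z < D')%Z -> W z = w) -> runs px' pw'' W u D' st (en + 1).
Proof.
intros [H1 H2] Hlt Hx Hw Hxe Hwe Hne HD HW. split; [rewrite Hx; [easy|lia]|].
intros t Ht. cbv zeta. destruct (Z.eq_dec t en) as [->|Hte].
- rewrite (proj2 (Z.ltb_ge (en + 1) (en + 1))) by lia. rewrite Hxe, Hwe. repeat split; [easy|easy|lia].
- rewrite (proj2 (Z.ltb_lt (t + 1) (en + 1))) by lia.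
  specialize (H2 t ltac:(lia)). cbv zeta in H2. rewrite (Hx t), (Hw t) by lia.
  destruct (Z.ltb_spec (t + 1) en) as [Hlt'|Hge].
  + rewrite (Hx (t + 1)%Z), (Hw (t + 1)%Z) by lia. destruct H2 as [H2 [H3 H4]].
    repeat split; auto.
  + replace (t + 1)%Z with en by lia. rewrite Hxe, Hwe. destruct H2 as [H2 [H3 H4]].
    split; [easy|]. split; [easy|]. intros _. replace t with (en - 1)%Z by lia. auto.
Qed.
End Runs.

(** * The advance of a merge *)

Section Advance.
Variables (m : nat) (A : list R) (f : R -> R).

(** Because neighbouring pieces differ, a run cut short by the end of a piece ends at a change of
    the child's minimizer. So the limit computed by a merge is always preceded by a stop. *)
Lemma child_piece px pw' (W : Z -> Z) u D st en p z lim : runs px pw' W u D st en ->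
  (st <= p < en)%Z -> (px p <= z)%Z -> ((p + 1 < en)%Z -> (z < px (p + 1))%Z) -> (z < lim <= D)%Z ->
  let l := if (p + 1 <? en)%Z then Z.min lim (px (p + 1)%Z) else lim in
  (z < l <= lim)%Z /\ (forall y, (z <= y < l)%Z -> W y = pw' p) /\ (l = lim \/ changes W (l - 1) = true).
Proof.
intros [_ Hr] Hp Hz Hnext Hlim. assert (H1 := Hr p Hp). cbv zeta in H1.
destruct (Z.ltb_spec (p + 1) en) as [Hlt|Hge]; cbv zeta.
- specialize (Hnext Hlt). destruct H1 as [H1 [H2 H3]].
  split; [lia|]. split; [intros y Hy; apply H2; lia|].
  destruct (Z_le_gt_dec lim (px (p + 1)%Z)) as [Hle|Hgt]; [left; lia|right].
  rewrite Z.min_r by lia. unfold changes. apply negb_true_iff, Z.eqb_neq.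
  rewrite (H2 (px (p + 1)%Z - 1)%Z) by lia. replace (px (p + 1)%Z - 1 + 1)%Z with (px (p + 1)%Z) by lia.
  assert (H4 := Hr (p + 1)%Z ltac:(lia)). cbv zeta in H4. destruct H4 as [H4 [H5 _]].
  rewrite H5 by lia. specialize (H3 Hlt). congruence.
- split; [lia|]. split; [intros y Hy; apply H1; lia|now left].
Qed.

Lemma window_extrema B L s a y : tables_ok m f B L s -> (0 < B)%Z -> (0 <= a < L)%Z ->
  (0 <= y)%Z -> (y + B - 1 < pw m - a)%Z ->
  extrema (delta f a) y (y + B - 1)
    (Rmin (rmem s SMN (a * pw m + y)%Z) (rmem s PMN (a * pw m + y + B - 1)%Z))
    (Rmax (rmem s SMX (a * pw m + y)%Z) (rmem s PMX (a * pw m + y + B - 1)%Z)).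
Proof.
intros Hok HB Ha Hy Hyn.
assert (H1 := proj2 (Hok a y Ha ltac:(lia))). assert (H2 := proj1 (Hok a (y + B - 1)%Z Ha ltac:(lia))).
unfold suffix_ok in H1. unfold prefix_ok in H2.
replace (a * pw m + (y + B - 1))%Z with (a * pw m + y + B - 1)%Z in H2 by lia.
refine (extrema_union _ _ _ _ _ _ _ _ _ _ _ _ H1 H2).
pose proof (Z_div_mod_eq_full y B). pose proof (Z.mod_pos_bound y B HB).
pose proof (Z_div_mod_eq_full (y + B - 1) B). pose proof (Z.mod_pos_bound (y + B - 1) B HB).
(* If [y] begins a block, the window is this block and both entries cover it entirely; otherwise the
   window meets two consecutive blocks. *)
assert (Hq : ((y + B - 1) / B = y / B \/ (y + B - 1) / B = y / B + 1)%Z).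
{ destruct (Z_le_gt_dec (y mod B) 0); [left|right]; apply div_unique_block; lia. }
intros z. destruct Hq as [Hq|Hq]; rewrite Hq in *; lia.
Qed.

Notation Wn := (winner (arr A) (onZ f)).

Lemma V_diff w w' z : candidate (arr A) (onZ f) w' z - candidate (arr A) (onZ f) w z =
  arr A w' - arr A w + delta f (w' - w) (z + w).
Proof. unfold candidate, delta. replace (z + w + (w' - w))%Z with (z + w')%Z by lia. ring. Qed.

(** A single step has to be charged to a stop: if the first [B - 1] positions contain no jump, the
    comparison is constant on the window, so the extrema pass the test and the window would have
    been skipped. Conversely, a passed test makes the comparison constant, so all skipped positions
    share one minimizer. *)
Lemma advance_ok s k lo (lin tab : bool) B z z' lim wa wb :
  let x := ((wb - wa) * pw m + (z + wa))%Z in let x' := (x + B - 1)%Z in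
  let dl := arr A wb - arr A wa in
  let jumps := (tab = true /\ (z + B <= lim)%Z) /\
    ((0 <= dl + rmem s SMN x /\ 0 <= dl + rmem s PMN x') \/
     (dl + rmem s SMX x < 0 /\ dl + rmem s PMX x' < 0)) in
  (0 <= lo)%Z -> (lo + pw (S k) <= pw m)%Z -> (0 < B)%Z ->
  (- lo <= z < lim)%Z -> (lim <= bound_at (pw m) k lo)%Z ->
  (forall y, (z <= y < lim)%Z -> Wn k lo y = wa) ->
  (forall y, (z <= y < lim)%Z -> Wn k (lo + pw k) y = wb) ->
  stop (arr A) (onZ f) (pw m) k lo (lim - 1) = true ->
  (lin = true -> affine (onZ f) (pw m)) ->
  (lin = false -> tab = true -> tables_ok m f B (pw (S k)) s) ->
  (lin = true /\ z' = lim \/ lin = false /\ jumps /\ z' = (z + B)%Z \/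
   lin = false /\ ~ jumps /\ z' = (z + 1)%Z) ->
  merge_step (arr A) (onZ f) (pw m) lin tab B k lo z z' /\ (z' <= lim)%Z /\
  forall y, (z <= y < z')%Z -> Wn (S k) lo y = Wn (S k) lo z.
Proof.
intros x x' dl jumps Hlo Hlon HB Hz Hlim Ha Hb Hstop Hlin Htab Hcase.
assert (Hpk := pw_pos k). assert (Hpk2 := pw_S k).
assert (Ra := winner_range (arr A) (onZ f) k lo z). assert (Rb := winner_range (arr A) (onZ f) k (lo + pw k) z).
rewrite Ha in Ra by lia. rewrite Hb in Rb by lia.
assert (Hside : forall y, (z <= y < lim)%Z ->
  side (arr A) (onZ f) k lo y = Rleb 0 (dl + delta f (wb - wa) (y + wa))).
{ intros y Hy. unfold side. rewrite Ha, Hb by easy. apply Rleb_shift. rewrite V_diff. unfold dl. lra. }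
assert (HWS : forall y, (z <= y < lim)%Z -> side (arr A) (onZ f) k lo y = side (arr A) (onZ f) k lo z ->
  Wn (S k) lo y = Wn (S k) lo z).
{ intros y Hy Hs. rewrite !winner_S, Hs, !Ha, !Hb by lia. reflexivity. }
assert (Hext : lin = false -> tab = true -> (z + B <= lim)%Z ->
  extrema (delta f (wb - wa)) (z + wa) (z + wa + B - 1)
    (Rmin (rmem s SMN x) (rmem s PMN x')) (Rmax (rmem s SMX x) (rmem s PMX x'))).
{ intros Hl Ht HzB. apply window_extrema with (pw (S k)); auto; unfold bound_at in *; lia. }
destruct Hcase as [[-> ->]|[[-> [Hj ->]]|[-> [Hj ->]]]].
- split; [split; [lia|easy]|]. split; [lia|]. intros y Hy. apply HWS; [easy|].
  apply (const_run (side (arr A) (onZ f) k lo) z (Z.to_nat (lim - 1 - z))); [|lia].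
  intros y' Hy'. apply jump_false, (affine_jump _ _ (pw m)); auto. unfold bound_at in *. lia.
- destruct Hj as [[Ht HzB] Hu]. split; [split; [lia|rewrite Ht; now left]|]. split; [lia|].
  intros y Hy. apply HWS; [lia|]. specialize (Hext eq_refl Ht HzB). destruct Hext as [Hmin Hmax].
  rewrite !Hside by lia.
  destruct Hu as [[U1 U2]|[U1 U2]].
  + assert (Hc : forall y, (z <= y < z + B)%Z -> - dl <= delta f (wb - wa) (y + wa)).
    { intros y' Hy'. apply (proj1 (Hmin (- dl))); [apply Rmin_glb; lra|lia]. }
    rewrite (proj2 (Rleb_true _ _)) by (specialize (Hc y Hy); lra).
    symmetry. apply Rleb_true. specialize (Hc z ltac:(lia)). lra.
  + assert (Hc : forall y, (z <= y < z + B)%Z -> delta f (wb - wa) (y + wa) < - dl).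
    { intros y' Hy'. apply (proj1 (Hmax (- dl))); [apply Rmax_lub_lt; lra|lia]. }
    rewrite (proj2 (Rleb_false _ _)) by (specialize (Hc y Hy); lra).
    symmetry. apply Rleb_false. specialize (Hc z ltac:(lia)). lra.
- split; [|split; [lia|intros y Hy; now replace y with z by lia]].
  split; [lia|]. destruct tab; [|easy]. right. split; [easy|].
  (* If no window fits before [lim], the stop [lim - 1] is itself near. *)
  destruct (Z_lt_le_dec lim (z + B)) as [HzB|HzB].
  { apply near_true. exists (lim - 1)%Z. split; [lia|easy]. }
  apply not_false_iff_true. intros Hnear. apply Hj. split; [easy|].
  assert (Hno : forall y, (z <= y < z + (B - 1))%Z -> jump (arr A) (onZ f) k lo y = false).
  { intros y Hy. apply not_true_iff_false. intros Hjy. apply not_true_iff_false in Hnear. apply Hnear.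
    apply near_true. exists y. split; [lia|]. unfold stop. rewrite Hjy.
    apply andb_true_intro. split; [apply Z.ltb_lt; lia|easy]. }
  assert (Hconst : forall y, (z <= y < z + B)%Z ->
    side (arr A) (onZ f) k lo y = side (arr A) (onZ f) k lo z).
  { intros y Hy. apply (const_run (side (arr A) (onZ f) k lo) z (Z.to_nat (B - 1))); [|lia].
    intros y' Hy'. apply jump_false, Hno. lia. }
  specialize (Hext eq_refl eq_refl HzB). destruct Hext as [Hmin Hmax].
  destruct (side (arr A) (onZ f) k lo z) eqn:Es; [left|right].
  + assert (Hc : - dl <= Rmin (rmem s SMN x) (rmem s PMN x')).
    { apply Hmin. intros y Hy. specialize (Hconst (y - wa)%Z ltac:(lia)).
      rewrite Hside in Hconst by lia. apply Rleb_true in Hconst.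
      replace (y - wa + wa)%Z with y in Hconst by lia. lra. }
    pose proof (Rmin_l (rmem s SMN x) (rmem s PMN x')). pose proof (Rmin_r (rmem s SMN x) (rmem s PMN x')). lra.
  + assert (Hc : Rmax (rmem s SMX x) (rmem s PMX x') < - dl).
    { apply Hmax. intros y Hy. specialize (Hconst (y - wa)%Z ltac:(lia)).
      rewrite Hside in Hconst by lia. apply Rleb_false in Hconst.
      replace (y - wa + wa)%Z with y in Hconst by lia. lra. }
    pose proof (Rmax_l (rmem s SMX x) (rmem s PMX x')). pose proof (Rmax_r (rmem s SMX x) (rmem s PMX x')). lra.
Qed.

End Advance.

(** * Correctness and cost of a merge *)

Section Merge.
Variables (m : nat) (A : list R) (f : R -> R) (spo : spo_oracle) (space : nat).
Let E := mkEnv (2 ^ m)%nat f spo space.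
Hypothesis space_pos : (0 < space)%nat.
Let H0 : in_space E 0 := in_space_0 m f spo space space_pos.

Definition cut (s : state) (p e : nat) (lim : Z) : Z :=
  if (zmem s p 0 + 1 <? zmem s e 0)%Z then Z.min lim (zmem s PX (zmem s p 0 + 1)) else lim.

Lemma wp_cut_at_end p e s : mem LIM [p; e; PX] = false ->
  wp E (cut_at_end p e) (fun s' t => zmem s' LIM 0%Z = cut s p e (zmem s LIM 0) /\ (t <= 40)%nat) s.
Proof.
intros Hne. unfold cut_at_end, cut. apply wp_if; intros Hb; cbn [beval] in Hb;
  [apply andb_prop in Hb; destruct Hb as [H1 H2]; apply Z.leb_le in H1, H2
  |apply andb_false_iff in Hb; rewrite !Z.leb_gt in Hb]; cbn [zeval zop_sem] in *.
- step; [exact H0|]. split; [|cost; lia]. destruct (Z.ltb_spec (zmem s p 0 + 1) (zmem s e 0)); lia.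
- step. split; [|cost; lia]. destruct (Z.ltb_spec (zmem s p 0 + 1) (zmem s e 0)); lia.
Qed.

Lemma wp_choose_winner s :
  let wa := zmem s PW (zmem s PL 0%Z) in
  let wb := zmem s PW (zmem s PR 0%Z) in
  let z := zmem s S_ 0%Z in
  wp E choose_winner (fun s' t =>
    zmem s' WA 0%Z = wa /\ zmem s' WB 0%Z = wb /\
    zmem s' W_ 0%Z = (if Rleb (rmem s 0 wa + rmem s FV (z + wa)%Z) (rmem s 0 wb + rmem s FV (z + wb)%Z)
      then wa else wb) /\
    zmem s' LIM 0%Z = cut s PR ER (cut s PL EL (zmem s D_ 0)) /\ (t <= 150)%nat) s.
Proof.
intros wa wb z. unfold choose_winner.
step. step; [exact H0|]. step. step; [exact H0|]. fold wa wb.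
set (s1 := mkState _ _).
apply wp_seq. apply (wp_conseq E _ s1 (fun s' t => zmem s' W_ 0%Z = (if Rleb (rmem s 0 wa + rmem s FV (z + wa)%Z)
  (rmem s 0 wb + rmem s FV (z + wb)%Z) then wa else wb) /\ (t <= 40)%nat)).
{ apply wp_if; intros Hb; change (beval s1 _) with (Rleb (rmem s 0 wa + rmem s FV (z + wa)%Z)
    (rmem s 0 wb + rmem s FV (z + wb)%Z)) in Hb; rewrite Hb; step; try exact H0; (split; [reflexivity|cost; lia]). }
intros s2 t2 Hf2 [HW Ht2].
step. step; [exact H0|]. set (s3 := mkState _ _).
apply wp_seq. apply wp_conseq with (1 := wp_cut_at_end PL EL s3 eq_refl). intros s4 t4 Hf4 [L4 Ht4].
apply wp_conseq with (1 := wp_cut_at_end PR ER s4 eq_refl). intros s5 t5 Hf5 [L5 Ht5].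
assert (U : forall a i, mem a [WA; WB; W_; LIM] = false -> zmem s5 a i = zmem s a i).
{ intros a i Ha. apply not_true_iff_false in Ha.
  assert (Hn : a <> WA /\ a <> WB /\ a <> W_ /\ a <> LIM).
  { repeat split; intros ->; now apply Ha. }
  destruct Hn as [N1 [N2 [N3 N4]]].
  apply Nat.eqb_neq in N1, N2, N3, N4.
  rewrite (proj1 Hf5) by (cbn; now rewrite N4). rewrite (proj1 Hf4) by (cbn; now rewrite N4).
  unfold s3. cbn [zmem]. rewrite upd_other by easy.
  rewrite (proj1 Hf2) by (cbn; now rewrite N3).
  unfold s1. cbn [zmem]. now rewrite !upd_other by easy. }
assert (V1 : forall i, zmem s5 WA i = zmem s1 WA i /\ zmem s5 WB i = zmem s1 WB i /\ zmem s5 W_ i = zmem s2 W_ i).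
{ intros i. repeat split; rewrite (proj1 Hf5), (proj1 Hf4) by reflexivity; unfold s3; cbn [zmem];
    rewrite upd_other by easy; try easy; now rewrite (proj1 Hf2) by reflexivity. }
destruct (V1 0%Z) as [-> [-> ->]].
split; [reflexivity|]. split; [reflexivity|]. split; [easy|]. split; [|cost; lia].
rewrite L5. assert (C4 : forall p e l, mem p [WA; WB; W_; LIM] = false -> mem e [WA; WB; W_; LIM] = false ->
  cut s4 p e l = cut s p e l).
{ intros p e l Hp He. unfold cut.
  assert (U4 : forall a i, mem a [WA; WB; W_; LIM] = false -> zmem s4 a i = zmem s a i).
  { intros a i Ha. rewrite <- U by easy. rewrite (proj1 Hf5); [easy|]. cbn in *. rewrite !orb_false_iff in Ha. cbn. 
    destruct Ha as [_ [_ [_ [Ha _]]]]. now rewrite Ha. }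
  now rewrite !U4 by easy. }
assert (C3 : forall p e l, mem p [WA; WB; W_; LIM] = false -> mem e [WA; WB; W_; LIM] = false ->
  cut s3 p e l = cut s p e l).
{ intros p e l Hp He. rewrite <- C4 by easy. unfold cut.
  assert (U4 : forall a i, mem a [WA; WB; W_; LIM] = false -> zmem s4 a i = zmem s3 a i).
  { intros a i Ha. rewrite (proj1 Hf4); [easy|]. cbn in *. rewrite !orb_false_iff in Ha. cbn. 
    destruct Ha as [_ [_ [_ [Ha _]]]]. now rewrite Ha. }
  now rewrite !U4 by easy. }
rewrite C4, L4, C3 by reflexivity. f_equal. f_equal. unfold s3. cbn [zmem]. unfold upd. cbn.
now rewrite (proj1 Hf2) by reflexivity.
Qed.

Lemma wp_push_winner s :
  let top := zmem s TOP 0%Z in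
  let w := zmem s W_ 0%Z in
  let coalesce := (zmem s ST0 0 < top)%Z /\ zmem s PW (top - 1)%Z = w in
  (~ coalesce -> (0 <= top < Z.of_nat space)%Z) ->
  wp E push_winner (fun s' t => (t <= 50)%nat /\
    (coalesce /\ zmem s' TOP 0%Z = top /\
       (forall i, zmem s' PX i = zmem s PX i) /\ (forall i, zmem s' PW i = zmem s PW i) \/
     ~ coalesce /\ zmem s' TOP 0%Z = (top + 1)%Z /\
       zmem s' PX top = zmem s S_ 0%Z /\ zmem s' PW top = w /\
       (forall i, i <> top -> zmem s' PX i = zmem s PX i) /\
       (forall i, i <> top -> zmem s' PW i = zmem s PW i))) s.
Proof.
intros top w coalesce Hsp. unfold push_winner.
apply wp_if; intros Hb; cbn [beval zeval zop_sem] in Hb; fold top w in Hb.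
- apply andb_prop in Hb. destruct Hb as [H1 H2]. apply andb_prop in H2. destruct H2 as [H2 H3].
  apply Z.leb_le in H1, H2, H3. step. split; [cost; lia|]. left. split; [split; lia|]. auto.
- assert (Hn : ~ coalesce).
  { intros [H1 H2]. apply andb_false_iff in Hb. rewrite andb_false_iff, !Z.leb_gt in Hb. lia. }
  specialize (Hsp Hn).
  step. apply wp_zset; [exact Hsp|]. cbn [zeval zmem]. fold top.
  step. apply wp_zset; [exact Hsp|]. cbn [zeval zmem].
  rewrite !(upd_other _ PX _ _ _) by reflexivity. fold top w.
  step; [exact H0|]. split; [cost; lia|]. right. split; [easy|]. cbn [zmem].
  split; [reflexivity|]. split; [apply upd_same|]. split; [apply upd_same|].
  split; intros i Hi; [now apply upd_diff|]. rewrite upd_diff by easy. now apply upd_other.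
Qed.

Lemma wp_move s :
  let z := zmem s S_ 0%Z in let wa := zmem s WA 0%Z in let wb := zmem s WB 0%Z in
  let lim := zmem s LIM 0%Z in let B := zmem s BLK 0%Z in
  let x := ((wb - wa) * zmem s 0%nat 0 + (z + wa))%Z in let x' := (x + B - 1)%Z in
  let dl := rmem s 0%nat wb - rmem s 0%nat wa in
  let jumps := (1 <= zmem s TAB 0 /\ z + B <= lim)%Z /\
    ((0 <= dl + rmem s SMN x /\ 0 <= dl + rmem s PMN x') \/
     (dl + rmem s SMX x < 0 /\ dl + rmem s PMX x' < 0)) in
  wp E move (fun s' t => (t <= 150)%nat /\
    ((1 <= zmem s LIN 0)%Z /\ zmem s' S_ 0%Z = lim \/
     (zmem s LIN 0 < 1)%Z /\ jumps /\ zmem s' S_ 0%Z = (z + B)%Z \/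
     (zmem s LIN 0 < 1)%Z /\ ~ jumps /\ zmem s' S_ 0%Z = (z + 1)%Z)) s.
Proof.
intros z wa wb lim B x x' dl jumps. unfold move.
step. step; [exact H0|]. fold z wa wb x. step. step; [exact H0|]. fold z wa wb dl.
set (s1 := mkState _ _).
apply wp_if; intros Hb; [apply beval_zle in Hb|apply beval_zle_false in Hb];
  (assert (Hb' : zmem s LIN 0%Z = zeval s1 !LIN) by reflexivity); cbn [zeval] in Hb, Hb'; rewrite <- Hb' in Hb.
{ step; [exact H0|]. split; [cost; lia|]. left. split; [easy|reflexivity]. }
apply wp_if; intros Hc; change (beval s1 _) with
  ((1 <=? zmem s TAB 0)%Z && ((z + B <=? lim)%Z && negb
    (negb (Rleb 0 (dl + rmem s SMN x) && Rleb 0 (dl + rmem s PMN x')) &&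
     negb (negb (Rleb 0 (dl + rmem s SMX x)) && negb (Rleb 0 (dl + rmem s PMX x')))))) in Hc.
- step; [exact H0|]. split; [unfold uniform_window, nonneg, sum_at; cost; lia|]. right; left. split; [easy|].
  split; [|reflexivity].
  apply andb_prop in Hc. destruct Hc as [C1 C2]. apply andb_prop in C2. destruct C2 as [C2 C3].
  apply Z.leb_le in C1, C2. split; [easy|].
  rewrite negb_true_iff, andb_false_iff, !negb_false_iff, !andb_true_iff, !negb_true_iff,
    !Rleb_true, !Rleb_false in C3. exact C3.
- step; [exact H0|]. split; [unfold uniform_window, nonneg, sum_at; cost; lia|]. right; right. split; [easy|].
  split; [|reflexivity]. intros [[C1 C2] C3].
  apply not_true_iff_false in Hc. apply Hc.
  apply Z.leb_le in C1, C2. rewrite C1, C2. simpl.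
  rewrite negb_true_iff, andb_false_iff, !negb_false_iff, !andb_true_iff, !negb_true_iff,
    !Rleb_true, !Rleb_false. exact C3.
Qed.


Notation Wn := (winner (arr A) (onZ f)).

(** One potential pays for time and space: each advance of [S_] lowers [phi] and pushes at most one
    piece, so the pieces pushed plus [phi] never exceed [phi (- lo)]. There are also no more pieces
    than positions passed, which gives the bound [pw m] of [node_ok]. The pieces of the children lie
    below [top], out of reach of the pushes. *)
Lemma wp_merge s k lo (lin tab : bool) B cap cap' j top :
  inputs m A f s -> zmem s J 0%Z = j -> zmem s LO 0%Z = lo -> zmem s LEN 0%Z = pw k ->
  zmem s TOP 0%Z = top -> zmem s LIN 0%Z = (if lin then 1 else 0)%Z ->
  zmem s TAB 0%Z = (if tab then 1 else 0)%Z -> zmem s BLK 0%Z = B -> (0 < B)%Z ->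
  (pw m <= j < 2 * pw m - 1)%Z -> (0 <= lo)%Z -> (lo + pw (S k) <= pw m)%Z ->
  node_ok m A f cap s (2 * (j - pw m)) k lo -> node_ok m A f cap s (2 * (j - pw m) + 1) k (lo + pw k) ->
  (zmem s ST (2 * (j - pw m) + 1) <= top)%Z -> (zmem s ST (2 * (j - pw m) + 2) <= top)%Z ->
  zmem s ST j = top -> (0 <= top)%Z ->
  (top + Z.of_nat cap' <= Z.of_nat space)%Z -> (2 * pw m <= Z.of_nat space)%Z ->
  (lin = true -> affine (onZ f) (pw m)) ->
  (lin = false -> tab = true -> tables_ok m f B (pw (S k)) s) ->
  merges_within (arr A) (onZ f) (pw m) lin tab B k lo cap' ->
  wp E merge (fun s' t =>
    node_ok m A f cap' s' j (S k) lo /\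
    (forall i, (i <= j)%Z -> zmem s' ST i = zmem s ST i) /\
    (forall i, (i < top)%Z -> zmem s' PX i = zmem s PX i /\ zmem s' PW i = zmem s PW i) /\
    zmem s' ST (j + 1)%Z = zmem s' TOP 0%Z /\ (zmem s' TOP 0 <= top + Z.of_nat cap')%Z /\
    (t <= 500 * (cap' + 2 * cap) + 300)%nat) s.
Proof.
intros Hin HJ HLO HLEN HTOP HLIN HTAB HB HB0 Hj Hlo Hlon Hn1 Hn2 Ht1 Ht2 Hstj Htop Hsp Hsp2 Hlin Htab
  [phi [Hphi Hcap]].
assert (Hpk := pw_pos k). assert (Hpk2 := pw_S k).
set (c := (2 * (j - pw m))%Z) in *.
destruct Hn1 as [L1 [_ [L2 L3]]]. destruct Hn2 as [R1 [_ [R2 R3]]].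
replace (c + 1 + 1)%Z with (c + 2)%Z in * by lia.
set (st1 := zmem s ST c) in *. set (en1 := zmem s ST (c + 1)%Z) in *. set (en2 := zmem s ST (c + 2)%Z) in *.
set (DD := bound_at (pw m) k lo).
assert (HDD : DD = (pw m - lo - 2 * pw k + 1)%Z) by (unfold DD, bound_at; lia).
unfold merge.
step. step; [exact H0|]. rewrite HJ, (proj1 Hin). fold c.
step. step; [exact H0|]. fold st1.
step. step; [exact H0|]. fold en1. step. step; [exact H0|]. fold en1.
step. step; [exact H0|]. fold en2.
step. step; [exact H0|]. rewrite HLO.
step. step; [exact H0|]. rewrite HLO, HLEN, (proj1 Hin), <- HDD.
step. step; [exact H0|]. rewrite HTOP.
match goal with |- context [wp _ _ _ ?x] => set (s0 := x) end.
apply wp_seq.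
apply wp_while with (v0 := (500 * (phi (- lo)%Z + 2 * cap) + 100)%nat) (Inv := fun s1 v => exists z pl pr t,
  zmem s1 S_ 0%Z = z /\ zmem s1 PL 0%Z = pl /\ zmem s1 PR 0%Z = pr /\ zmem s1 TOP 0%Z = t /\
  (- lo <= z <= DD)%Z /\ (st1 <= pl < en1)%Z /\ (en1 <= pr < en2)%Z /\
  (zmem s PX pl <= z)%Z /\ (zmem s PX pr <= z)%Z /\
  (forall i, (i < top)%Z -> zmem s1 PX i = zmem s PX i /\ zmem s1 PW i = zmem s PW i) /\
  (z = (- lo)%Z /\ t = top \/
   (top < t)%Z /\ runs (zmem s1 PX) (zmem s1 PW) (Wn (S k) lo) (- lo) z top t) /\
  (t - top <= z + lo)%Z /\ (t - top + Z.of_nat (phi z) <= Z.of_nat (phi (- lo)%Z))%Z /\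
  (500 * (phi z + Z.to_nat (en1 - pl) + Z.to_nat (en2 - pr)) + 100 <= v)%nat).
- exists (- lo)%Z, st1, en1, top. repeat (split; [reflexivity|]). split; [exact HTOP|].
  split; [lia|]. split; [lia|]. split; [lia|]. split; [rewrite (proj1 L3); lia|].
  split; [rewrite (proj1 R3); lia|]. split; [intros; split; reflexivity|].
  split; [now left|]. split; [lia|]. split; [lia|]. lia.
- intros s1 v Hf [z [pl [pr [t [E1 [E2 [E3 [E4 [I1 [I2 [I3 [I4 [I5 [I6 [I7 [I8 [I9 I10]]]]]]]]]]]]]]]]] Hb.
  apply beval_zle in Hb. sim_in Hb.
  unchanged EL from s0 to s1 by Hf as U1. unchanged ER from s0 to s1 by Hf as U2.
  unchanged D_ from s0 to s1 by Hf as U3. unchanged ST0 from s0 to s1 by Hf as U4.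
  unchanged LIN from s0 to s1 by Hf as U5. unchanged TAB from s0 to s1 by Hf as U6.
  unchanged BLK from s0 to s1 by Hf as U7. unchanged 0%nat from s0 to s1 by Hf as U8.
  real unchanged 0%nat from s to s1 by Hf as V0. real unchanged FV from s to s1 by Hf as V2.
  real unchanged PMN from s to s1 by Hf as V3. real unchanged PMX from s to s1 by Hf as V4.
  real unchanged SMN from s to s1 by Hf as V5. real unchanged SMX from s to s1 by Hf as V6.
  specialize (U1 0%Z). specialize (U2 0%Z). specialize (U3 0%Z). specialize (U4 0%Z).
  specialize (U5 0%Z). specialize (U6 0%Z). specialize (U7 0%Z). specialize (U8 0%Z).
  unfold s0 in U1, U2, U3, U4, U5, U6, U7, U8.
  sim_in U1; sim_in U2; sim_in U3; sim_in U4; sim_in U5; sim_in U6; sim_in U7; sim_in U8.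
  rewrite HLIN in U5. rewrite HTAB in U6. rewrite HB in U7. rewrite (proj1 Hin) in U8.
  rewrite E1, U3 in Hb.
  assert (Hin1 : inputs m A f s1) by (apply (inputs_keep m A f s); auto; rewrite U8; symmetry; apply Hin).
  clearbody s0. clear Hf.
  apply wp_if; intros Hb1; cbn [beval zeval zop_sem] in Hb1; rewrite E1, E2, U1 in Hb1.
  { apply andb_prop in Hb1. destruct Hb1 as [B1 B2]. apply Z.leb_le in B1, B2.
    rewrite (proj1 (I6 (pl + 1)%Z ltac:(lia))) in B2.
    step; [exact H0|]. rewrite E2.
    exists (500 * (phi z + Z.to_nat (en1 - (pl + 1)) + Z.to_nat (en2 - pr)) + 100)%nat. split.
    - exists z, (pl + 1)%Z, pr, t. sim. repeat (split; [first [assumption|reflexivity|lia]|]). lia.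
    - replace (en1 - pl)%Z with (en1 - (pl + 1) + 1)%Z in I10 by lia.
      rewrite Z2Nat.inj_add in I10 by lia. cost. lia. }
  apply wp_if; intros Hb2; cbn [beval zeval zop_sem] in Hb2; rewrite E1, E3, U2 in Hb2.
  { apply andb_prop in Hb2. destruct Hb2 as [B1 B2]. apply Z.leb_le in B1, B2.
    rewrite (proj1 (I6 (pr + 1)%Z ltac:(lia))) in B2.
    step; [exact H0|]. rewrite E3.
    exists (500 * (phi z + Z.to_nat (en1 - pl) + Z.to_nat (en2 - (pr + 1))) + 100)%nat. split.
    - exists z, pl, (pr + 1)%Z, t. sim. repeat (split; [first [assumption|reflexivity|lia]|]). lia.
    - replace (en2 - pr)%Z with (en2 - (pr + 1) + 1)%Z in I10 by lia.
      rewrite Z2Nat.inj_add in I10 by lia. cost. lia. }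
  apply andb_false_iff in Hb1, Hb2. rewrite !Z.leb_gt in Hb1, Hb2.
  assert (N1 : (pl + 1 < en1)%Z -> (z < zmem s PX (pl + 1))%Z).
  { intros Hlt. rewrite (proj1 (I6 (pl + 1)%Z ltac:(lia))) in Hb1. lia. }
  assert (N2 : (pr + 1 < en2)%Z -> (z < zmem s PX (pr + 1))%Z).
  { intros Hlt. rewrite (proj1 (I6 (pr + 1)%Z ltac:(lia))) in Hb2. lia. }
  assert (C1 := child_piece _ _ _ _ _ _ _ pl z DD L3 ltac:(lia) I4 N1 ltac:(lia)). cbv zeta in C1.
  set (l1 := if (pl + 1 <? en1)%Z then Z.min DD (zmem s PX (pl + 1)) else DD) in *.
  destruct C1 as [C1 [C2 C3]].
  assert (C4 := child_piece _ _ _ _ _ _ _ pr z l1 R3 ltac:(lia) I5 N2 ltac:(lia)). cbv zeta in C4.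
  set (lim := if (pr + 1 <? en2)%Z then Z.min l1 (zmem s PX (pr + 1)) else l1) in *.
  destruct C4 as [C4 [C5 C6]].
  set (wa := zmem s PW pl) in *. set (wb := zmem s PW pr) in *.
  assert (Hw1 : zmem s1 PW pl = wa) by (apply I6; lia).
  assert (Hw2 : zmem s1 PW pr = wb) by (apply I6; lia).
  assert (Hlim : cut s1 PR ER (cut s1 PL EL (zmem s1 D_ 0)) = lim).
  { unfold cut, lim, l1. rewrite E2, E3, U1, U2, U3.
    destruct (Z.ltb_spec (pl + 1) en1), (Z.ltb_spec (pr + 1) en2);
      rewrite ?(proj1 (I6 (pl + 1)%Z ltac:(lia))), ?(proj1 (I6 (pr + 1)%Z ltac:(lia))); reflexivity. }
  assert (Hstop : stop (arr A) (onZ f) (pw m) k lo (lim - 1) = true).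
  { unfold stop. fold DD. apply andb_true_intro. split; [apply Z.ltb_lt; lia|].
    apply orb_true_iff. destruct C6 as [->|C6].
    - destruct C3 as [->|C3]; [right; apply Z.eqb_refl|left].
      unfold jump, jumpAB. now rewrite C3.
    - left. unfold jump, jumpAB. rewrite C6, orb_true_r. reflexivity. }
  apply wp_seq. apply wp_conseq with (1 := wp_choose_winner s1).
  rewrite E1, E2, E3, Hw1, Hw2, Hlim.
  intros s2 t2 Hf2 [F1 [F2 [F3 [F4 Ht2']]]].
  assert (Ra := winner_range (arr A) (onZ f) k lo z). assert (Rb := winner_range (arr A) (onZ f) k (lo + pw k) z).
  rewrite C2 in Ra by lia. rewrite C5 in Rb by lia.
  assert (Hw : zmem s2 W_ 0%Z = Wn (S k) lo z).
  { rewrite F3, winner_S. unfold side. rewrite C2, C5 by lia. unfold candidate.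
    destruct Hin1 as [_ [A1 A2]]. rewrite !A1, !A2 by lia. reflexivity. }
  set (w := Wn (S k) lo z) in *.
  unchanged TOP from s1 to s2 by Hf2 as X1. unchanged ST0 from s1 to s2 by Hf2 as X2.
  unchanged PX from s1 to s2 by Hf2 as X3. unchanged PW from s1 to s2 by Hf2 as X4.
  unchanged S_ from s1 to s2 by Hf2 as X5.
  assert (Hfut : forall z', (z < z' <= lim)%Z ->
    merge_step (arr A) (onZ f) (pw m) lin tab B k lo z z' -> (phi z' < phi z)%nat).
  { intros z' Hz' Hst. apply Hphi; [|easy]. fold DD. lia. }
  assert (Hphi1 : (0 < phi z)%nat).
  { assert (Hst : merge_step (arr A) (onZ f) (pw m) lin tab B k lo z (if lin then lim else
        if near (stop (arr A) (onZ f) (pw m) k lo) (Z.to_nat (B - 1)) z then z + 1 else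
          if tab then (if z + B <=? lim then z + B else z + 1) else z + 1)%Z).
    { split; [destruct lin; [lia|]; destruct near; [lia|]; destruct tab; [|lia];
        destruct (Z.leb_spec (z + B) lim); lia|].
      destruct lin; [easy|]. destruct tab; [|easy].
      destruct near eqn:En; [now right|]. destruct (Z.leb_spec (z + B) lim); [now left|].
      exfalso. apply not_true_iff_false in En. apply En. apply near_true. exists (lim - 1)%Z. split; [lia|easy]. }
    apply Hphi in Hst; [lia|]. fold DD. lia. }
  apply wp_seq. eapply wp_conseq; [apply wp_push_winner|].
  { rewrite X1, E4. intros _. lia. }
  rewrite X1, X2, X5, E1, E4, U4, Hw, X4.
  intros s3 t3 Hf3 [Ht3 Hpush].
  eapply wp_conseq; [apply wp_move|]. cbv zeta.

  assert (Z3 : forall a, mem a (zmods choose_winner) = false -> mem a (zmods push_winner) = false ->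
    zmem s3 a 0%Z = zmem s1 a 0%Z).
  { intros a Ha1 Ha2. now rewrite (proj1 Hf3), (proj1 Hf2). }
  assert (Q3 : forall a i, mem a [0%nat; PMN; PMX; SMN; SMX] = true -> rmem s3 a i = rmem s a i).
  { intros a i Ha. apply mem_In in Ha. rewrite (proj2 Hf3), (proj2 Hf2) by reflexivity.
    destruct Ha as [<-|[<-|[<-|[<-|[<-|[]]]]]]; auto. }
  assert (G1 : zmem s3 WA 0%Z = wa) by now rewrite (proj1 Hf3).
  assert (G2 : zmem s3 WB 0%Z = wb) by now rewrite (proj1 Hf3).
  assert (G3 : zmem s3 LIM 0%Z = lim) by now rewrite (proj1 Hf3).
  rewrite G1, G2, G3, !Q3 by reflexivity.
  rewrite (Z3 S_), (Z3 BLK), (Z3 0%nat), (Z3 TAB), (Z3 LIN), E1, U5, U6, U7, U8 by reflexivity.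
  intros s4 t4 Hf4 [Ht4 Hmove].
  destruct Hin as [_ [A1 _]]. rewrite !A1 in Hmove by lia.
  set (z' := zmem s4 S_ 0%Z) in *.
  destruct (advance_ok m A f s k lo lin tab B z z' lim wa wb) as [M1 [M2 M3]];
    [lia|lia|lia|lia|fold DD; lia|intros; apply C2; lia|intros; apply C5; lia|exact Hstop|exact Hlin|exact Htab| |].
  { destruct Hmove as [[T1 T2]|[[T1 [T2 T3]]|[T1 [T2 T3]]]].
    - left. split; [destruct lin; [easy|lia]|easy].
    - right; left. split; [destruct lin; [lia|easy]|]. split; [|easy].
      destruct T2 as [[T2 T4] T5]. split; [|exact T5]. split; [destruct tab; [easy|lia]|lia].
    - right; right. split; [destruct lin; [lia|easy]|]. split; [|easy].
      intros [[T4 T5] T6]. apply T2. split; [rewrite T4; lia|exact T6]. }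
  fold w in M3. assert (Hzz : (z < z')%Z) by apply M1.
  assert (Hdec := Hfut z' ltac:(lia) M1).
  unchanged PL from s3 to s4 by Hf4 as K1. unchanged PR from s3 to s4 by Hf4 as K2.
  unchanged TOP from s3 to s4 by Hf4 as K3. unchanged PX from s3 to s4 by Hf4 as K4.
  unchanged PW from s3 to s4 by Hf4 as K5.
  exists (500 * (phi z' + Z.to_nat (en1 - pl) + Z.to_nat (en2 - pr)) + 100)%nat. split; [|cost; lia].
  exists z', pl, pr, (zmem s3 TOP 0%Z).
  split; [reflexivity|]. split; [now rewrite K1, Z3|]. split; [now rewrite K2, Z3|].
  split; [apply K3|]. split; [lia|]. split; [lia|]. split; [lia|]. split; [lia|]. split; [lia|].
  destruct Hpush as [[[P0 P1] [P2 [P3 P4]]]|[P1 [P2 [P3 [P4 [P5 P6]]]]]]; rewrite P2.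
  + destruct I7 as [[_ I7]|[_ I7]]; [lia|].
    split; [intros i Hi; rewrite K4, K5, P3, P4, X3, X4; now apply I6|].
    split; [right; split; [easy|]|split; [lia|split; [lia|lia]]].
    apply (runs_ext (zmem s1 PX) (zmem s1 PW)).
    { intros i. now rewrite K4, P3, X3. } { intros i. now rewrite K5, P4, X4. }
    apply runs_extend with z; [easy|lia|]. rewrite P1. exact M3.
  + assert (Htt : (top <= t)%Z) by (destruct I7 as [[_ I7]|[I7 _]]; lia).
    split; [intros i Hi; rewrite K4, K5, P5, P6, X3, X4 by lia; now apply I6|].
    split; [right; split; [lia|]|split; [lia|split; [lia|lia]]].
    destruct I7 as [[I7 I7']|[I7 I7']].
    * rewrite I7'. apply runs_start with w; [rewrite K4, <- I7', P3; exact I7|rewrite K5, <- I7'; exact P4|lia|].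
      rewrite <- I7. exact M3.
    * apply (runs_push (zmem s1 PX) (zmem s1 PW)) with (D := z) (w := w); try easy.
      -- intros i Hi. rewrite K4, P5, X3 by lia. reflexivity.
      -- intros i Hi. rewrite K5, P6, X4 by lia. reflexivity.
      -- now rewrite K4.
      -- now rewrite K5.
      -- intros Hww. apply P1. split; [easy|]. exact Hww.
- intros s1 v Hf [z [pl [pr [t [E1 [E2 [E3 [E4 [I1 [I2 [I3 [I4 [I5 [I6 [I7 [I8 [I9 I10]]]]]]]]]]]]]]]]] Hb.
  apply beval_zle_false in Hb. sim_in Hb.
  unchanged D_ from s0 to s1 by Hf as U3. unchanged J from s to s1 by Hf as U4.
  unchanged ST from s to s1 by Hf as U5.
  specialize (U3 0%Z). unfold s0 in U3. sim_in U3. rewrite E1, U3 in Hb.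
  split; [cost; lia|]. intros t' Ht'.
  apply wp_zset; [cbn [zeval zop_sem]; rewrite U4, HJ; unfold in_space; simpl; lia|].
  cbn [zeval zop_sem]. rewrite U4, HJ, E4.
  set (s2 := mkState _ _).
  assert (Hz : z = DD) by lia.
  destruct I7 as [[I7 _]|[I7 I7']]; [lia|].
  assert (S1 : forall i, i <> (j + 1)%Z -> zmem s2 ST i = zmem s ST i).
  { intros i Hi. unfold s2. cbn [zmem]. rewrite upd_diff by easy. apply U5. }
  assert (S2 : zmem s2 ST (j + 1)%Z = t) by (unfold s2; cbn [zmem]; apply upd_same).
  assert (S3 : zmem s2 TOP 0%Z = t) by exact E4.
  rewrite S2, S3. split.
  { unfold node_ok. rewrite S2, (S1 j) by lia. rewrite Hstj. split; [lia|]. split; [lia|].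
    split; [lia|]. replace (pw m - lo - pw (S k) + 1)%Z with z by lia. exact I7'. }
  split; [intros i Hi; apply S1; lia|]. split; [exact I6|]. split; [easy|]. split; [lia|].
  cost. lia.
Qed.
End Merge.

(** * Building the tree *)

(** The values of [f] are copied to [FV] once; [build] and [query] make no other oracle calls. Leaf
    [q] has the single piece number [q], starting at [- q]. *)
Definition leaves : com :=
  I ::= lit 0 ;;
  While (!I < size)%ze
    (Eval FV !I FSelf (ROfZ !I) ;;
     ZSet ST !I !I ;;
     ZSet PX !I (lit 0 - !I)%ze ;;
     ZSet PW !I !I ;;
     I ::= !I + lit 1) ;;
  ZSet ST size size ;;
  TOP ::= size.

Definition rise (i : zexp) : rexp := ROp RSub (RGet FV (i + lit 1)%ze) (RGet FV i).

Definition detect_affine : com :=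
  LIN ::= lit 1 ;;
  I ::= lit 0 ;;
  While (!I + lit 1 < size)%ze
    (If (BAnd (BRle (rise !I) (rise (lit 0))) (BRle (rise (lit 0)) (rise !I))) Skip (LIN ::= lit 0) ;;
     I ::= !I + lit 1).

(** The machine has no square root; the largest power of two with square at most [n] is found by
    doubling. *)
Definition init_block : com :=
  BLK ::= lit 1 ;;
  While (lit 4 * (!BLK * !BLK) <= size)%ze (BLK ::= lit 2 * !BLK).

(** [BLK] becomes the largest power of two with square at most [n / (2 * LEN)]; as [LEN] doubles per
    level, one halving suffices. *)
Definition level : com :=
  If (size < !BLK * !BLK * (lit 2 * !LEN))%ze (BLK ::= !BLK / lit 2) Skip ;;
  If (BAnd (!LIN <= lit 0) (lit 4 * (!LEN * !LEN) <= size))%ze (TAB ::= lit 1 ;; tables) (TAB ::= lit 0) ;;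
  LO ::= lit 0 ;;
  While (!LO < size)%ze (merge ;; J ::= !J + lit 1 ;; LO ::= !LO + lit 2 * !LEN) ;;
  LEN ::= lit 2 * !LEN.

Definition build : com :=
  leaves ;; detect_affine ;; init_block ;;
  LEN ::= lit 1 ;;
  J ::= size ;;
  While (!LEN < size)%ze level.

Lemma pw_le a b : (pw a <= pw b)%Z <-> (a <= b)%nat.
Proof. unfold pw. rewrite <- Z.pow_le_mono_r_iff; lia. Qed.

Lemma pw_lt a b : (pw a < pw b)%Z <-> (a < b)%nat.
Proof. unfold pw. rewrite <- Z.pow_lt_mono_r_iff; lia. Qed.

Fixpoint total (g : nat -> nat) (k d : nat) : nat :=
  match d with
  | O => 0
  | S d => g k + total g (S k) d
  end.

Section Build.
Variables (m : nat) (A : list R) (f : R -> R) (spo : spo_oracle) (space : nat).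
Let E := mkEnv (2 ^ m)%nat f spo space.
Hypothesis space_pos : (0 < space)%nat.
Let H0 : in_space E 0 := in_space_0 m f spo space space_pos.

Lemma runs_ext_below px pw px' pw' W u D st en : (st < en)%Z ->
  (forall i, (i < en)%Z -> px' i = px i) -> (forall i, (i < en)%Z -> pw' i = pw i) ->
  runs px pw W u D st en -> runs px' pw' W u D st en.
Proof.
intros H H1 H2 [H3 H4]. split; [rewrite H1; [easy|lia]|]. intros t Ht. specialize (H4 t Ht).
cbv zeta in *. rewrite (H1 t), (H2 t) by lia.
destruct (Z.ltb_spec (t + 1) en); [rewrite (H1 (t + 1)%Z), (H2 (t + 1)%Z) by lia; exact H4|].
repeat split; try easy. lia.
Qed.

Lemma wp_leaves s : zmem s 0%nat 0%Z = pw m -> (forall z, (0 <= z < pw m)%Z -> rmem s 0%nat z = arr A z) ->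
  (2 * pw m <= Z.of_nat space)%Z ->
  wp E leaves (fun s' t => inputs m A f s' /\ zmem s' TOP 0%Z = pw m /\
    (forall q, (0 <= q <= pw m)%Z -> zmem s' ST q = q) /\
    (forall q, (0 <= q < pw m)%Z -> zmem s' PX q = (- q)%Z /\ zmem s' PW q = q) /\
    (t <= 100 * 2 ^ m + 100)%nat) s.
Proof.
intros Hn HA Hsp. assert (Hpm := pw_nat m). assert (Hp := pw_pos m).
unfold leaves. step. step; [exact H0|].
match goal with |- context [wp _ _ _ ?x] => set (s0 := x) end.
apply wp_seq.
apply wp_while with (v0 := (100 * 2 ^ m + 20)%nat) (Inv := fun s1 v => exists a,
  zmem s1 I 0%Z = a /\ (0 <= a <= pw m)%Z /\ v = (100 * Z.to_nat (pw m - a) + 20)%nat /\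
  forall q, (0 <= q < a)%Z -> rmem s1 FV q = onZ f q /\ zmem s1 ST q = q /\
    zmem s1 PX q = (- q)%Z /\ zmem s1 PW q = q).
- exists 0%Z. split; [reflexivity|]. split; [lia|]. split; [lia|]. lia.
- intros s1 v Hf [a [Ha [Har [-> Hok]]]] Hb. apply beval_zle in Hb. sim_in Hb.
  unchanged 0%nat from s to s1 by Hf as U0. rewrite U0, Hn, Ha in Hb.
  assert (Hsa : in_space E a) by (unfold in_space; simpl; lia).
  step. apply wp_eval; [sim; now rewrite Ha| |].
  { cbn [reval zeval]. rewrite Ha. change (dim E) with (2 ^ m)%nat.
    rewrite INR_IZR_INZ, <- Hpm. split; [apply IZR_le; lia|apply IZR_lt; lia]. }
  cbn [zeval reval]. rewrite Ha.
  step. apply wp_zset; [cbn [zeval zmem]; now rewrite Ha|]. cbn [zeval zmem rmem]. rewrite Ha.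
  step. apply wp_zset; [cbn [zeval zmem]; rewrite upd_other by reflexivity; now rewrite Ha|].
  cbn [zeval zmem rmem zop_sem]. rewrite (upd_other _ ST) by reflexivity. rewrite Ha.
  step. apply wp_zset; [cbn [zeval zmem]; rewrite !upd_other by reflexivity; now rewrite Ha|].
  cbn [zeval zmem rmem zop_sem]. rewrite !(upd_other _ PX), !(upd_other _ ST) by reflexivity. rewrite Ha.
  step; [exact H0|]. rewrite Ha.
  eexists. split.
  + exists (a + 1)%Z. split; [reflexivity|]. split; [lia|]. split; [reflexivity|].
    intros q Hq. cbn [zmem rmem].
    destruct (Z.eq_dec q a) as [->|Hne].
    * unfold upd. cbn [Nat.eqb andb]. rewrite !Z.eqb_refl. repeat split; lia.
    * apply Z.eqb_neq in Hne. unfold upd. cbn [Nat.eqb andb]. rewrite !Hne.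
      apply Z.eqb_neq in Hne. apply Hok. lia.
  + replace (pw m - a)%Z with (pw m - (a + 1) + 1)%Z by lia. rewrite Z2Nat.inj_add by lia. cost.
    change (Z.to_nat 1) with 1%nat. lia.
- intros s1 v Hf [a [Ha [Har [-> Hok]]]] Hb. apply beval_zle_false in Hb. sim_in Hb.
  unchanged 0%nat from s to s1 by Hf as U0. rewrite U0, Hn, Ha in Hb. split; [cost; lia|]. intros t Ht.
  assert (Haa : a = pw m) by lia. subst a.
  step. apply wp_zset; [cbn [zeval]; rewrite U0, Hn; unfold in_space; simpl; lia|].
  cbn [zeval]. rewrite U0, Hn. step; [exact H0|]. rewrite U0, Hn.
  split; [|split; [reflexivity|split; [|split]]].
  + split; [cbn [zmem]; rewrite !upd_other by reflexivity; now rewrite U0|]. cbn [rmem]. split.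
    * intros z Hz. rewrite (proj2 Hf) by reflexivity. now apply HA.
    * intros z Hz. apply Hok; lia.
  + intros q Hq. cbn [zmem].
    destruct (Z.eq_dec q (pw m)) as [->|Hne]; [apply upd_same|]. rewrite upd_diff by easy. apply Hok. lia.
  + intros q Hq. cbn [zmem]. apply Hok. lia.
  + cost. lia.
Qed.

Lemma wp_detect_affine s (lin : bool) : inputs m A f s -> (lin = true <-> affine (onZ f) (pw m)) ->
  wp E detect_affine (fun s' t => zmem s' LIN 0%Z = (if lin then 1 else 0)%Z /\
    (t <= 100 * 2 ^ m + 100)%nat) s.
Proof.
intros [Hn [_ HF]] Hlin. assert (Hpm := pw_nat m). assert (Hp := pw_pos m).
unfold detect_affine. step. step; [exact H0|]. step. step; [exact H0|].
match goal with |- context [wp _ _ _ ?x] => set (s0 := x) end.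
apply wp_while with (v0 := (100 * 2 ^ m + 20)%nat) (Inv := fun s1 v => exists a,
  zmem s1 I 0%Z = a /\ (0 <= a < pw m)%Z /\ v = (100 * Z.to_nat (pw m - a) + 20)%nat /\
  (zmem s1 LIN 0%Z = 1%Z /\ (forall x, (0 <= x < a)%Z -> slope (onZ f) x = slope (onZ f) 0) \/
   zmem s1 LIN 0%Z = 0%Z /\ ~ affine (onZ f) (pw m))).
- exists 0%Z. split; [reflexivity|]. split; [lia|]. split; [lia|]. left. split; [reflexivity|lia].
- intros s1 v Hf [a [Ha [Har [-> Hok]]]] Hb. apply beval_zle in Hb. sim_in Hb.
  unchanged 0%nat from s to s1 by Hf as U0. rewrite U0, Hn, Ha in Hb.
  real unchanged FV from s to s1 by Hf as R2.
  apply wp_seq.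
  apply (wp_conseq E _ s1 (fun s2 t => (t <= 50)%nat /\
    (zmem s2 LIN 0%Z = 1%Z /\ (forall x, (0 <= x < a + 1)%Z -> slope (onZ f) x = slope (onZ f) 0) \/
     zmem s2 LIN 0%Z = 0%Z /\ ~ affine (onZ f) (pw m)))).
  { assert (Hs : reval s1 (rise !I) = slope (onZ f) a /\ reval s1 (rise (lit 0)) = slope (onZ f) 0).
    { unfold rise, slope. cbn [reval zeval zop_sem rop_sem]. rewrite Ha, !R2, !HF by lia. split; reflexivity. }
    destruct Hs as [Hs1 Hs2].
    apply wp_if; intros Hc; cbn [beval] in Hc; rewrite Hs1, Hs2 in Hc.
    - apply andb_prop in Hc. destruct Hc as [C1 C2]. apply Rleb_true in C1, C2.
      step. split; [unfold rise; cost; lia|]. destruct Hok as [[L1 L2]|Hok]; [left|now right].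
      split; [easy|]. intros x Hx. destruct (Z.eq_dec x a) as [->|]; [lra|]. apply L2. lia.
    - step; [exact H0|]. split; [unfold rise; cost; lia|]. right. split; [reflexivity|].
      intros Haff. specialize (Haff a ltac:(lia) ltac:(lia)). rewrite Haff in Hc.
      rewrite (proj2 (Rleb_true _ _)) in Hc by lra. discriminate. }
  intros s2 t2 Hf2 [Ht2 Hok2]. unchanged I from s1 to s2 by Hf2 as U2.
  step; [exact H0|]. rewrite U2, Ha. eexists. split.
  + exists (a + 1)%Z. split; [reflexivity|]. split; [lia|]. split; [reflexivity|]. exact Hok2.
  + replace (pw m - a)%Z with (pw m - (a + 1) + 1)%Z by lia. rewrite Z2Nat.inj_add by lia. cost.
    change (Z.to_nat 1) with 1%nat. lia.
- intros s1 v Hf [a [Ha [Har [-> Hok]]]] Hb. apply beval_zle_false in Hb. sim_in Hb.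
  unchanged 0%nat from s to s1 by Hf as U0. rewrite U0, Hn, Ha in Hb. split; [cost; lia|]. intros t Ht.
  split; [|cost; lia]. destruct Hok as [[L1 L2]|[L1 L2]].
  + destruct lin; [easy|]. exfalso.
    assert (Hc : false = true); [|discriminate]. apply Hlin. intros x Hx1 Hx2. apply L2. lia.
  + destruct lin; [|easy]. exfalso. apply L2. now apply Hlin.
Qed.

Lemma wp_init_block s : zmem s 0%nat 0%Z = pw m ->
  wp E init_block (fun s' t => zmem s' BLK 0%Z = pw (m / 2) /\ (t <= 50 * m + 50)%nat) s.
Proof.
intros Hn. unfold init_block. step. step; [exact H0|].
match goal with |- context [wp _ _ _ ?x] => set (s0 := x) end.
assert (Hsq : forall b, (4 * (pw b * pw b))%Z = pw (2 * b + 2)).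
{ intros b. replace (2 * b + 2)%nat with (S (S (b + b))) by lia. rewrite !pw_S, pw_add. lia. }
apply wp_while with (v0 := (50 * m + 20)%nat) (Inv := fun s1 v => exists b,
  zmem s1 BLK 0%Z = pw b /\ (2 * b <= m)%nat /\ v = (50 * (m - b) + 20)%nat).
- exists 0%nat. split; [reflexivity|]. split; lia.
- intros s1 v Hf [b [Hb1 [Hb2 ->]]] Hb. apply beval_zle in Hb. sim_in Hb.
  unchanged 0%nat from s to s1 by Hf as U0. rewrite U0, Hn, Hb1, Hsq in Hb. apply pw_le in Hb.
  step; [exact H0|]. rewrite Hb1. eexists. split.
  + exists (S b). split; [sim; now rewrite pw_S|]. split; [lia|reflexivity].
  + cost. lia.
- intros s1 v Hf [b [Hb1 [Hb2 ->]]] Hb. apply beval_zle_false in Hb. sim_in Hb.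
  unchanged 0%nat from s to s1 by Hf as U0. rewrite U0, Hn, Hb1, Hsq in Hb. apply pw_lt in Hb.
  split; [cost; lia|]. intros t Ht. split; [|cost; lia]. rewrite Hb1. f_equal.
  apply Nat.div_unique with (m - 2 * b)%nat; lia.
Qed.

Variables (lin : bool) (caps : nat -> nat).

Definition tabulated (k : nat) : bool := negb lin && (2 * k <=? m)%nat.

Definition finished (s : state) (k : nat) (Q : Z) : Prop :=
  forall q, (0 <= q < Q)%Z -> node_ok m A f (caps k) s (off m k + q) k (q * pw k) /\
    (zmem s ST (off m k + q + 1) <= zmem s TOP 0)%Z.

Lemma node_ok_below s s' cap id k lo top : node_ok m A f cap s id k lo ->
  zmem s' ST id = zmem s ST id -> zmem s' ST (id + 1)%Z = zmem s ST (id + 1)%Z ->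
  (zmem s ST (id + 1) <= top)%Z ->
  (forall i, (i < top)%Z -> zmem s' PX i = zmem s PX i /\ zmem s' PW i = zmem s PW i) ->
  node_ok m A f cap s' id k lo.
Proof.
intros [H1 [H2 [H3 H4]]] E1 E2 Ht Hp. unfold node_ok. rewrite E1, E2.
split; [easy|]. split; [easy|]. split; [easy|].
apply (runs_ext_below (zmem s PX) (zmem s PW)); [lia| | |easy]; intros i Hi; apply Hp; lia.
Qed.

Lemma off_next k : (k < m)%nat -> off m (S k) = (off m k + pw (m - k))%Z.
Proof. intros H. unfold off. replace (m - k)%nat with (S (m - S k)) by lia. rewrite pw_S. lia. Qed.

Hypothesis Hlin : lin = true <-> affine (onZ f) (pw m).
Hypothesis Hsp1 : (2 * pw m <= Z.of_nat space)%Z.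
Hypothesis Htab : forall k, (k <= m)%nat -> tabulated k = true -> (pw k * pw m <= Z.of_nat space)%Z.
Hypothesis Hmw : forall k q, (S k <= m)%nat -> (0 <= q < pw (m - S k))%Z ->
  merges_within (arr A) (onZ f) (pw m) lin (tabulated (S k)) (pw ((m - S k) / 2)) k (q * pw (S k)) (caps (S k)).

Definition pieces_at (k : nat) : nat := (2 ^ (m - S k) * caps (S k))%nat.

Definition time_at (k : nat) : nat :=
  (500 + (if tabulated (S k) then 700 * 2 ^ S k * 2 ^ m else 0) +
   2 ^ (m - S k) * (600 + 500 * (caps (S k) + 2 * caps k)))%nat.

(** The inequality with [total] reserves cells for the pieces of all levels still to come. *)
Definition leveled (k : nat) (s : state) : Prop :=
  inputs m A f s /\ (k <= m)%nat /\ zmem s LEN 0%Z = pw k /\ zmem s J 0%Z = (off m k + pw (m - k))%Z /\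
  zmem s LIN 0%Z = (if lin then 1 else 0)%Z /\ zmem s BLK 0%Z = pw ((m - k) / 2) /\
  (0 <= zmem s TOP 0)%Z /\ zmem s ST (zmem s J 0) = zmem s TOP 0%Z /\
  (zmem s TOP 0 + Z.of_nat (total pieces_at k (m - k)) <= Z.of_nat space)%Z /\
  forall k', (k' <= k)%nat -> finished s k' (pw (m - k')).

Lemma wp_level k s : (k < m)%nat -> leveled k s ->
  wp E level (fun s' t => leveled (S k) s' /\ (t <= time_at k)%nat) s.
Proof.
intros Hk [Hin [_ [L1 [L2 [L3 [L4 [L5 [L6 [L7 L8]]]]]]]]].
assert (Hpm := pw_nat m). assert (Hp := pw_pos m). assert (Hpk := pw_pos k).
assert (Hpk2 := pw_S k). assert (Hpmk := pw_pos (m - S k)).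
assert (Hprod : (pw (m - S k) * pw (S k) = pw m)%Z) by (rewrite <- pw_add; f_equal; lia).
unfold level. apply wp_seq.
apply (wp_conseq E _ s (fun s' t => (t <= 50)%nat /\ zmem s' BLK 0%Z = pw ((m - S k) / 2))).
(* The test succeeds exactly if [m - k] is even, and only then is [(m - S k) / 2] smaller than
   [b]. *)
{ set (b := ((m - k) / 2)%nat) in *.
  assert (Hsq : (pw b * pw b * (2 * pw k))%Z = pw (b + b + S k)) by (rewrite !pw_add, pw_S; ring).
  assert (Hbm := Nat.div_mod_eq (m - k) 2). assert (Hbl := Nat.mod_upper_bound (m - k) 2). fold b in Hbm.
  apply wp_if; intros Hb; [apply beval_zle in Hb|apply beval_zle_false in Hb]; sim_in Hb;
    rewrite (proj1 Hin), L1, L4, Hsq in Hb.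
  - assert (Hb' : (m < b + b + S k)%nat) by (apply pw_lt; lia).
    step; [exact H0|]. split; [cost; lia|]. sim. rewrite L4.
    destruct b as [|b']; [lia|].
    replace ((m - S k) / 2)%nat with b' by (apply Nat.div_unique with 1%nat; lia).
    rewrite pw_S, Z.mul_comm, Z_div_mult; lia.
  - assert (Hb' : (b + b + S k <= m)%nat) by (apply pw_le; lia).
    step. split; [cost; lia|]. rewrite L4. f_equal. apply Nat.div_unique with 0%nat; lia. }
intros s1 t1 Hf1 [Ht1 HB].
unchanged LEN from s to s1 by Hf1 as U1. unchanged LIN from s to s1 by Hf1 as U2.
unchanged 0%nat from s to s1 by Hf1 as U3.
assert (Hin1 : inputs m A f s1).
{ apply (inputs_keep m A f s); auto; intros i; now rewrite (proj2 Hf1) by reflexivity. }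
apply wp_seq.
apply (wp_conseq E _ s1 (fun s' t =>
  (t <= 100 + (if tabulated (S k) then 700 * 2 ^ S k * 2 ^ m else 0))%nat /\
  zmem s' TAB 0%Z = (if tabulated (S k) then 1 else 0)%Z /\
  (tabulated (S k) = true -> tables_ok m f (pw ((m - S k) / 2)) (pw (S k)) s'))).
{ assert (Hsq : (4 * (pw k * pw k))%Z = pw (2 * S k)).
  { replace (2 * S k)%nat with (S k + S k)%nat by lia. rewrite pw_add, pw_S. lia. }
  assert (Hguard : beval s1 (BAnd (!LIN <= lit 0) (lit 4 * (!LEN * !LEN) <= size))%ze = tabulated (S k)).
  { cbn [beval zeval zop_sem]. rewrite U1, U2, U3, L1, L3, (proj1 Hin), Hsq. unfold tabulated.
    f_equal; [now destruct lin|]. apply eq_true_iff_eq. rewrite Z.leb_le, Nat.leb_le. apply pw_le. }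
  apply wp_if; rewrite Hguard; intros Ht; rewrite Ht.
  - step. step; [exact H0|]. set (s2 := mkState _ _).
    assert (Hin2 : inputs m A f s2) by (apply (inputs_keep m A f s1); auto).
    assert (Hspk := Htab (S k) ltac:(lia) Ht).
    apply (wp_conseq E _ s2 _ _ (wp_tables m A f spo space space_pos s2 _ (pw (S k)) Hin2 HB (pw_pos _)
      ltac:(unfold s2; sim; rewrite U1, L1; lia)
      ltac:(split; [lia|apply pw_le; lia]) Hspk)).
    intros s3 t3 Hf3 [Htb Ht3].
    replace (Z.to_nat (pw (S k))) with (2 ^ S k)%nat in Ht3 by (rewrite pw_nat; lia).
    split; [cost; lia|]. split; [|easy]. rewrite (proj1 Hf3) by reflexivity. reflexivity.
  - step; [exact H0|]. split; [cost; lia|]. split; [reflexivity|easy]. }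
intros s2 t2 Hf2 [Ht2 [HT Htbl]].
assert (K : forall a i, mem a [0%nat; ST; PX; PW; TOP; LEN; LIN; J] = true -> zmem s2 a i = zmem s a i).
{ intros a i Ha. apply mem_In in Ha.
  destruct Ha as [<-|[<-|[<-|[<-|[<-|[<-|[<-|[<-|[]]]]]]]]]; now rewrite (proj1 Hf2), (proj1 Hf1) by reflexivity. }
assert (KB : zmem s2 BLK 0%Z = pw ((m - S k) / 2)) by now rewrite (proj1 Hf2) by reflexivity.
assert (Hin2 : inputs m A f s2).
{ apply (inputs_keep m A f s1); [now rewrite (proj1 Hf2) by reflexivity|intros i; now rewrite (proj2 Hf2) by reflexivity|intros i; now rewrite (proj2 Hf2) by reflexivity|exact Hin1]. }
step. step; [exact H0|].
match goal with |- context [wp _ _ _ ?x] => set (s3 := x) end.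
apply wp_seq.
set (per := (600 + 500 * (caps (S k) + 2 * caps k))%nat).
set (rest := total pieces_at (S k) (m - S k)).
assert (Hrest : total pieces_at k (m - k) = (2 ^ (m - S k) * caps (S k) + rest)%nat).
{ replace (m - k)%nat with (S (m - S k)) by lia. reflexivity. }
assert (Hpn := pw_nat (m - S k)).
apply wp_while with (v0 := (2 ^ (m - S k) * per + 100)%nat) (Inv := fun s4 v => exists q,
  (0 <= q <= pw (m - S k))%Z /\ zmem s4 LO 0%Z = (q * pw (S k))%Z /\ zmem s4 J 0%Z = (off m (S k) + q)%Z /\
  (0 <= zmem s4 TOP 0)%Z /\ zmem s4 ST (off m (S k) + q)%Z = zmem s4 TOP 0%Z /\
  (zmem s4 TOP 0 + (pw (m - S k) - q) * Z.of_nat (caps (S k)) + Z.of_nat rest <= Z.of_nat space)%Z /\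
  (forall k', (k' <= k)%nat -> finished s4 k' (pw (m - k'))) /\ finished s4 (S k) q /\
  (Z.to_nat (pw (m - S k) - q) * per + 100 <= v)%nat).
- exists 0%Z. assert (EJ : zmem s3 J 0%Z = off m (S k)) by (unfold s3; sim; rewrite K, L2, off_next; auto).
  assert (ET : zmem s3 TOP 0%Z = zmem s TOP 0%Z) by (unfold s3; sim; now rewrite K).
  assert (ES : forall i, zmem s3 ST i = zmem s ST i) by (intros i; unfold s3; sim; now rewrite K).
  split; [lia|]. split; [reflexivity|]. split; [lia|]. rewrite ET, ES. split; [easy|].
  split; [rewrite <- L6, L2, off_next by easy; f_equal; lia|].
  split; [rewrite Hrest in L7; lia|]. split; [|split; [intros q Hq; lia|]].
  + intros k' Hk' q Hq. destruct (L8 k' Hk' q Hq) as [N1 N2]. rewrite ET, ES. split; [|easy].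
    apply (node_ok_keep m A f s); auto; intros i; unfold s3; sim; now rewrite K.
  + replace (Z.to_nat (pw (m - S k) - 0)) with (2 ^ (m - S k))%nat by lia. lia.
- intros s4 v Hf4 [q [Q1 [Q2 [Q3 [Q4 [Q5 [Q6 [Q7 [Q8 Q9]]]]]]]]] Hb.
  apply beval_zle in Hb. sim_in Hb.
  assert (K4 : forall a, mem a [0; LEN; LIN]%nat = true -> zmem s4 a 0%Z = zmem s a 0%Z).
  { intros a Ha. apply mem_In in Ha.
    destruct Ha as [<-|[<-|[<-|[]]]]; rewrite (proj1 Hf4) by reflexivity; unfold s3; sim; now rewrite K. }
  rewrite Q2, (K4 0%nat), (proj1 Hin) in Hb by reflexivity.
  assert (Hq : (q < pw (m - S k))%Z) by nia.
  assert (Hin4 : inputs m A f s4).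
  { apply (inputs_keep m A f s2); [rewrite (proj1 Hf4) by reflexivity; reflexivity|intros i; now rewrite (proj2 Hf4) by reflexivity|intros i; now rewrite (proj2 Hf4) by reflexivity|exact Hin2]. }
  assert (Hoff : (2 * (off m (S k) + q - pw m) = off m k + 2 * q)%Z).
  { rewrite off_next by easy. unfold off. lia. }
  assert (Hmk : pw (m - k) = (2 * pw (m - S k))%Z) by (rewrite <- pw_S; f_equal; lia).
  assert (Hoffk : off m (S k) = (2 * pw m - 2 * pw (m - S k))%Z) by reflexivity.
  assert (Hbig : (2 * pw (m - S k) <= pw m)%Z) by nia.
  destruct (Q7 k (le_n k) (2 * q)%Z ltac:(lia)) as [N1 N2].
  destruct (Q7 k (le_n k) (2 * q + 1)%Z ltac:(lia)) as [N3 N4].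
  set (top := zmem s4 TOP 0%Z) in *.
  assert (Hmerge := wp_merge m A f spo space space_pos s4 k (q * pw (S k)) lin (tabulated (S k))
    (pw ((m - S k) / 2)) (caps k) (caps (S k)) (off m (S k) + q) top Hin4 Q3 Q2).
  rewrite (K4 LEN), (K4 LIN), L1, L3 in Hmerge by reflexivity.
  specialize (Hmerge eq_refl eq_refl eq_refl).
  rewrite (proj1 Hf4 TAB) in Hmerge by reflexivity.
  rewrite (proj1 Hf4 BLK) in Hmerge by reflexivity.
  specialize (Hmerge HT KB (pw_pos _) ltac:(lia) ltac:(nia) ltac:(nia)).
  rewrite Hoff in Hmerge.
  replace (off m k + (2 * q + 1))%Z with (off m k + 2 * q + 1)%Z in N3, N4 by lia.
  replace (2 * q * pw k)%Z with (q * pw (S k))%Z in N1 by (rewrite pw_S; lia).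
  replace ((2 * q + 1) * pw k)%Z with (q * pw (S k) + pw k)%Z in N3 by (rewrite pw_S; lia).
  replace (off m k + 2 * q + 1 + 1)%Z with (off m k + 2 * q + 2)%Z in N4 by lia.
  specialize (Hmerge N1 N3 N2 N4 Q5 Q4 ltac:(nia) Hsp1 (proj1 Hlin)).
  specialize (Hmerge ltac:(intros _ Ht; apply (tables_ok_keep m f _ _ s2); [|now apply Htbl];
    intros a i Ha; apply mem_In in Ha;
    destruct Ha as [<-|[<-|[<-|[<-|[]]]]]; now rewrite (proj2 Hf4) by reflexivity)).
  specialize (Hmerge (Hmw k q Hk ltac:(lia))).
  apply wp_seq. apply wp_conseq with (1 := Hmerge). clear Hmerge.
  intros s5 t5 Hf5 [M1 [M2 [M3 [M4 [M5 Ht5]]]]].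
  unchanged J from s4 to s5 by Hf5 as W1. unchanged LO from s4 to s5 by Hf5 as W2.
  unchanged LEN from s4 to s5 by Hf5 as W3.
  step. step; [exact H0|]. rewrite W1, Q3. step; [exact H0|]. rewrite W2, W3, (K4 LEN), L1, Q2 by reflexivity.
  set (s6 := mkState _ _).
  assert (ET6 : zmem s6 TOP 0%Z = zmem s5 TOP 0%Z) by reflexivity.
  assert (ES6 : forall i, zmem s6 ST i = zmem s5 ST i) by reflexivity.
  assert (Hmono : (top <= zmem s5 TOP 0)%Z).
  { destruct M1 as [M1 _]. rewrite M4 in M1. rewrite (M2 (off m (S k) + q)%Z), Q5 in M1 by lia. lia. }
  (* Finished nodes survive: their pieces lie below [top], and their entries of [ST] have indices at
     most that of the current node, where the merge changes nothing. *)
  assert (Hkeep : forall k' q', (off m k' + q' + 1 <= off m (S k) + q)%Z ->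
    node_ok m A f (caps k') s4 (off m k' + q') k' (q' * pw k') /\ (zmem s4 ST (off m k' + q' + 1) <= top)%Z ->
    node_ok m A f (caps k') s6 (off m k' + q') k' (q' * pw k') /\
    (zmem s6 ST (off m k' + q' + 1) <= zmem s6 TOP 0)%Z).
  { intros k' q' Hid [B1 B2]. rewrite ET6, ES6, M2 by lia. split; [|lia].
    apply (node_ok_below s4 s6 _ _ _ _ top B1);
      [rewrite ES6; apply M2; lia|rewrite ES6; apply M2; lia|exact B2|exact M3]. }
  exists (Z.to_nat (pw (m - S k) - (q + 1)) * per + 100)%nat. split.
  + exists (q + 1)%Z. split; [lia|].
    split; [unfold s6; sim; lia|]. split; [unfold s6; sim; lia|].
    split; [lia|]. split; [rewrite <- M4; f_equal; lia|].
    split; [nia|]. split; [|split; [|lia]].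
    * intros k' Hk' q' Hq'. apply Hkeep; [|apply (Q7 k' Hk' q' Hq')].
      assert (pw (m - k) <= pw (m - k'))%Z by (apply pw_le; lia).
      unfold off in *. lia.
    * intros q' Hq'. destruct (Z.eq_dec q' q) as [->|Hne].
      { rewrite ET6, ES6, M4. split; [|lia]. apply (node_ok_keep m A f s5); auto. }
      apply Hkeep; [lia|]. apply Q8. lia.
  + replace (Z.to_nat (pw (m - S k) - q)) with (S (Z.to_nat (pw (m - S k) - (q + 1)))) in Q9 by lia.
    unfold per in *. cost. lia.
- intros s4 v Hf4 [q [Q1 [Q2 [Q3 [Q4 [Q5 [Q6 [Q7 [Q8 Q9]]]]]]]]] Hb.
  apply beval_zle_false in Hb. sim_in Hb.
  assert (K4 : forall a, mem a [0; LEN; LIN]%nat = true -> zmem s4 a 0%Z = zmem s a 0%Z).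
  { intros a Ha. apply mem_In in Ha.
    destruct Ha as [<-|[<-|[<-|[]]]]; rewrite (proj1 Hf4) by reflexivity; unfold s3; sim; now rewrite K. }
  rewrite Q2, (K4 0%nat), (proj1 Hin) in Hb by reflexivity.
  assert (Hq : q = pw (m - S k)) by nia. subst q.
  split; [cost; lia|]. intros t Ht.
  step; [exact H0|]. rewrite (K4 LEN), L1 by reflexivity.
  split; [|unfold time_at; fold per; cost; lia].
  set (s6 := mkState _ _).
  assert (ET6 : zmem s6 TOP 0%Z = zmem s4 TOP 0%Z) by reflexivity.
  assert (ES6 : forall i, zmem s6 ST i = zmem s4 ST i) by reflexivity.
  assert (EJ6 : zmem s6 J 0%Z = zmem s4 J 0%Z) by reflexivity.
  assert (Hfin : forall k', (k' <= k)%nat \/ k' = S k -> finished s6 k' (pw (m - k'))).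
  { intros k' Hk' q Hq. rewrite ET6, ES6.
    assert (B : node_ok m A f (caps k') s4 (off m k' + q) k' (q * pw k') /\
      (zmem s4 ST (off m k' + q + 1) <= zmem s4 TOP 0)%Z).
    { destruct Hk' as [Hk'|Hk']; [now apply Q7|]. subst k'. now apply Q8. }
    destruct B as [B1 B2]. split; [|easy]. apply (node_ok_keep m A f s4); auto. }
  unfold leveled. rewrite EJ6, ET6, ES6, Q3, Q5.
  split.
  { apply (inputs_keep m A f s2); [unfold s6; sim; rewrite (proj1 Hf4) by reflexivity; reflexivity|intros i; unfold s6; cbn [rmem]; now rewrite (proj2 Hf4) by reflexivity|intros i; unfold s6; cbn [rmem]; now rewrite (proj2 Hf4) by reflexivity|exact Hin2]. }
  split; [lia|]. split; [unfold s6; sim; lia|]. split; [lia|].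
  split; [unfold s6; sim; now rewrite (K4 LIN)|].
  split; [unfold s6; sim; rewrite (proj1 Hf4) by reflexivity; exact KB|].
  split; [easy|]. split; [easy|]. fold rest. split; [lia|].
  intros k' Hk'. apply Hfin. lia.
Qed.

Hypothesis Hcaps0 : (1 <= caps 0)%nat.
Hypothesis Hsp2 : (pw m + Z.of_nat (total pieces_at 0 m) <= Z.of_nat space)%Z.

Lemma wp_build s : zmem s 0%nat 0%Z = pw m -> (forall z, (0 <= z < pw m)%Z -> rmem s 0%nat z = arr A z) ->
  wp E build (fun s' t => valid m A f caps s' /\ (t <= 500 * 2 ^ m + total time_at 0 m + 500 + 100 * m)%nat) s.
Proof.
intros Hn HA. assert (Hp := pw_pos m).
unfold build.
apply wp_seq. apply wp_conseq with (1 := wp_leaves s Hn HA Hsp1).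
intros s1 t1 _ [Hin1 [T1 [T2 [T3 Ht1]]]].
apply wp_seq. apply wp_conseq with (1 := wp_detect_affine s1 lin Hin1 Hlin).
intros s2 t2 Hf2 [D1 Ht2].
unchanged 0%nat from s1 to s2 by Hf2 as U0.
apply wp_seq. apply wp_conseq with (1 := wp_init_block s2 ltac:(rewrite U0; apply Hin1)).
intros s3 t3 Hf3 [B1 Ht3].
step. step; [exact H0|].
assert (K : forall a i, mem a [0%nat; ST; PX; PW; TOP] = true -> zmem s3 a i = zmem s1 a i).
{ intros a i Ha. apply mem_In in Ha.
  destruct Ha as [<-|[<-|[<-|[<-|[<-|[]]]]]]; now rewrite (proj1 Hf3), (proj1 Hf2) by reflexivity. }
step. step; [exact H0|]. rewrite K, (proj1 Hin1) by reflexivity.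
match goal with |- context [wp _ _ _ ?x] => set (s4 := x) end.
assert (Hoff0 : off m 0 = 0%Z) by (unfold off; rewrite Nat.sub_0_r; lia).
assert (K4 : forall a i, mem a [0%nat; ST; PX; PW; TOP] = true -> zmem s4 a i = zmem s1 a i).
{ intros a i Ha. rewrite <- K by easy. apply mem_In in Ha.
  destruct Ha as [<-|[<-|[<-|[<-|[<-|[]]]]]]; reflexivity. }
apply wp_while with (v0 := (total time_at 0 m + 20 * m + 20)%nat) (Inv := fun s5 v => exists k,
  leveled k s5 /\ v = (total time_at k (m - k) + 20 * (m - k) + 20)%nat).
- exists 0%nat. rewrite Nat.sub_0_r. split; [|lia].
  unfold leveled. rewrite (K4 TOP), T1, Nat.sub_0_r, Hoff0 by reflexivity.
  split.
  { apply (inputs_keep m A f s1); [now apply K4| | |exact Hin1];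
      intros i; unfold s4; cbn [rmem]; now rewrite (proj2 Hf3), (proj2 Hf2) by reflexivity. }
  split; [lia|]. split; [reflexivity|]. split; [reflexivity|].
  split; [unfold s4; sim; now rewrite (proj1 Hf3) by reflexivity|]. split; [exact B1|].
  split; [lia|]. split; [change (zmem s4 J 0%Z) with (pw m); rewrite K4 by reflexivity; apply T2; lia|].
  split; [exact Hsp2|].
  intros k' Hk' q Hq. assert (k' = 0%nat) as -> by lia. rewrite Nat.sub_0_r in Hq.
  change (pw 0) with 1%Z. rewrite Hoff0, Z.add_0_l, Z.mul_1_r.
  assert (Hnd : node_ok m A f (caps 0) s4 q 0 q).
  { unfold node_ok. rewrite !(K4 ST), !T2 by (reflexivity || lia).
    split; [lia|]. split; [lia|]. split; [lia|]. destruct (T3 q Hq) as [P1 P2].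
    apply runs_start with q; [now rewrite K4|now rewrite K4| |reflexivity].
    change (pw 0) with 1%Z. lia. }
  split; [exact Hnd|]. rewrite !K4, T2, T1 by (reflexivity || lia). lia.
- intros s5 v Hf5 [k [Hl ->]] Hb. apply beval_zle in Hb. sim_in Hb.
  assert (Hl' := Hl). destruct Hl' as [I5 [Hkm [L1 _]]]. rewrite (proj1 I5), L1 in Hb.
  assert (Hk : (k < m)%nat) by (apply pw_lt; lia).
  apply wp_conseq with (1 := wp_level k s5 Hk Hl). intros s6 t6 _ [Hl6 Ht6].
  eexists. split; [exists (S k); split; [exact Hl6|reflexivity]|].
  replace (m - k)%nat with (S (m - S k)) by lia.
  change (total time_at k (S (m - S k))) with (time_at k + total time_at (S k) (m - S k))%nat. cost. lia.
- intros s5 v Hf5 [k [Hl ->]] Hb. apply beval_zle_false in Hb. sim_in Hb.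
  destruct Hl as [I5 [Hkm [L1 [_ [_ [_ [_ [_ [_ L9]]]]]]]]]. rewrite (proj1 I5), L1 in Hb.
  assert (Hk : k = m) by (assert (m < S k)%nat; [apply pw_lt; rewrite pw_S; pose proof (pw_pos k); lia|lia]).
  subst k. split; [cost; lia|]. intros t Ht. split; [|cost; lia].
  split; [easy|]. intros k q Hk Hq. now apply L9.
Qed.
End Build.

(** * Number of pieces *)

(** A node with [b] breaks has [b + 1] pieces, and one switch per merge makes the numbers of pieces
    at most add up. *)
Lemma breaks_curved A F n : convex F n \/ concave F n -> forall k lo, (0 <= lo)%Z -> (lo + pw k <= n)%Z ->
  (breaks A F n k lo + 1 <= 2 ^ k)%nat.
Proof.
intros Hc. induction k as [|k IH]; intros lo H1 H2; [rewrite breaks_0; simpl; lia|].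
pose proof (breaks_S A F n k lo). pose proof (jumps_curved A F n k lo Hc H1 H2).
rewrite pw_S in H2. pose proof (pw_pos k).
pose proof (IH lo ltac:(lia) ltac:(lia)). pose proof (IH (lo + pw k)%Z ltac:(lia) ltac:(lia)).
simpl. lia.
Qed.

Lemma breaks_switch3 A F n : switch_bound F n 3 -> forall k lo, (0 <= lo)%Z -> (lo + pw k <= n)%Z ->
  (breaks A F n k lo + 1 <= 6 ^ k)%nat.
Proof.
intros Hc. induction k as [|k IH]; intros lo H1 H2; [rewrite breaks_0; simpl; lia|].
pose proof (breaks_S A F n k lo). pose proof (jumps_general A F n 3 k lo Hc H1 H2).
rewrite pw_S in H2. pose proof (pw_pos k).
pose proof (IH lo ltac:(lia) ltac:(lia)). pose proof (IH (lo + pw k)%Z ltac:(lia) ltac:(lia)).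
simpl. lia.
Qed.

(** * Sums over the levels *)

(** [H i] is a guess for the sum from [i] on, verified by telescoping; this avoids closed forms of
    geometric sums with irrational ratios. *)
Lemma total_le (g : nat -> nat) (h H : nat -> R) d : forall k,
  (forall i, (k <= i < k + d)%nat -> INR (g i) <= h i) ->
  (forall i, (k <= i < k + d)%nat -> h i + H (S i) <= H i) -> 0 <= H (k + d)%nat ->
  INR (total g k d) <= H k.
Proof.
induction d; intros k H1 H2 H3; simpl total; [now rewrite Nat.add_0_r in H3|].
rewrite plus_INR. pose proof (H1 k ltac:(lia)). pose proof (H2 k ltac:(lia)).
specialize (IHd (S k)). rewrite Nat.add_succ_comm in IHd.
specialize (IHd ltac:(intros; apply H1; lia) ltac:(intros; apply H2; lia) H3). lra.
Qed.

Lemma total_le_nat g h d : forall k, (forall i, (k <= i < k + d)%nat -> (g i <= h i)%nat) ->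
  (total g k d <= total h k d)%nat.
Proof.
induction d; intros k H; simpl; [lia|]. pose proof (H k ltac:(lia)).
specialize (IHd (S k) ltac:(intros; apply H; lia)). lia.
Qed.

Lemma total_add g h d : forall k, total (fun i => (g i + h i)%nat) k d = (total g k d + total h k d)%nat.
Proof. induction d; intros k; simpl; [easy|]. rewrite IHd. lia. Qed.

Lemma total_mul c g d : forall k, total (fun i => (c * g i)%nat) k d = (c * total g k d)%nat.
Proof. induction d; intros k; simpl; [lia|]. rewrite IHd. lia. Qed.

Lemma total_shift g d : forall k, total (fun i => g (S i)) k d = total g (S k) d.
Proof. induction d; intros k; simpl; [easy|]. now rewrite IHd. Qed.

Lemma total_last g d : forall k, total g k (S d) = (total g k d + g (k + d))%nat.
Proof.
induction d; intros k; [simpl; rewrite !Nat.add_0_r; lia|].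
change (total g k (S (S d))) with (g k + total g (S k) (S d))%nat. rewrite IHd.
change (total g k (S d)) with (g k + total g (S k) d)%nat. rewrite Nat.add_succ_comm. lia.
Qed.

Definition rpow2 (x : R) : R := Rpower 2 x.

Lemma rpow2_nat k : INR (2 ^ k) = rpow2 (INR k).
Proof. unfold rpow2. rewrite Rpower_pow by lra. rewrite pow_INR. reflexivity. Qed.

Lemma rpow2_add x y : rpow2 (x + y) = rpow2 x * rpow2 y.
Proof. apply Rpower_plus. Qed.

Lemma rpow2_pos x : 0 < rpow2 x.
Proof. apply exp_pos. Qed.

Lemma rpow2_le x y : x <= y -> rpow2 x <= rpow2 y.
Proof. intros H. apply Rle_Rpower; lra. Qed.

Lemma rpow2_1 : rpow2 1 = 2.
Proof. apply Rpower_1. lra. Qed.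

Lemma rpow2_half : rpow2 (- / 2) <= 3 / 4 /\ rpow2 (/ 2) <= 3 / 2.
Proof.
assert (H := rpow2_pos (/ 2)). assert (H' := rpow2_pos (- / 2)).
assert (E : rpow2 (/ 2) * rpow2 (/ 2) = 2) by (rewrite <- rpow2_add; replace (/ 2 + / 2) with 1 by lra; apply rpow2_1).
assert (E' : rpow2 (- / 2) * rpow2 (/ 2) = 1).
{ rewrite <- rpow2_add. replace (- / 2 + / 2) with 0 by lra. apply Rpower_O. lra. }
split; nra.
Qed.

(** [3^5 = 243 <= 256 = 2^8]. *)
Lemma three_le : 3 <= rpow2 (16 / 10).
Proof.
assert (H := rpow2_pos (16 / 10)).
assert (E : rpow2 (16 / 10) ^ 5 = 256).
{ rewrite <- Rpower_pow by easy. unfold rpow2. rewrite Rpower_mult.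
  replace (16 / 10 * INR 5) with (INR 8) by (simpl; lra). rewrite Rpower_pow by lra. ring. }
apply Rnot_lt_le. intros Hlt. assert (Hp : rpow2 (16 / 10) ^ 5 <= 3 ^ 5) by (apply pow_incr; lra). lra.
Qed.

Lemma double_scale a : rpow2 (a + 1) = 2 * rpow2 a.
Proof. rewrite rpow2_add, rpow2_1. ring. Qed.

Section Weights.
Variable m : nat.
Let M := INR m.

Definition weight (caps : nat -> nat) (k : nat) : nat := (2 ^ (m - k) * caps k)%nat.

(* [n / B + 1 + B * c] for windows of length [B = 2 ^ b] and [c] runs of constant minimizers. *)
Definition windows_cap (k c : nat) : nat := let b := ((m - k) / 2)%nat in (2 ^ (m - b) + 1 + 2 ^ b * c)%nat.

Lemma weight_flat caps k : (k <= m)%nat -> (caps k <= 2 ^ m)%nat -> INR (weight caps k) <= rpow2 (2 * M - INR k).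
Proof.
intros Hk Hc. unfold weight. rewrite mult_INR, rpow2_nat, minus_INR by easy.
apply le_INR in Hc. rewrite rpow2_nat in Hc.
replace (2 * M - INR k) with ((INR m - INR k) + INR m) by (unfold M; ring). rewrite rpow2_add.
apply Rmult_le_compat_l; [left; apply rpow2_pos|easy].
Qed.

Lemma half_floor k : (k <= m)%nat -> let b := ((m - k) / 2)%nat in
  (b <= m)%nat /\ (INR m - INR k - 1) / 2 <= INR b <= (INR m - INR k) / 2.
Proof.
intros Hk b. assert (H1 := Nat.div_mod_eq (m - k) 2). assert (H2 := Nat.mod_upper_bound (m - k) 2 ltac:(lia)).
fold b in H1. split; [lia|]. rewrite <- minus_INR by easy.
assert (H3 : (2 * b <= m - k)%nat) by lia. assert (H4 : (m - k <= 2 * b + 1)%nat) by lia.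
apply le_INR in H3, H4. rewrite plus_INR, mult_INR in *. simpl in *. lra.
Qed.

(** With [l = 2^k], skips cost [n/l * n/B] on the level and single steps [n/l * B * c]. Rounding
    down the exponent of [B] costs a factor [2^(1/2) <= 3/2] in the first term; the summand 1 of
    [windows_cap] adds at most one more such term, so 3 is enough. *)
Lemma weight_windows caps k c : (k <= m)%nat -> caps k = windows_cap k c -> (1 <= c)%nat ->
  INR (weight caps k) <= 3 * rpow2 (3 / 2 * M - INR k / 2) + rpow2 (3 / 2 * (M - INR k)) * INR c.
Proof.
intros Hk E Hc. unfold weight. rewrite E. unfold windows_cap. destruct (half_floor k Hk) as [Hb1 [Hb2 Hb3]].
set (b := ((m - k) / 2)%nat) in *. fold M in Hb2, Hb3.
assert (HkM : INR k <= M) by (apply le_INR; easy).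
rewrite mult_INR, !plus_INR, mult_INR, !rpow2_nat, !minus_INR by easy. fold M. change (INR 1) with 1.
assert (E1 : rpow2 (M - INR k) * rpow2 (M - INR b) <= 3 / 2 * rpow2 (3 / 2 * M - INR k / 2)).
{ rewrite <- rpow2_add. apply Rle_trans with (rpow2 (3 / 2 * M - INR k / 2 + / 2)).
  - apply rpow2_le. lra.
  - rewrite rpow2_add. pose proof rpow2_half. pose proof (rpow2_pos (3 / 2 * M - INR k / 2)). nra. }
assert (E2 : rpow2 (M - INR k) <= rpow2 (3 / 2 * M - INR k / 2)) by (apply rpow2_le; pose proof (pos_INR k); lra).
assert (E3 : rpow2 (M - INR k) * rpow2 (INR b) <= rpow2 (3 / 2 * (M - INR k))).
{ rewrite <- rpow2_add. apply rpow2_le. lra. }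
assert (HC : 0 <= INR c) by apply pos_INR.
pose proof (rpow2_pos (3 / 2 * M - INR k / 2)). nra.
Qed.

Lemma sum_scan caps : (forall k, (k <= m)%nat -> (caps k <= 2 ^ m)%nat) ->
  INR (total (weight caps) 0 (S m)) <= 2 * rpow2 (2 * M).
Proof.
intros H. apply (Rle_trans _ (2 * rpow2 (2 * M - INR 0))); [|simpl; rewrite Rminus_0_r; lra].
apply total_le with (h := fun i => rpow2 (2 * M - INR i)) (H := fun i => 2 * rpow2 (2 * M - INR i)).
- intros i Hi. apply weight_flat; [lia|]. apply H. lia.
- intros i Hi. rewrite S_INR. replace (2 * M - INR i) with (2 * M - (INR i + 1) + 1) by ring.
  rewrite double_scale. lra.
- pose proof (rpow2_pos (2 * M - INR (0 + S m))). lra.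
Qed.

Lemma sum_unit : INR (total (weight (fun _ => 1%nat)) 0 (S m)) <= 2 * rpow2 M.
Proof.
apply (Rle_trans _ (2 * rpow2 (M - INR 0))); [|simpl; rewrite Rminus_0_r; lra].
apply total_le with (h := fun i => rpow2 (M - INR i)) (H := fun i => 2 * rpow2 (M - INR i)).
- intros i Hi. unfold weight. rewrite Nat.mul_1_r, rpow2_nat, minus_INR by lia. unfold M. lra.
- intros i Hi. rewrite S_INR. replace (M - INR i) with (M - (INR i + 1) + 1) by ring.
  rewrite double_scale. lra.
- pose proof (rpow2_pos (M - INR (0 + S m))). lra.
Qed.

(** Windows are counted on all tabulated levels; above them, scanning a level costs
    [2^(2 * m - k) <= 2^(3/2 * m)]. *)
Definition caps2 (k : nat) : nat := if (2 * k <=? m)%nat then windows_cap k (2 ^ k) else 2 ^ m.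
(** With [6^k] runs the single steps of a level cost at most [2^(3/2 * m) * 3^k], whereas scanning
    costs [2^(2 * m - k)]. Changing over at [k = m / 4] keeps the former within [2^(19/10 * m)], as
    [3^(m/4) <= 2^(2/5 * m)], and the latter within [2^(7/4 * m)]. *)
Definition caps3 (k : nat) : nat := if (4 * k <=? m)%nat then windows_cap k (6 ^ k) else 2 ^ m.

Lemma pow_ge_1 a k : (1 <= a)%nat -> (1 <= a ^ k)%nat.
Proof. intros H. induction k; simpl; nia. Qed.

Lemma sum_caps2 : INR (total (weight caps2) 0 (S m)) <= 18 * rpow2 (3 / 2 * M).
Proof.
(* The constant 16 solves [4 + 3/4 * 16 = 16], where [3/4] bounds the ratio [2^(-1/2)]; the terms
   with factor 2 are the geometric series of the scanned levels. *)
set (H := fun i => if (2 * i <=? m)%nat then 16 * rpow2 (3 / 2 * M - INR i / 2) + 2 * rpow2 (3 / 2 * M)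
  else 2 * rpow2 (2 * M - INR i)).
apply (Rle_trans _ (H 0%nat)).
- apply total_le with (h := fun i => if (2 * i <=? m)%nat then 4 * rpow2 (3 / 2 * M - INR i / 2)
    else rpow2 (2 * M - INR i)).
  + intros i Hi. destruct (Nat.leb_spec (2 * i) m) as [Hle|Hgt].
    * eapply Rle_trans; [apply (weight_windows caps2 i (2 ^ i)); [lia| |apply pow_ge_1; lia]|].
      { unfold caps2. now rewrite (proj2 (Nat.leb_le _ _) Hle). }
      rewrite rpow2_nat, <- rpow2_add. replace (3 / 2 * (M - INR i) + INR i) with (3 / 2 * M - INR i / 2) by field.
      lra.
    * apply weight_flat; [lia|]. unfold caps2. rewrite (proj2 (Nat.leb_gt _ _) Hgt). lia.
  + intros i Hi. unfold H. rewrite S_INR.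
    destruct (Nat.leb_spec (2 * i) m) as [Hle|Hgt], (Nat.leb_spec (2 * S i) m) as [Hle'|Hgt']; try lia.
    * replace (3 / 2 * M - (INR i + 1) / 2) with (3 / 2 * M - INR i / 2 + - / 2) by field.
      rewrite rpow2_add. pose proof rpow2_half. pose proof (rpow2_pos (3 / 2 * M - INR i / 2)). nra.
    * assert (Hlt : rpow2 (2 * M - (INR i + 1)) <= rpow2 (3 / 2 * M)).
      { apply rpow2_le. assert (Hx : (m <= 2 * i + 2)%nat) by lia. apply le_INR in Hx.
        rewrite plus_INR, mult_INR in Hx. simpl in Hx. unfold M. lra. }
      pose proof (rpow2_pos (3 / 2 * M - INR i / 2)). lra.
    * replace (2 * M - INR i) with (2 * M - (INR i + 1) + 1) by ring. rewrite double_scale. lra.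
  + unfold H. rewrite (proj2 (Nat.leb_gt _ _)) by lia. pose proof (rpow2_pos (2 * M - INR (0 + S m))). lra.
- unfold H. simpl. replace (3 / 2 * M - 0 / 2) with (3 / 2 * M) by field. lra.
Qed.

Lemma sum_caps3 : INR (total (weight caps3) 0 (S m)) <= 14 * rpow2 (19 / 10 * M).
Proof.
set (q := (m / 4)%nat).
assert (Hq : (4 * q <= m < 4 * q + 4)%nat).
{ assert (H1 := Nat.div_mod_eq m 4). assert (H2 := Nat.mod_upper_bound m 4 ltac:(lia)). fold q in H1. lia. }
assert (HqR : 4 * INR q <= M < 4 * INR q + 4).
{ destruct Hq as [Hq1 Hq2]. apply le_INR in Hq1. apply lt_INR in Hq2.
  rewrite ?plus_INR, mult_INR in *. simpl in *. unfold M. lra. }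
assert (HM : 0 <= M) by apply pos_INR.
(* [2 * (3 ^ S q - 3 ^ i)] is the sum of [4 * 3 ^ j] for [i <= j <= q], where [q] is the last level
   with windows. *)
set (H := fun i => if (4 * i <=? m)%nat then 2 * rpow2 (3 / 2 * M) * (3 ^ S q - 3 ^ i) + 2 * rpow2 (7 / 4 * M)
  else 2 * rpow2 (2 * M - INR i)).
apply (Rle_trans _ (H 0%nat)).
- apply total_le with (h := fun i => if (4 * i <=? m)%nat then 4 * rpow2 (3 / 2 * M) * 3 ^ i
    else rpow2 (2 * M - INR i)).
  + intros i Hi. destruct (Nat.leb_spec (4 * i) m) as [Hle|Hgt].
    * eapply Rle_trans; [apply (weight_windows caps3 i (6 ^ i)); [lia| |apply pow_ge_1; lia]|].
      { unfold caps3. now rewrite (proj2 (Nat.leb_le _ _) Hle). }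
      assert (E1 : rpow2 (3 / 2 * M - INR i / 2) <= rpow2 (3 / 2 * M)) by (apply rpow2_le; pose proof (pos_INR i); lra).
      assert (E2 : rpow2 (3 / 2 * (M - INR i)) * INR (6 ^ i) <= rpow2 (3 / 2 * M) * 3 ^ i).
      { rewrite pow_INR. replace (INR 6) with (2 * 3) by (simpl; ring). rewrite Rpow_mult_distr.
        rewrite <- (Rpower_pow i 2) by lra. fold (rpow2 (INR i)). rewrite <- Rmult_assoc, <- rpow2_add.
        apply Rmult_le_compat_r; [apply pow_le; lra|]. apply rpow2_le. pose proof (pos_INR i). lra. }
      assert (E3 : 1 <= 3 ^ i) by (apply pow_R1_Rle; lra).
      pose proof (rpow2_pos (3 / 2 * M)). nra.
    * apply weight_flat; [lia|]. unfold caps3. rewrite (proj2 (Nat.leb_gt _ _) Hgt). lia.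
  + intros i Hi. unfold H. rewrite S_INR.
    destruct (Nat.leb_spec (4 * i) m) as [Hle|Hgt], (Nat.leb_spec (4 * S i) m) as [Hle'|Hgt']; try lia.
    * change (3 ^ S i) with (3 * 3 ^ i). lra.
    * assert (i = q) as -> by lia.
      assert (Hlt : rpow2 (2 * M - (INR q + 1)) <= rpow2 (7 / 4 * M)) by (apply rpow2_le; lra).
      change (3 ^ S q) with (3 * 3 ^ q). lra.
    * replace (2 * M - INR i) with (2 * M - (INR i + 1) + 1) by ring. rewrite double_scale. lra.
  + unfold H. rewrite (proj2 (Nat.leb_gt _ _)) by lia. pose proof (rpow2_pos (2 * M - INR (0 + S m))). lra.
- unfold H. simpl (4 * 0 <=? m)%nat. cbv iota.
  assert (E1 : rpow2 (7 / 4 * M) <= rpow2 (19 / 10 * M)) by (apply rpow2_le; lra).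
  assert (E2 : rpow2 (3 / 2 * M) * 3 ^ q <= rpow2 (19 / 10 * M)).
  { apply Rle_trans with (rpow2 (3 / 2 * M) * rpow2 (16 / 10 * INR q)).
    - apply Rmult_le_compat_l; [left; apply rpow2_pos|]. unfold rpow2. rewrite <- Rpower_mult.
      rewrite Rpower_pow by apply rpow2_pos. apply pow_incr. split; [lra|apply three_le].
    - rewrite <- rpow2_add. apply rpow2_le. lra. }
  pose proof (rpow2_pos (3 / 2 * M)). pose proof (rpow2_pos (19 / 10 * M)).
  change (3 ^ S q) with (3 * 3 ^ q). nra.
Qed.

End Weights.

(** * The exponent *)

Lemma lg_ge x y : 0 < x -> rpow2 y <= x -> y <= lg x.
Proof.
intros Hx H. unfold lg. assert (Hl : 0 < ln 2) by (rewrite <- ln_1; apply ln_increasing; lra).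
apply Rmult_le_reg_r with (1 := Hl). unfold Rdiv. rewrite Rmult_assoc, Rinv_l, Rmult_1_r by lra.
unfold rpow2, Rpower in H. rewrite <- (ln_exp (y * ln 2)). apply Rcomplements.ln_le; [apply exp_pos|easy].
Qed.

Lemma lg_pow2 k : lg (INR (2 ^ k)) = INR k.
Proof.
unfold lg. rewrite rpow2_nat. unfold rpow2, Rpower. rewrite ln_exp.
assert (Hl : 0 < ln 2) by (rewrite <- ln_1; apply ln_increasing; lra). field. lra.
Qed.

Lemma exponent_ge u e : 0 <= u -> e * (1 + u) <= u * (1 + u) + 1 -> e <= u + 1 / (1 + u).
Proof.
intros Hu H. apply Rmult_le_reg_r with (1 + u); [lra|].
replace ((u + 1 / (1 + u)) * (1 + u)) with (u * (1 + u) + 1) by (field; lra). easy.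
Qed.

Lemma lg_INR_ge p q e : rpow2 e <= INR q -> (1 <= q <= p)%nat -> e <= lg (INR p).
Proof.
intros H [Hq Hp]. apply le_INR in Hp. apply lg_ge; [|lra].
apply lt_0_INR in Hq. lra.
Qed.

Definition exponent (p : nat) : R := lg (INR p) + 1 / (1 + lg (INR p)).

Lemma exponent_1 p : (1 <= p)%nat -> 1 <= exponent p.
Proof.
intros Hp. assert (H : 0 <= lg (INR p)).
{ apply (lg_INR_ge p 1); [|lia]. unfold rpow2. rewrite Rpower_O; simpl; lra. }
apply exponent_ge; [easy|nra].
Qed.

Lemma exponent_2 p : (2 <= p)%nat -> 3 / 2 <= exponent p.
Proof.
intros Hp. assert (H : 1 <= lg (INR p)).
{ apply (lg_INR_ge p 2); [|lia]. rewrite rpow2_1. simpl; lra. }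
apply exponent_ge; [lra|nra].
Qed.

(** [2^3 <= 3^2] gives [lg 3 >= 3/2]; the function [u + 1 / (1 + u)] increases for [u >= 0] and
    takes the value [19/10] at [3/2]. *)
Lemma exponent_3 p : (3 <= p)%nat -> 19 / 10 <= exponent p.
Proof.
intros Hp. assert (H : 3 / 2 <= lg (INR p)).
{ apply (lg_INR_ge p 3); [|lia]. pose proof (rpow2_pos (3 / 2)).
  assert (E : rpow2 (3 / 2) * rpow2 (3 / 2) = 8).
  { rewrite <- rpow2_add. replace (3 / 2 + 3 / 2) with (INR 3) by (simpl; lra). rewrite <- rpow2_nat. simpl; lra. }
  simpl. nra. }
apply exponent_ge; [lra|nra].
Qed.

Lemma exponent_4 p : (4 <= p)%nat -> 2 <= exponent p.
Proof.
intros Hp. assert (H : 2 <= lg (INR p)).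
{ apply (lg_INR_ge p 4); [|lia]. replace 2 with (INR 2) by (simpl; lra). rewrite <- rpow2_nat. simpl; lra. }
apply exponent_ge; [lra|nra].
Qed.

Lemma Rpower_exponent m p e : e <= exponent p -> rpow2 (e * INR m) <= Rpower (INR (2 ^ m)) (exponent p).
Proof.
intros He. rewrite rpow2_nat. unfold rpow2. rewrite Rpower_mult.
apply Rle_Rpower; [lra|]. rewrite Rmult_comm. apply Rmult_le_compat_l; [apply pos_INR|easy].
Qed.

(** * Step bounds for every merge *)

Lemma merges_windows A F m k q c : (S k <= m)%nat -> (0 <= q < pw (m - S k))%Z ->
  (forall lo, (0 <= lo)%Z -> (lo + pw (S k) <= pw m)%Z -> (jumps A F (pw m) k lo + 1 <= c)%nat) ->
  merges_within A F (pw m) false true (pw ((m - S k) / 2)) k (q * pw (S k)) (windows_cap m (S k) c).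
Proof.
intros Hk Hq Hj. pose proof (pw_pos (S k)).
assert (Hprod : (pw (m - S k) * pw (S k) = pw m)%Z) by (rewrite <- pw_add; f_equal; lia).
assert (Hlo : (0 <= q * pw (S k))%Z /\ (q * pw (S k) + pw (S k) <= pw m)%Z) by (split; nia).
apply merges_within_windows; [apply Hlo|apply Hlo|apply pw_pos|].
specialize (Hj _ (proj1 Hlo) (proj2 Hlo)). unfold windows_cap.
destruct (half_floor m (S k) Hk) as [Hb _]. set (b := ((m - S k) / 2)%nat) in *.
replace (pw m / pw b)%Z with (pw (m - b)).
- assert (Hto : forall k, Z.to_nat (pw k) = (2 ^ k)%nat) by (intros i; now rewrite pw_nat, Nat2Z.id).
  rewrite !Hto. apply Nat.add_le_mono_l, Nat.mul_le_mono_l. exact Hj.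
- replace (pw m) with (pw (m - b) * pw b)%Z by (rewrite <- pw_add; f_equal; lia).
  rewrite Z_div_mult; [easy|]. pose proof (pw_pos b). lia.
Qed.

(** Every move advances, so this holds in all modes, also on tabulated levels where the bound on
    runs is too weak. *)
Lemma merges_scan A F m lin tab B k q : (S k <= m)%nat -> (0 <= q < pw (m - S k))%Z ->
  merges_within A F (pw m) lin tab B k (q * pw (S k)) (2 ^ m).
Proof.
intros Hk Hq. pose proof (pw_pos (S k)).
assert (Hprod : (pw (m - S k) * pw (S k) = pw m)%Z) by (rewrite <- pw_add; f_equal; lia).
destruct (merges_within_scan A F (pw m) lin tab B k (q * pw (S k))) as [phi [H1 H2]]; [nia|].
exists phi. split; [exact H1|]. assert (Hto : Z.to_nat (pw m) = (2 ^ m)%nat) by now rewrite pw_nat, Nat2Z.id. lia.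
Qed.

Section Caps.
Variables (m : nat) (A : Z -> R) (f : R -> R) (lin : bool).
Hypothesis Hlin : lin = true <-> affine (onZ f) (pw m).
Let p := pf (2 ^ m) f.

Lemma pf_affine : (p <= 1)%nat -> affine (onZ f) (pw m).
Proof.
intros Hp x Hx1 Hx2. apply NNPP. intros Hne.
pose proof (pf_not_linear (2 ^ m) f x Hx1). rewrite pw_nat in Hx2. specialize (H Hx2 Hne). unfold p in Hp. lia.
Qed.

(** The program does not know [p]; only the choice of caps depends on it. The second summand stands
    for the tables, built only if [f] is not affine: then [p >= 2], and the exponent is at least
    [3/2]. *)
Lemma caps_exist : exists caps : nat -> nat,
  (forall k, (1 <= caps k)%nat) /\
  (forall k q, (S k <= m)%nat -> (0 <= q < pw (m - S k))%Z ->
     merges_within A (onZ f) (pw m) lin (tabulated m lin (S k)) (pw ((m - S k) / 2)) k (q * pw (S k))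
       (caps (S k))) /\
  INR (total (weight m caps) 0 (S m)) + (if lin then 0 else rpow2 (3 / 2 * INR m)) <=
    20 * Rpower (INR (2 ^ m)) (exponent p).
Proof.
assert (H2m : (1 <= 2 ^ m)%nat) by (apply pow_ge_1; lia).
assert (Hp1 : (1 <= p)%nat) by (apply pf_pos; lia).
assert (Hwin : forall k c, (1 <= windows_cap m k c)%nat) by (intros; unfold windows_cap; lia).
destruct lin eqn:El.
{ exists (fun _ => 1%nat). split; [easy|]. split.
  - intros k q Hk Hq. pose proof (pw_pos (S k)).
    assert (Hprod : (pw (m - S k) * pw (S k) = pw m)%Z) by (rewrite <- pw_add; f_equal; lia).
    apply merges_within_lin; [nia|nia|].
    unfold jumps. rewrite count_false; [lia|]. intros z Hz.
    apply (affine_jump A (onZ f) (pw m)); [now apply Hlin|nia|nia|nia].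
  - pose proof (sum_unit m). pose proof (Rpower_exponent m p 1 (exponent_1 p Hp1)).
    rewrite Rmult_1_l in *. pose proof (rpow2_pos (INR m)). lra. }
assert (Hp2 : (2 <= p)%nat).
{ destruct (Nat.le_gt_cases p 1) as [H|H]; [|lia]. apply pf_affine, Hlin in H. discriminate. }
assert (Ht : rpow2 (3 / 2 * INR m) <= Rpower (INR (2 ^ m)) (exponent p)) by now apply Rpower_exponent, exponent_2.
assert (Htab : forall k, tabulated m false k = (2 * k <=? m)%nat) by reflexivity.
destruct (Nat.le_gt_cases p 2) as [H2|H2]; [|destruct (Nat.le_gt_cases p 3) as [H3|H3]].
- assert (Hc : convex (onZ f) (pw m) \/ concave (onZ f) (pw m)).
  { rewrite pw_nat. apply pf_le2_monotone_slopes. exact H2. }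
  exists (caps2 m). split; [intros k; unfold caps2; destruct Nat.leb; auto|]. split.
  + intros k q Hk Hq. rewrite Htab. unfold caps2. destruct (Nat.leb_spec (2 * S k) m); [|now apply merges_scan].
    apply merges_windows; auto. intros lo H1 Hn. pose proof (jumps_curved A (onZ f) (pw m) k lo Hc H1 Hn).
    rewrite pw_S in Hn. pose proof (pw_pos k).
    pose proof (breaks_curved A (onZ f) (pw m) Hc k lo ltac:(lia) ltac:(lia)).
    pose proof (breaks_curved A (onZ f) (pw m) Hc k (lo + pw k) ltac:(lia) ltac:(lia)). simpl. lia.
  + pose proof (sum_caps2 m). pose proof (rpow2_pos (3 / 2 * INR m)). lra.
- assert (Hc : switch_bound (onZ f) (pw m) 3).
  { intros a u c d H4 H5 H6. rewrite pw_nat in H6.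
    pose proof (pf_switches (2 ^ m) f a u c d H4 H5 H6) as H7. fold p in H7. unfold onZ. lia. }
  exists (caps3 m). split; [intros k; unfold caps3; destruct Nat.leb; auto|]. split.
  + intros k q Hk Hq. rewrite Htab. unfold caps3. destruct (Nat.leb_spec (4 * S k) m); [|now apply merges_scan].
    rewrite (proj2 (Nat.leb_le _ _)) by lia.
    apply merges_windows; auto. intros lo H1 Hn. pose proof (jumps_general A (onZ f) (pw m) 3 k lo Hc H1 Hn).
    rewrite pw_S in Hn. pose proof (pw_pos k).
    pose proof (breaks_switch3 A (onZ f) (pw m) Hc k lo ltac:(lia) ltac:(lia)).
    pose proof (breaks_switch3 A (onZ f) (pw m) Hc k (lo + pw k) ltac:(lia) ltac:(lia)). simpl. lia.
  + pose proof (sum_caps3 m). pose proof (Rpower_exponent m p (19 / 10) (exponent_3 p ltac:(lia))).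
    pose proof (rpow2_pos (19 / 10 * INR m)). lra.
- exists (fun _ => 2 ^ m)%nat. split; [easy|]. split; [intros; now apply merges_scan|].
  pose proof (sum_scan m (fun _ => 2 ^ m)%nat ltac:(auto)).
  pose proof (Rpower_exponent m p 2 (exponent_4 p ltac:(lia))). pose proof (rpow2_pos (2 * INR m)). lra.
Qed.
End Caps.

(** * Totals *)

Section Totals.
Variables (m : nat) (lin : bool) (caps : nat -> nat).
Hypothesis Hcaps : forall k, (1 <= caps k)%nat.

(** Table sizes double from level to level, so the last table dominates; the truncated difference
    vanishes from the first untabulated level on. *)
Lemma table_total d : forall k,
  (total (fun i => if tabulated m lin (S i) then 700 * 2 ^ S i * 2 ^ m else 0) k d <=
    1400 * 2 ^ m * (if lin then 0 else 2 ^ (m / 2) - 2 ^ k))%nat.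
Proof.
set (g := fun i => if tabulated m lin (S i) then (700 * 2 ^ S i * 2 ^ m)%nat else 0%nat).
induction d; intros k; [apply Nat.le_0_l|]. specialize (IHd (S k)).
change (total g k (S d)) with (g k + total g (S k) d)%nat.
assert (Hg : g k = if tabulated m lin (S k) then (700 * (2 * 2 ^ k) * 2 ^ m)%nat else 0%nat).
{ unfold g. now rewrite Nat.pow_succ_r'. }
rewrite Nat.pow_succ_r' in IHd. unfold tabulated in Hg. destruct lin.
- rewrite Nat.mul_0_r in *. cbn [negb andb] in Hg. lia.
- cbn [negb andb] in Hg. destruct (Nat.leb_spec (2 * S k) m) as [H|H].
  + assert (Hk : (S k <= m / 2)%nat) by (apply Nat.div_le_lower_bound; lia).
    apply (Nat.pow_le_mono_r 2) in Hk; [|lia]. rewrite Nat.pow_succ_r' in Hk.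
    replace (2 ^ (m / 2) - 2 ^ k)%nat with (2 ^ (m / 2) - 2 * 2 ^ k + 2 ^ k)%nat by lia.
    rewrite Nat.mul_add_distr_l. lia.
  + rewrite Hg. etransitivity; [exact IHd|]. apply Nat.mul_le_mono_l. lia.
Qed.

(** Each level is paid for twice, as the result of merges (1100) and as their children (1000);
    constant terms are absorbed because caps are positive. *)
Lemma time_total : (total (time_at m lin caps) 0 m <=
  1400 * (if lin then 0 else 2 ^ (m / 2) * 2 ^ m) + 2100 * total (weight m caps) 0 (S m))%nat.
Proof.
etransitivity; [apply total_le_nat with (h := fun i =>
  ((if tabulated m lin (S i) then 700 * 2 ^ S i * 2 ^ m else 0) +
   (1100 * weight m caps (S i) + 1000 * weight m caps i))%nat)|].
- intros i Hi. unfold time_at, weight.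
  replace (m - i)%nat with (S (m - S i)) by lia.
  pose proof (pow_ge_1 2 (m - S i) ltac:(lia)). pose proof (Hcaps i). pose proof (Hcaps (S i)).
  rewrite (Nat.pow_succ_r' 2 (m - S i)). nia.
- rewrite !total_add, !total_mul, (total_shift (weight m caps)).
  pose proof (table_total m 0). pose proof (total_last (weight m caps) m 0).
  change (total (weight m caps) 0 (S m)) with (weight m caps 0 + total (weight m caps) 1 m)%nat in *.
  destruct lin; nia.
Qed.

Lemma weight_total : (2 ^ m + total (pieces_at m caps) 0 m <= total (weight m caps) 0 (S m))%nat.
Proof.
change (total (weight m caps) 0 (S m)) with (weight m caps 0 + total (weight m caps) 1 m)%nat.
rewrite <- (total_shift (weight m caps)). unfold weight at 1. rewrite Nat.sub_0_r.
pose proof (Hcaps 0). change (pieces_at m caps) with (fun i => weight m caps (S i)). nia.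
Qed.
End Totals.

Theorem theorem1 :
  exists (build query : com) (C : R) (N : nat),
  forall (m n : nat) (A : list R) (f : R -> R) (spo : spo_oracle) (p : nat),
  n = (2 ^ m)%nat -> length A = n -> spo_correct spo -> p = pf n f ->
  let bound := C * Rpower (INR n) (lg (INR p) + 1 / (1 + lg (INR p))) in
  exists (space : nat) (T : state -> Prop),
    let E := mkEnv n f spo space in
    ((N <= n)%nat -> INR space <= bound) /\
    (exists s t L,
       exec E build (init n A) s t L /\ T s /\ admissible f L /\
       ((N <= n)%nat -> INR (spo_calls L) <= bound /\ INR t <= bound)) /\
    (forall s i j x, T s -> (i <= n)%nat -> (j <= n)%nat -> (x < n)%nat ->
       exists s' t L,
         exec E query (with_args i j x s) s' t L /\ T s' /\ admissible f L /\
         result s' = F n A f i j x /\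
         ((N <= n)%nat ->
            INR (evo_calls L) <= C * (lg (INR n)) ^ 2 /\
            INR t <= C * (lg (INR n)) ^ 2)).
Proof.
(* For [n >= 2] one has [m >= 1] and [(m + 2)^2 <= 9 * m^2], which bounds a query by [3600 * m^2].
   Building takes at most [3300 * 20] times the power of [n], so 100000 covers both. *)
exists build, query, 100000, 2%nat.
intros m n A f spo p -> HA _ ->. fold (exponent (pf (2 ^ m) f)).
set (lin := if excluded_middle_informative (affine (onZ f) (pw m)) then true else false).
assert (Hlin : lin = true <-> affine (onZ f) (pw m)).
{ unfold lin. destruct excluded_middle_informative; split; easy. }
destruct (caps_exist m (arr A) f lin Hlin) as [caps [Hcaps [Hmw Hsum]]].
set (W := total (weight m caps) 0 (S m)) in *.
set (T := if lin then 0%nat else (2 ^ (m / 2) * 2 ^ m)%nat).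
set (bound := Rpower (INR (2 ^ m)) (exponent (pf (2 ^ m) f))) in *.
assert (Hwt := weight_total m caps Hcaps). fold W in Hwt.
assert (Htt := time_total m lin caps Hcaps). fold W in Htt. fold T in Htt.
assert (H2m : (1 <= 2 ^ m)%nat) by (apply pow_ge_1; lia).
assert (Hm2 : (m <= 2 ^ m)%nat) by (apply Nat.lt_le_incl, Nat.pow_gt_lin_r; lia).
assert (HWT : INR W + INR T <= 20 * bound).
{ eapply Rle_trans; [|exact Hsum]. apply Rplus_le_compat_l. unfold T. destruct lin; [simpl; lra|].
  rewrite mult_INR, !rpow2_nat, <- rpow2_add. apply rpow2_le.
  assert (Hh := Nat.div_mod_eq m 2). assert (Hh' : (2 * (m / 2) <= m)%nat) by lia.
  apply le_INR in Hh'. rewrite mult_INR in Hh'. change (INR 2) with 2 in Hh'. lra. }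
assert (HT : 0 <= INR T) by apply pos_INR. assert (HW : 0 <= INR W) by apply pos_INR.
(* [2 * 2^m] cells for [ST], one per node and one past the last, [W] for the pieces and [T] for the
   table rows. *)
set (space := (2 * 2 ^ m + W + T)%nat).
exists space, (valid m A f caps). cbv zeta.
assert (Hspace : INR space <= 100000 * bound).
{ assert (H : (space <= 3 * W + T)%nat) by (unfold space; lia).
  apply le_INR in H. rewrite plus_INR, mult_INR in H. simpl (INR 3) in H. lra. }
split; [easy|]. split.
- destruct (wp_build m A f spo space ltac:(unfold space; lia) lin caps Hlin) with (s := init (2 ^ m) A)
    as [s [t [L [Hx [Hv Ht]]]]].
  + rewrite pw_nat. unfold space. lia.
  + intros k Hk Htab. unfold tabulated in Htab. apply andb_prop in Htab. destruct Htab as [Ht1 Ht2].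
    apply Nat.leb_le in Ht2. assert (Hk2 : (2 ^ k <= 2 ^ (m / 2))%nat).
    { apply Nat.pow_le_mono_r; [lia|]. apply Nat.div_le_lower_bound; lia. }
    rewrite !pw_nat. unfold space, T. destruct lin; [discriminate|]. nia.
  + exact Hmw.
  + apply Hcaps.
  + rewrite pw_nat. unfold space. lia.
  + rewrite pw_nat. reflexivity.
  + intros z Hz. unfold init, arr. cbn [rmem Nat.eqb andb]. rewrite (proj2 (Z.leb_le 0 z)) by lia. reflexivity.
  + destruct (exec_calls _ _ _ _ _ _ Hx eq_refl) as [Hadm HL].
    exists s, t, L. split; [exact Hx|]. split; [exact Hv|]. split; [exact Hadm|]. intros _.
    assert (Htb : INR t <= 100000 * bound).
    { assert (H : (t <= 3300 * W + 1400 * T)%nat) by lia.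
      apply le_INR in H. rewrite plus_INR, !mult_INR in H.
      rewrite (INR_IZR_INZ 3300), (INR_IZR_INZ 1400) in H. simpl Z.of_nat in H. lra. }
    split; [|exact Htb]. destruct (evo_spo_calls L) as [_ Hspo].
    assert (H : (spo_calls L <= t)%nat) by lia. apply le_INR in H. lra.
- intros s i j x Hv Hi Hj Hx.
  destruct (wp_query m A f spo space ltac:(unfold space; lia) caps s i j x Hi Hj Hx Hv)
    as [s' [t [L [He [Hv' [Hres Ht]]]]]].
  destruct (exec_calls _ _ _ _ _ _ He eq_refl) as [Hadm HL].
  exists s', t, L. split; [exact He|]. split; [exact Hv'|]. split; [exact Hadm|]. split; [exact Hres|].
  intros HN. rewrite lg_pow2.
  assert (Hm1 : (1 <= m)%nat) by (destruct m; [simpl in HN; lia|lia]).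
  assert (Htb : INR t <= 100000 * INR m ^ 2).
  { assert (H : (t <= 3600 * (m * m))%nat) by nia.
    apply le_INR in H. rewrite !mult_INR in H. rewrite (INR_IZR_INZ 3600) in H. simpl Z.of_nat in H.
    pose proof (pos_INR m). simpl. nra. }
  split; [|exact Htb]. destruct (evo_spo_calls L) as [Hevo _].
  assert (H : (evo_calls L <= t)%nat) by lia. apply le_INR in H. lra.
Qed.
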